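(* Consider the polynomial Cherkas system $$\dot x=y,\qquad \dot y=P_0(x)+P_1(x)y+P_2(x)y^2,$$ where $P_0(x)=a_0+\cdots+a_nx^n$, $P_1(x)=b_0+\cdots+b_nx^n$, $P_2(x)=c_0+\cdots+c_nx^n$ are real polynomials, $n\ge 0$, $a_n^2+b_n^2+c_n^2\neq 0$, $P_0\not\equiv 0$ and $P_2\not\equiv 0$. Let ${\cal X}^{(0)}$ and (when $c_n\neq0$) ${\cal Y}^{(0)}$ be the associated vector fields defined in the context. The system is monodromic at infinity if and only if $n$ is odd and one of the following holds: (F1) $c_n=b_n=0$, $a_n<0$, and the vector field ${\cal X}^{(0)}$ has no formal invariant curves of the form $v=\Phi(u)\in\mathbb{R}[\![|u|^{\frac12}]\!]\setminus\{0\}$ with $\Phi(0)=0$; (F2) $c_n<0$ and $b_n^2-4a_nc_n<0$; (F3) $c_n<0$, $b_n^2-4a_nc_n=0$, and the vector field ${\cal Y}^{(0)}$ has no formal invariant curves of the form $y=\Psi(u)\in\mathbb{R}[\![|u|^{\frac12}]\!]$ with $\Psi(0)=0$.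
   Context: Monodromic at infinity: in the Poincaré compactification of the system (extension to the Poincaré sphere, whose equator represents infinity), no orbits of the system in $\mathbb{R}^2$ connect with (tend in forward or backward time to) any equilibrium on the equator. Put $\widetilde P_i(u):=u^nP_i(1/u)$ for $i=0,1,2$ (polynomials in $u$). Define ${\cal X}^{(0)}:=F_1^{(0)}\frac{\partial}{\partial u}+G_1^{(0)}\frac{\partial}{\partial v}$ with $$F_1^{(0)}(u,v)=u^{n+2},\qquad G_1^{(0)}(u,v)=\widetilde P_0(u)v^3+\widetilde P_1(u)v^2+\widetilde P_2(u)v,$$ and, when $c_n\neq0$, with $y_*:=-b_n/(2c_n)$, define ${\cal Y}^{(0)}:=F_2^{(0)}\frac{\partial}{\partial u}+G_2^{(0)}\frac{\partial}{\partial y}$ with $$F_2^{(0)}(u,y)=-u^{n+2}(y+y_* ),\qquad G_2^{(0)}(u,y)=\widetilde P_0(u)+\widetilde P_1(u)(y+y_* )+\widetilde P_2(u)(y+y_* )^2.$$ $\mathbb{R}[\![|u|^{\frac12}]\!]$ is the ring of formal power series in $|u|^{\frac12}$ with real coefficients. For $\Phi\in\mathbb{R}[\![|u|^{\frac12}]\!]$, the curve $v=\Phi(u)$ is a ($\frac12$-fractional) formal invariant curve of ${\cal X}^{(0)}$ if, with $C(u,v)=v-\Phi(u)$, one has ${\cal X}^{(0)}C|_{C=0}=0$ formally, i.e. $$-F_1^{(0)}(u,\Phi(u))\,\Phi'(u)+G_1^{(0)}(u,\Phi(u))=0 .$$ Such a curve is understood as a half-branch defined for $u\ge0$ or for $u\le0$: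 the identity is required as an identity of formal series on one of the two half-lines ($|u|=u$, or $|u|=-u$), not necessarily on both. Formal invariant curves $y=\Psi(u)$ of ${\cal Y}^{(0)}$ are defined in the same way. *)

(* Defs.v *)
From HB Require Import structures.
From mathcomp Require Import all_boot all_order all_algebra.
From mathcomp Require Import all_classical all_reals all_analysis.
From mathcomp Require Import ring.
Set Implicit Arguments.
Unset Strict Implicit.
Unset Printing Implicit Defensive.
Import Order.TTheory GRing.Theory Num.Theory.
Import numFieldNormedType.Exports.
Local Open Scope classical_set_scope.
Local Open Scope ring_scope.

(* A polynomial in two variables (x, y) is p : {poly {poly R}}, where y is the
   outer variable: p`_j`_i is the coefficient of x^i y^j. *)

Definition total_degree (R : realType) (p : {poly {poly R}}) : nat :=
  (\max_(j < size p | (p`_j != 0)%R) ((size (p`_j)%R).-1 + j))%N.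

(* q_2^d p(q_0/q_2, q_1/q_2), extended polynomially to q_2 = 0; it is meant for
   d >= total_degree p, so that the subtraction in the exponent is exact. *)
Definition homogenize (R : realType) (d : nat) (p : {poly {poly R}})
    (q : 'rV[R]_3) : R :=
  \sum_(j < size p) \sum_(i < size p`_j)
    p`_j`_i * q 0 0 ^+ i * q 0 1 ^+ j * q 0 2%:R ^+ (d - (i + j))%N.

Lemma homogenizeE (R : realType) (d : nat) (p : {poly {poly R}}) (q : 'rV[R]_3) :
  (total_degree p <= d)%N -> q 0 2%:R != 0 ->
  homogenize d p q =
  q 0 2%:R ^+ d * p.[(q 0 1 / q 0 2%:R)%:P].[q 0 0 / q 0 2%:R].
Proof.
move=> hd q2; rewrite (horner_coef p) horner_sum big_distrr /=.
apply: eq_bigr => j _; rewrite hornerM -polyC_exp hornerC horner_coef.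
rewrite big_distrl big_distrr /=; apply: eq_bigr => i _.
have pj0 : p`_j != 0 by rewrite -size_poly_gt0 (leq_trans _ (ltn_ord i)).
have hij : (i + j <= d)%N.
  apply: leq_trans hd.
  apply: (@leq_trans ((size (p`_j)%R).-1 + j)).
    by rewrite leq_add2r -ltnS (leq_trans (ltn_ord i)) ?leqSpred.
  exact: (@leq_bigmax_cond _ (fun l : 'I_(size p) => (p`_l != 0)%R)
            (fun l : 'I_(size p) => (size (p`_l)%R).-1 + l)%N j pj0).
rewrite -[in RHS](subnK hij) !exprD !expr_div_n.
by field; rewrite !expf_neq0.
Qed.

(* Planar polynomial vector field (p, r) : x' = p(x,y), y' = r(x,y). *)
Definition planar_field (R : realType) : Type :=
  ({poly {poly R}} * {poly {poly R}})%type.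

Definition field_degree (R : realType) (X : planar_field R) : nat :=
  maxn (total_degree X.1) (total_degree X.2).

Definition sphere2 (R : realType) : set 'rV[R]_3 :=
  [set q | q 0 0 ^+ 2 + q 0 1 ^+ 2 + q 0 2%:R ^+ 2 = 1].

(* The Poincare compactification of X, of degree d.  The central projection
   (x, y) |-> (x, y, 1) / sqrt (1 + x^2 + y^2) = q onto the open upper
   hemisphere q_2 > 0 sends X to q_2 (w - <w, q> q) with w = (p, r, 0);
   multiplying by the positive factor q_2^(d-1) (a change of time) replaces
   p, r by their homogenizations, and the result is polynomial in q, hence
   extends to the equator q_2 = 0. *)
Definition poincare_field (R : realType) (X : planar_field R) (q : 'rV[R]_3) :
    'rV[R]_3 :=
  let d := field_degree X in
  let w := \row_(i < 3) [:: homogenize d X.1 q; homogenize d X.2 q; 0]`_i in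
  w - (w *m q^T) 0 0 *: q.

Definition equilibrium_at_infinity (R : realType) (X : planar_field R)
    (q : 'rV[R]_3) : Prop :=
  [/\ sphere2 q, q 0 2%:R = 0 & poincare_field X q = 0].

(* The orbits of X in the plane, seen on the Poincare sphere: the orbits of
   the compactified field in the open upper hemisphere.  Since the sphere is
   compact, they are defined for all times. *)
Definition finite_orbit (R : realType) (X : planar_field R)
    (g : R -> 'rV[R]_3) : Prop :=
  forall t : R, [/\ sphere2 (g t), 0 < g t 0 2%:R &
                    is_derive t (1 : R) g (poincare_field X (g t))].

Lemma is_derive_coord (R : realType) (g : R -> 'rV[R]_3) (t : R) v (i : 'I_3) :
  is_derive t (1 : R) g v -> is_derive t (1 : R) (fun s => g s 0 i) (v 0 i).
Proof.
move=> [dg <-]; rewrite derive_mx // mxE; apply/derivableP.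
by move/derivable_mxP: dg.
Qed.

(* Read in the plane, a finite orbit is an orbit of X up to the positive time
   change q_2^(d-1). *)
Lemma finite_orbit_plane (R : realType) (X : planar_field R)
    (g : R -> 'rV[R]_3) (t : R) :
  finite_orbit X g ->
  let x s := g s 0 0 / g s 0 2%:R in
  let y s := g s 0 1 / g s 0 2%:R in
  let c := g t 0 2%:R ^+ field_degree X / g t 0 2%:R in
  is_derive t (1 : R) x (c * X.1.[(y t)%:P].[x t]) /\
  is_derive t (1 : R) y (c * X.2.[(y t)%:P].[x t]).
Proof.
move=> /(_ t) [_ z0 dg] x y c; have {}z0 : g t 0 2%:R != 0 by rewrite gt_eqF.
have d2 := is_derive_coord 2%:R dg.
have dV : is_derive t (1 : R) (fun s => (g s 0 2%:R)^-1)
    (- (g t 0 2%:R) ^- 2 *: poincare_field X (g t) 0 2%:R).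
  have e : derivable (fun s => g s 0 2%:R) t 1 by exact: ex_derive.
  rewrite -(derive_val (is_derive := d2)) -deriveV //; apply: DeriveDef => //.
rewrite /c /x /y ![_ / _ * _]mulrAC -!homogenizeE ?leq_maxl ?leq_maxr //.
split; apply: is_derive_eq (is_deriveM (is_derive_coord _ dg) dV) _;
  rewrite /poincare_field !mxE /= /GRing.scale /=; by field.
Qed.

Definition monodromic_at_infinity (R : realType) (X : planar_field R) : Prop :=
  ~ exists g : R -> 'rV[R]_3, exists q : 'rV[R]_3,
      [/\ finite_orbit X g, equilibrium_at_infinity X q &
          (g t @[t --> +oo] --> q) \/ (g t @[t --> -oo] --> q)].

Definition cherkas (R : realType) (P0 P1 P2 : {poly R}) : planar_field R :=
  ('X, P0%:P + P1%:P * 'X + P2%:P * 'X^2).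

(* Formal power series f = sum_k f_k s^k in s = |u|^(1/2). *)
Definition fps (R : realType) : Type := nat -> R.

Definition fps_mul (R : realType) (f g : fps R) : fps R :=
  fun k => \sum_(i < k.+1) f i * g (k - i)%N.

Definition fps_exp (R : realType) (f : fps R) (m : nat) : fps R :=
  iter m (fps_mul f) (fun k => (k == 0%N)%:R).

(* p(f, g), with f in place of the inner variable and g of the outer one *)
Definition fps_eval (R : realType) (p : {poly {poly R}}) (f g : fps R) : fps R :=
  fun k => \sum_(j < size p) \sum_(i < size p`_j)
    p`_j`_i * fps_mul (fps_exp f i) (fps_exp g j) k.

(* u = s^2 on the half-line u >= 0 (neg = false), u = - s^2 on u <= 0 *)
Definition fps_u (R : realType) (neg : bool) : fps R :=
  fun k => if k == 2%N then (-1) ^+ neg else 0.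

(* u f'(u), where ' is d/du: on either half-line u (s^k)' = (k/2) s^k.
   The factor u is there because f'(u) itself may have a term in s^(-1). *)
Definition fps_uderiv (R : realType) (f : fps R) : fps R :=
  fun k => k%:R / 2 * f k.

(* - F(u, f(u)) f'(u) + G(u, f(u)) = 0, multiplied by u *)
Definition formal_invariant_curve (R : realType) (X : planar_field R)
    (neg : bool) (f : fps R) : Prop :=
  forall k : nat,
    - fps_mul (fps_eval X.1 (fps_u R neg) f) (fps_uderiv f) k
    + fps_mul (fps_u R neg) (fps_eval X.2 (fps_u R neg) f) k = 0.

(* u^n P(1/u), for P of degree at most n *)
Definition tilde (R : realType) (n : nat) (P : {poly R}) : {poly R} :=
  \poly_(i < n.+1) P`_(n - i)%N.

(* The variables are (u, v). *)
Definition X0 (R : realType) (n : nat) (P0 P1 P2 : {poly R}) : planar_field R :=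
  (('X^(n + 2))%:P,
   (tilde n P0)%:P * 'X^3 + (tilde n P1)%:P * 'X^2 + (tilde n P2)%:P * 'X).

(* The variables are (u, y); meaningful only when P2`_n != 0. *)
Definition Y0 (R : realType) (n : nat) (P0 P1 P2 : {poly R}) : planar_field R :=
  let ystar := - P1`_n / (2 * P2`_n) in
  let yy : {poly {poly R}} := 'X + ystar%:P%:P in
  (- ('X^(n + 2))%:P * yy,
   (tilde n P0)%:P + (tilde n P1)%:P * yy + (tilde n P2)%:P * yy ^+ 2).

(* Main.v *)
Require Import Defs.
From HB Require Import structures.
From mathcomp Require Import all_boot all_order all_algebra.
From mathcomp Require Import all_classical all_reals all_analysis.
From mathcomp Require Import ring lra zify.

(** The idea.  Put s = |u|^(1/2) = |x|^(-1/2) and fix the signs sg of x and ep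
    of y.  In X = |x| and Y = |y| an orbit off the x axis solves

      Y Y' = p0 + p1 Y + p2 Y^2,  Y > 0,

    where p_i(X) = sg P_i(sg X), and p1 is moreover multiplied by ep.  The
    system fails to be monodromic at infinity exactly when, for some choice of
    the signs, this equation has a positive solution that reaches X = +oo
    ([end_sol]).  One direction is [nonmonodromic_end_sol]: along an orbit that
    tends to the equator |x| is unbounded, because log |y| is a Lipschitz
    function of x as long as x is bounded and y is bounded away from 0; and y
    keeps its sign, because it vanishes only where y' = P0(x), whose sign is
    constant for large |x|.

    For the converse it is enough to have a barrier: a function be > 0 with
    p0 + p1 be + p2 be^2 - be be' > 0 for large X.  A solution that starts above
    the graph of be stays above it, and so reaches X = +oo.  Its orbit converges
    on the sphere, since it crosses all but finitely many lines through the
    origin, far away, in one direction only, and its limit is an equilibrium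
    ([barrier_nonmonodromic]).  The orbit itself, complete in time, comes from
    Picard iteration for a bounded Lipschitz field that agrees with the
    compactified field on the sphere ([finite_orbit_exists]).

    Let q(K) = a_n + b_n K + c_n K^2.  If the leading coefficient
    sg^(n+1) q(K) is positive for some K <> 0, constants are barriers
    ([const_barrier]).  Hence monodromy forces n odd and q <= 0, which leaves
    the three cases of the theorem ([quad_le0]).  When q < 0 everywhere the
    right hand side is bounded above by a negative constant, Y^2 decreases to 0
    in finite time, and no solution reaches infinity.  In the two other cases it
    remains to compare real and formal solutions.

    Formal solutions give barriers ([formal_barrier]).  Truncate the series and
    add c s^M: to first order the residual changes by c times a function of
    fixed sign near s = 0, whose term in M cannot cancel for large M.  So one of
    the two signs of c makes the residual positive.

    Conversely a real solution forces a formal one ([end_sol_formal]).  If the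
    quadratic p0 + p1 Y + p2 Y^2 has, at leading order, two distinct real
    roots, one of them starts a formal solution unconditionally, by the
    Hensel-like lemma [ser_hensel].  If it has none, Y^2 decreases to 0 as
    before.  If it has a double root, put Y = -2 p0 / (p1 (1 + tau)), which turns
    the equation into tau' = (1 + tau) (A tau^2 + B) with A ~ A0 X^m, m = deg p2.
    Either tau ~ s^e h with e < 2m + 2 and h^2 = - B / A at leading order, or
    e = 2m + 2 and the leading coefficient of tau solves a quadratic equation
    in which tau' takes part.  When these leading equations have real roots, a
    suitable root (without resonances) gives a formal solution in powers of s;
    half-integer powers of u come from the square roots in the leading
    equations.  When they have no real root,
    (X^(m+1) tau)' X is bounded below by a positive multiple of
    1 + (X^(m+1) tau)^2, an arc tangent grows at least like log X, and no
    solution reaches infinity ([no_end_sol_of_bounds]). *)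

Set Implicit Arguments.
Unset Strict Implicit.
Unset Printing Implicit Defensive.
Import Order.TTheory GRing.Theory Num.Theory.
Import numFieldNormedType.Exports.
Local Open Scope classical_set_scope.
Local Open Scope ring_scope.

(** * Formal power series in one variable *)

(** The series get a type of their own because the functions from nat to R already
    carry the pointwise ring structure. *)
Definition ser (R : realFieldType) : Type := nat -> R.

HB.instance Definition _ (R : realFieldType) := gen_eqMixin (ser R).
HB.instance Definition _ (R : realFieldType) := gen_choiceMixin (ser R).

Section SerRing.
Variable R : realFieldType.
Implicit Types f g h : ser R.

Definition ser_add f g : ser R := fun k => f k + g k.
Definition ser_opp f : ser R := fun k => - f k.
Definition ser_mul f g : ser R := fun k => \sum_(i < k.+1) f i * g (k - i)%N.
Definition ser_of_poly (p : {poly R}) : ser R := fun k => p`_k.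
Definition ser_trunc (N : nat) f : {poly R} := \poly_(i < N) f i.

Lemma coef_trunc N f k : (k < N)%N -> (ser_trunc N f)`_k = f k.
Proof. by move=> kN; rewrite coef_poly kN. Qed.

Lemma ser_mul_trunc N f g k : (k < N)%N ->
  ser_mul f g k = (ser_trunc N f * ser_trunc N g)`_k.
Proof.
move=> kN; rewrite coefM; apply: eq_bigr => i _.
by rewrite !coef_trunc //; have := ltn_ord i; lia.
Qed.

(** A coefficient of a product only depends on coefficients of no higher order;
    this is what reduces the ring axioms of series to those of polynomials. *)
Lemma coefM_congr N (p p' q q' : {poly R}) :
  (forall k, (k < N)%N -> p`_k = p'`_k) ->
  (forall k, (k < N)%N -> q`_k = q'`_k) ->
  forall k, (k < N)%N -> (p * q)`_k = (p' * q')`_k.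
Proof.
move=> ep eq k kN; rewrite !coefM; apply: eq_bigr => i _.
by rewrite ep ?eq //; have := ltn_ord i; lia.
Qed.

Lemma ser_mulC : commutative ser_mul.
Proof.
move=> f g; apply/funext => k.
by rewrite !(@ser_mul_trunc k.+1) // mulrC.
Qed.

Lemma ser_mulA : associative ser_mul.
Proof.
move=> f g h; apply/funext => k.
rewrite !(@ser_mul_trunc k.+1) //.
transitivity ((ser_trunc k.+1 f * ser_trunc k.+1 g * ser_trunc k.+1 h)`_k).
  rewrite -mulrA; apply: (@coefM_congr k.+1) => // i ik.
  by rewrite coef_trunc // (@ser_mul_trunc k.+1).
apply: (@coefM_congr k.+1) => // i ik.
by rewrite coef_trunc // (@ser_mul_trunc k.+1).
Qed.

Lemma ser_mul1 : left_id (ser_of_poly 1) ser_mul.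
Proof.
move=> f; apply/funext => k; rewrite /ser_mul big_ord_recl /= subn0.
rewrite /ser_of_poly coefC /= mul1r big1 ?addr0 // => i _.
by rewrite coefC mul0r.
Qed.

Lemma ser_mulDl : left_distributive ser_mul ser_add.
Proof.
move=> f g h; apply/funext => k; rewrite /ser_mul /ser_add -big_split /=.
by apply: eq_bigr => i _; rewrite mulrDl.
Qed.

Lemma ser_addA : associative ser_add.
Proof. by move=> f g h; apply/funext => k; rewrite /ser_add addrA. Qed.
Lemma ser_addC : commutative ser_add.
Proof. by move=> f g; apply/funext => k; rewrite /ser_add addrC. Qed.
Lemma ser_add0 : left_id (ser_of_poly 0) ser_add.
Proof. by move=> f; apply/funext => k; rewrite /ser_add /ser_of_poly coef0 add0r. Qed.
Lemma ser_addN : left_inverse (ser_of_poly 0) ser_opp ser_add.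
Proof.
by move=> f; apply/funext => k; rewrite /ser_add /ser_of_poly coef0 addNr.
Qed.

HB.instance Definition _ := GRing.isZmodule.Build (ser R)
  ser_addA ser_addC ser_add0 ser_addN.

Lemma ser_oneN0 : ser_of_poly 1 != 0 :> ser R.
Proof.
apply/eqP => /(congr1 (fun f : ser R => f 0%N)) e.
have : (1 : {poly R})`_0 = (0 : {poly R})`_0 by exact: e.
by rewrite coef1 coef0 => /eqP; rewrite oner_eq0.
Qed.

HB.instance Definition _ := GRing.Zmodule_isComNzRing.Build (ser R)
  ser_mulA ser_mulC ser_mul1 ser_mulDl ser_oneN0.

Lemma serD f g k : (f + g) k = f k + g k. Proof. by []. Qed.
Lemma serN f k : (- f) k = - f k. Proof. by []. Qed.
Lemma serB f g k : (f - g) k = f k - g k. Proof. by []. Qed.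
Lemma ser0 k : (0 : ser R) k = 0. Proof. exact: coef0. Qed.
Lemma serM f g k : (f * g) k = \sum_(i < k.+1) f i * g (k - i)%N.
Proof. by []. Qed.
Lemma serM_trunc N f g k : (k < N)%N ->
  (f * g) k = (ser_trunc N f * ser_trunc N g)`_k.
Proof. exact: ser_mul_trunc. Qed.
Lemma serM0 f g : (f * g) 0%N = f 0%N * g 0%N.
Proof. by rewrite serM big_ord1. Qed.

Lemma ser_poly_is_additive : additive ser_of_poly.
Proof. by move=> p q; apply/funext => k; rewrite /ser_of_poly coefB. Qed.
Lemma ser_poly_is_multiplicative : multiplicative ser_of_poly.
Proof.
by split=> // p q; apply/funext => k; rewrite /ser_of_poly coefM.
Qed.
HB.instance Definition _ := GRing.isAdditive.Build {poly R} (ser R)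
  ser_of_poly ser_poly_is_additive.
HB.instance Definition _ := GRing.isMultiplicative.Build {poly R} (ser R)
  ser_of_poly ser_poly_is_multiplicative.

Definition sC (c : R) : ser R := ser_of_poly c%:P.
(** The variable s = |u|^(1/2). *)
Definition sX : ser R := ser_of_poly 'X.
(** The derivation u d/du, which multiplies s^k by k / 2; unlike d/du it preserves
    power series. *)
Definition theta f : ser R := fun k => k%:R / 2 * f k.

Lemma ser1 k : (1 : ser R) k = (k == 0%N)%:R.
Proof. exact: coef1. Qed.
Lemma sCE c k : sC c k = if k == 0%N then c else 0.
Proof. exact: coefC. Qed.
Lemma sC0 : sC 0 = 0.
Proof. by rewrite /sC polyC0 rmorph0. Qed.
Lemma sC1 : sC 1 = 1.
Proof. by rewrite /sC polyC1 rmorph1. Qed.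
Lemma sCD a b : sC (a + b) = sC a + sC b.
Proof. by rewrite /sC polyCD rmorphD. Qed.
Lemma sCN a : sC (- a) = - sC a.
Proof. by rewrite /sC polyCN rmorphN. Qed.
Lemma sCM a b : sC (a * b) = sC a * sC b.
Proof. by rewrite /sC polyCM rmorphM. Qed.
Lemma sXnE k : sX ^+ k = ser_of_poly 'X^k.
Proof. by rewrite rmorphXn. Qed.
Lemma sXn0 k : (sX ^+ k) 0%N = (k == 0%N)%:R.
Proof. by rewrite sXnE /ser_of_poly coefXn eq_sym. Qed.
Lemma coef_sXnM k f j :
  (sX ^+ k * f) j = if (j < k)%N then 0 else f (j - k)%N.
Proof.
rewrite sXnE (@serM_trunc j.+1) //.
transitivity (('X^k * ser_trunc j.+1 f)`_j).
  apply: (@coefM_congr j.+1) => // i ij; by rewrite coef_trunc.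
by rewrite coefXnM; case: ifP => // jk; rewrite coef_trunc //; lia.
Qed.
Lemma coef_sCM c f j : (sC c * f) j = c * f j.
Proof.
rewrite serM big_ord_recl /= subn0 sCE /= big1 ?addr0 // => i _.
by rewrite sCE mul0r.
Qed.

Lemma ser_factor k f : (forall j, (j < k)%N -> f j = 0) ->
  f = sX ^+ k * ((fun j => f (k + j)%N) : ser R).
Proof.
move=> fk; apply/funext => j; rewrite coef_sXnM.
by case: ltnP => jk; [rewrite fk | congr f; lia].
Qed.

Lemma sXn_inj k f g : sX ^+ k * f = sX ^+ k * g -> f = g.
Proof.
move=> e; apply/funext => j.
have := congr1 (fun h : ser R => h (k + j)%N) e.
by rewrite /= !coef_sXnM ltnNge leq_addr /= addKn.
Qed.

Lemma thetaD f g : theta (f + g) = theta f + theta g.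
Proof. by apply/funext => k; rewrite /theta !serD mulrDr. Qed.
Lemma thetaN f : theta (- f) = - theta f.
Proof. by apply/funext => k; rewrite /theta !serN mulrN. Qed.
Lemma thetaM f g : theta (f * g) = theta f * g + f * theta g.
Proof.
apply/funext => k; rewrite serD !serM /theta big_distrr -big_split /=.
apply: eq_bigr => i _; have ik : (i <= k)%N by rewrite -ltnS.
by rewrite natrB //; field.
Qed.
Lemma thetaC c : theta (sC c) = 0.
Proof.
apply/funext => k; rewrite /theta sCE ser0.
by case: eqP => [->|_]; rewrite ?mulr0 // mul0r mul0r.
Qed.
Lemma theta1 : theta 1 = 0. Proof. by rewrite -sC1 thetaC. Qed.
Lemma thetaXn k : theta (sX ^+ k) = sC (k%:R / 2) * sX ^+ k.
Proof.
apply/funext => j; rewrite coef_sCM sXnE /theta /ser_of_poly coefXn.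
by case: eqP => [->|_]; rewrite ?mulr0.
Qed.
Lemma theta_at0 f : theta f 0%N = 0.
Proof. by rewrite /theta !mul0r. Qed.

Lemma horner_taylor1 (A : comNzRingType) (p : {poly A}) (x d : A) :
  exists e, p.[x + d] = p.[x] + d * e.
Proof.
elim/poly_ind: p => [|p c [e IH]]; first by exists 0; rewrite !horner0 mulr0 addr0.
exists (p.[x] + e * (x + d)); rewrite !hornerMXaddC IH; ring.
Qed.

Lemma horner_taylor2 (A : comNzRingType) (p : {poly A}) (x d : A) :
  exists e, p.[x + d] = p.[x] + d * p^`().[x] + d ^+ 2 * e.
Proof.
elim/poly_ind: p => [|p c [e IH]].
  by exists 0; rewrite deriv0 !horner0 !mulr0 !addr0.
exists (p^`().[x] + e * (x + d)).
rewrite derivD derivC derivM derivX addr0 mulr1.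
by rewrite !hornerD !hornerM !hornerX !hornerC IH; ring.
Qed.

Lemma horner_at0 (p : {poly ser R}) f : p.[f] 0%N = p.[sC (f 0%N)] 0%N.
Proof.
have ef : f = sC (f 0%N) + sX ^+ 1 * ((fun j => f (1 + j)%N) : ser R).
  rewrite {1}(_ : f = sC (f 0%N) + (f - sC (f 0%N))); last by ring.
  congr (_ + _); rewrite [LHS](@ser_factor 1).
    by congr (_ * _); apply/funext => j; rewrite serB sCE subr0.
  by case=> // _; rewrite serB sCE /= subrr.
have [e he] := horner_taylor1 p (sC (f 0%N)) (sX ^+ 1 * ((fun j => f (1 + j)%N) : ser R)).
by rewrite {1}ef he serD -mulrA coef_sXnM addr0.
Qed.

(** The coefficients are determined one by one.  Adding c s^k to an approximate
    solution with constant term h0 leaves the coefficients of the residual below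
    s^k alone and changes that of s^k by c times the number which is assumed to
    be nonzero.  The derivative contributes to that number only if q = 0. *)
Lemma ser_hensel (q : nat) (M N : {poly ser R}) (h0 : R) :
  N.[sC h0] 0%N = 0 ->
  (forall k, (0 < k)%N ->
    (q == 0%N)%:R * (k%:R / 2) * M.[sC h0] 0%N - N^`().[sC h0] 0%N != 0) ->
  exists h : ser R, h 0%N = h0 /\ sX ^+ q * M.[h] * theta h = N.[h].
Proof.
move=> N0 lamN0.
pose G (h : ser R) := sX ^+ q * M.[h] * theta h - N.[h].
have Gexp (a r : ser R) k : exists E, G (a + sX ^+ k * r) = G a + sX ^+ k *
    (sX ^+ q * M.[a] * (sC (k%:R / 2) * r + theta r) +
     sX ^+ q * r * M^`().[a] * theta a - r * N^`().[a] + sX ^+ k * E).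
  have [e1 h1] := horner_taylor2 M a (sX ^+ k * r).
  have [e2 h2] := horner_taylor2 N a (sX ^+ k * r).
  exists (sX ^+ q * r ^+ 2 * e1 * theta a + sX ^+ q *
    (r * M^`().[a] + sX ^+ k * r ^+ 2 * e1) * (sC (k%:R / 2) * r + theta r)
    - r ^+ 2 * e2).
  rewrite /G h1 h2 thetaD thetaM thetaXn.
  by ring.
pose lam k : R := (q == 0%N)%:R * (k%:R / 2) * M.[sC h0] 0%N - N^`().[sC h0] 0%N.
pose fix a k : ser R := if k is k'.+1 then
   a k' + sX ^+ k * sC (- G (a k') k / lam k) else sC h0.
have a0 k : a k 0%N = h0.
  elim: k => [|k IH] /=; first by rewrite sCE.
  by rewrite serD IH coef_sXnM addr0.
have Ga k j : (j <= k)%N -> G (a k) j = 0.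
  elim: k j => [|k IH] j.
    rewrite leqn0 => /eqP->; rewrite /G /= serB N0 thetaC mulr0 ser0; ring.
  move=> jk /=.
  (* The new coefficient is chosen to cancel that of s^(k+1) in the residual. *)
  have [E ->] := Gexp (a k) (sC (- G (a k) k.+1 / lam k.+1)) k.+1.
  rewrite serD coef_sXnM; case: ltnP => [lt|ge]; first by rewrite IH ?addr0 //; lia.
  have -> : j = k.+1 by lia.
  rewrite subnn thetaC addr0 !serD serN !serM0 horner_at0 a0 theta_at0 mulr0.
  rewrite (horner_at0 N^`()) a0 !sXn0 !sCE /= !mul0r !addr0.
  have := lamN0 k.+1 isT; rewrite -/(lam _) => l0.
  rewrite -[X in _ = X](subrr (G (a k) k.+1)); congr (_ + _).
  have eL : (q == 0%N)%:R * M.[sC h0] 0%N * (k.+1%:R / 2) =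
      lam k.+1 + N^`().[sC h0] 0%N by rewrite /lam; ring.
  by rewrite mulrA eL; field.
pose h : ser R := fun k => a k k.
have ha k j : (j <= k)%N -> a k j = h j.
  elim: k => [|k IH]; first by rewrite leqn0 => /eqP->.
  rewrite leq_eqVlt => /orP[/eqP-> //|jk].
  by rewrite /= serD coef_sXnM jk addr0 IH.
exists h; split; first exact: a0.
apply/eqP; rewrite -subr_eq0; apply/eqP/funext => k; rewrite ser0 -/(G h).
have -> : h = a k + sX ^+ k.+1 * ((fun j => (h - a k) (k.+1 + j)%N) : ser R).
  rewrite -ser_factor; first by ring.
  by move=> j jk; rewrite serB ha ?subrr.
have [E ->] := Gexp (a k) ((fun j => (h - a k) (k.+1 + j)%N) : ser R) k.+1.
by rewrite serD coef_sXnM ltnSn addr0 Ga.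
Qed.

(** Inversion is the case of the equation 0 = f g - 1, which has no derivative. *)
Lemma ser_inv f : f 0%N != 0 -> exists g : ser R, f * g = 1.
Proof.
move=> f0; have [] := @ser_hensel 1 0 (f%:P * 'X - 1%:P) (f 0%N)^-1.
- rewrite !hornerE serB serM0 ser1 sCE /= divff //; ring.
- move=> k k0; rewrite derivB derivM !derivC derivX subr0 !mul0r sub0r add0r mulr1 hornerC.
  by rewrite oppr_eq0.
move=> g [_]; rewrite !hornerE /= => e; exists g.
by apply/eqP; rewrite -subr_eq0 -e; apply/eqP; ring.
Qed.
End SerRing.

(** * Polynomials seen from infinity *)

Ltac olia i := have := ltn_ord i; move: (nat_of_ord i) => ?; lia.
Ltac olia2 i j := have := ltn_ord i; have := ltn_ord j; move: (nat_of_ord i) (nat_of_ord j) => ? ?; lia.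

Lemma size_mul_le (R : nzRingType) (p r : {poly R}) u v N :
  (size p <= u)%N -> (size r <= v)%N -> (u + v <= N.+1)%N ->
  (size (p * r)%R <= N)%N.
Proof. by move=> sp sr uv; apply: leq_trans (size_polyMleq _ _) _; lia. Qed.

Lemma coefM_top (R : nzRingType) (p r : {poly R}) u v :
  (size p <= u.+1)%N -> (size r <= v.+1)%N -> (p * r)`_(u + v) = p`_u * r`_v.
Proof.
move=> sp sr; rewrite coefM (bigD1 (inord u)) //= inordK ?addKn; last by lia.
rewrite big1 ?addr0 // => j; rewrite -val_eqE /= inordK; last by lia.
move=> ju; case: (ltnP j u) => jlt.
  by rewrite [X in _ * X]nth_default ?mulr0 // (leq_trans sr) // ltn_subRL ltn_add2r.
by rewrite nth_default ?mul0r // (leq_trans sp) // ltn_neqAle eq_sym ju.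
Qed.

Lemma size_deriv_le (R : nzRingType) (p : {poly R}) u :
  (size p <= u.+1)%N -> (size (p^`())%R <= u)%N.
Proof.
move=> sp; case: u sp => [|u] sp.
  by move/size1_polyC: sp => ->; rewrite derivC size_poly0.
by apply: leq_trans (size_poly _ _) _; lia.
Qed.

Section Qp.
Variable R : realFieldType.
Implicit Types (p r : {poly R}) (a b h : ser R).

(** The polynomial s^(2n) p(1 / s^2), that is p read at infinity in the variable
    s = x^(-1/2). *)
Definition qp (n : nat) p : {poly R} := \sum_(i < n.+1) p`_i *: 'X^(2 * (n - i)).

Lemma qp_is_linear n : linear (qp n).
Proof.
move=> c p r; rewrite /qp scaler_sumr -big_split /=; apply: eq_bigr => i _.
by rewrite coefD coefZ scalerDl scalerA.
Qed.
HB.instance Definition _ n := GRing.isLinear.Build R {poly R} {poly R} _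
  (qp n) (qp_is_linear n).

Lemma qpXn n k : (k <= n)%N -> qp n 'X^k = 'X^(2 * (n - k)).
Proof.
move=> kn; rewrite /qp (bigD1 (Ordinal (kn : (k < n.+1)%N))) //= coefXn eqxx.
rewrite scale1r big1 ?addr0 // => i ik; rewrite coefXn.
case: eqP => [e|_]; last by rewrite scale0r.
by move: ik; rewrite -(inj_eq val_inj) /= e eqxx.
Qed.

Lemma qpE n p : (size p <= n.+1)%N -> qp n p = \sum_(i < size p) p`_i *: 'X^(2 * (n - i)).
Proof.
move=> sp; rewrite -{1}[p]coefK poly_def linear_sum; apply: eq_bigr => i _.
by rewrite linearZ /= qpXn // -ltnS (leq_trans (ltn_ord i)).
Qed.

Lemma qpM n m p r : (size p <= n.+1)%N -> (size r <= m.+1)%N ->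
  qp (n + m) (p * r) = qp n p * qp m r.
Proof.
move=> sp sr; rewrite -{1}[p]coefK -{1}[r]coefK !poly_def (qpE sp) (qpE sr).
rewrite !big_distrl linear_sum; apply: eq_bigr => i _.
rewrite !big_distrr linear_sum; apply: eq_bigr => j _ /=.
rewrite -!scalerAl -!scalerAr -!exprD !linearZ /= qpXn; last first.
  by olia2 i j.
rewrite scalerA mulrC -scalerA; congr (_ *: (_ *: 'X^_)).
by olia2 i j.
Qed.

Lemma qp_shift n k p : (size p <= k.+1)%N -> (k <= n)%N ->
  qp n p = 'X^(2 * (n - k)) * qp k p.
Proof.
move=> sp kn; rewrite !qpE //; last by lia.
rewrite big_distrr; apply: eq_bigr => i _ /=; rewrite -scalerAr -exprD.
by congr (_ *: 'X^_); olia i.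
Qed.

Lemma qp_at0 k p : (qp k p)`_0 = p`_k.
Proof.
rewrite /qp coef_sum big_ord_recr /= subnn muln0 coefZ expr0 coef1 mulr1.
rewrite big1 ?add0r // => i _; rewrite coefZ coefXn.
by rewrite (_ : _ == _ = false) ?mulr0 //; olia i.
Qed.

Lemma horner_qp n p s : s != 0 -> (size p <= n.+1)%N ->
  (qp n p).[s] = s ^+ (2 * n) * p.[s ^- 2].
Proof.
move=> s0 sp; rewrite (qpE sp) horner_sum horner_coef big_distrr /=.
apply: eq_bigr => i _; rewrite hornerZ hornerXn mulrCA; congr (_ * _).
have ip : (i <= n)%N by rewrite -ltnS (leq_trans (ltn_ord i)).
rewrite -exprVn -exprM mulnBr exprVn.
apply: (mulIf (expf_neq0 (2 * i) s0)).
by rewrite -exprD subnK ?leq_mul2l ?ip ?orbT // mulfVK // expf_neq0.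
Qed.

Definition qs n p : ser R := ser_of_poly (qp n p).

Lemma qsM n m p r : (size p <= n.+1)%N -> (size r <= m.+1)%N ->
  qs (n + m) (p * r) = qs n p * qs m r.
Proof. by move=> sp sr; rewrite /qs qpM // rmorphM. Qed.
Lemma qsD n p r : qs n (p + r) = qs n p + qs n r.
Proof. by rewrite /qs !raddfD. Qed.
Lemma qsB n p r : qs n (p - r) = qs n p - qs n r.
Proof. by rewrite /qs !raddfB. Qed.
Lemma qsMn n p k : qs n (p *+ k) = qs n p *+ k.
Proof. by rewrite /qs !raddfMn. Qed.
Lemma qs0 n : qs n 0 = 0.
Proof. by rewrite /qs !raddf0. Qed.
Lemma qs_shift n k p : (size p <= k.+1)%N -> (k <= n)%N ->
  qs n p = sX R ^+ (2 * (n - k)) * qs k p.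
Proof. by move=> sp kn; rewrite /qs (qp_shift sp kn) rmorphM /= rmorphXn. Qed.
Lemma qs_at0 k p : qs k p 0%N = p`_k. Proof. exact: qp_at0. Qed.

(** Since x d/dx = - u d/du, the Euler operator acts on u^n p(1/u) as n minus the
    Euler operator on p. *)
Lemma theta_qs n p :
  theta (qs n.+1 p) = sC n.+1%:R * qs n.+1 p - qs n p^`().
Proof.
have eq1 : qs n.+1 p = \sum_(i < n.+2) sC p`_i * sX R ^+ (2 * (n.+1 - i)).
  rewrite /qs /qp raddf_sum; apply: eq_bigr => i _.
  by rewrite /= -mul_polyC rmorphM /= rmorphXn.
have eq2 : qs n p^`() = \sum_(i < n.+1) sC p^`()`_i * sX R ^+ (2 * (n - i)).
  rewrite /qs /qp raddf_sum; apply: eq_bigr => i _.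
  by rewrite /= -mul_polyC rmorphM /= rmorphXn.
have thsum (I : Type) (l : seq I) (F : I -> ser R) :
  theta (\sum_(i <- l) F i) = \sum_(i <- l) theta (F i).
  apply: (big_morph (@theta R)); first exact: thetaD.
  by rewrite -sC0 thetaC sC0.
rewrite eq1 eq2 thsum big_ord_recl [\sum_(i < n.+2) sC p`_i * _]big_ord_recl mulrDr -addrA.
congr (_ + _).
  rewrite thetaM thetaC mul0r add0r thetaXn /= subn0 natrM mulrC.
  by rewrite [2 * _]mulrC mulfK ?pnatr_eq0 //; ring.
rewrite big_distrr -sumrB; apply: eq_bigr => i _.
rewrite lift0 thetaM thetaC mul0r add0r thetaXn coef_deriv /= subSS natrM.
rewrite [2 * _]mulrC mulfK ?pnatr_eq0 // natrB; last by rewrite -ltnS.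
by rewrite -mulr_natr -!natr1 !(sCM, sCD, sCN, sC1); ring.
Qed.
End Qp.

(** * Formal solutions of the orbit equation *)

Section OrbitForm.
Variable R : realFieldType.
Implicit Types (p r : {poly R}) (a b h g f : ser R).
Local Notation sX := (sX R).

(** For Y = a / b this is b^3 times s^(2n+2) Y theta(Y) + Q0 + Q1 Y + Q2 Y^2, so its
    zeros are the formal solutions of the equation of the orbits near infinity.
    The case b = 1 is the equation in y, the case a = 1 the one in v = 1 / y, and
    the homogeneous form avoids Laurent series in between. *)
Definition orbit_form (n : nat) (p0 p1 p2 : {poly R}) a b : ser R :=
  sX ^+ (2 * n + 2) * a * (b * theta a - a * theta b)
  + b * (qs n p0 * b ^+ 2 + qs n p1 * (a * b) + qs n p2 * a ^+ 2).

Lemma orbit_formZ n p0 p1 p2 g a b :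
  orbit_form n p0 p1 p2 (g * a) (g * b) = g ^+ 3 * orbit_form n p0 p1 p2 a b.
Proof. by rewrite /orbit_form !thetaM; ring. Qed.

Lemma orbit_form_cancel n p0 p1 p2 k a b :
  orbit_form n p0 p1 p2 (sX ^+ k * a) (sX ^+ k * b) = 0 -> orbit_form n p0 p1 p2 a b = 0.
Proof.
rewrite orbit_formZ -exprM => e; apply: (@sXn_inj _ (k * 3)); by rewrite e mulr0.
Qed.

Lemma serXn0 f k : (f ^+ k) 0%N = f 0%N ^+ k.
Proof. by elim: k => [|k IH]; rewrite ?expr0 ?ser1 // exprS serM0 IH exprS. Qed.

(** The factor s^q.+1 keeps the derivative out of the leading balance, so any simple
    root of the leading quadratic polynomial extends to a series.  The exponents
    d0 and d1 tell which terms take part in that polynomial. *)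
Lemma simple_root_series (q d0 d1 : nat) (q0 q1 q2 : ser R) (gam h0 : R) :
  (d0 == 0%N)%:R * q0 0%N + (d1 == 0%N)%:R * q1 0%N * h0 + q2 0%N * h0 ^+ 2 = 0 ->
  (d1 == 0%N)%:R * q1 0%N + 2 * q2 0%N * h0 != 0 ->
  exists h : ser R, h 0%N = h0 /\
    sX ^+ q.+1 * h * (theta h + sC gam * h) +
      (sX ^+ d0 * q0 + sX ^+ d1 * q1 * h + q2 * h ^+ 2) = 0.
Proof.
move=> root simple.
pose q0' := - (sX ^+ d0 * q0); pose q1' := - (sX ^+ d1 * q1).
pose q2' := - (q2 + sX ^+ q.+1 * sC gam).
have at0E := (@serN R, @serD R, @serM0 R, @sXn0 R, @sCE R, @serXn0, @ser1 R, @ser0 R).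
have [] := @ser_hensel _ q.+1 'X ((q2'%:P * 'X + q1'%:P) * 'X + q0'%:P) h0.
- rewrite !(hornerMXaddC, hornerM, hornerD, hornerX, hornerC) /q0' /q1' /q2' !at0E /=.
  by apply/eqP; rewrite -oppr_eq0 -[X in _ == X]root; apply/eqP; ring.
- move=> k _; rewrite !(derivD, derivM, derivC, derivX).
  rewrite !(hornerM, hornerD, hornerX, hornerC, horner0) /q1' /q2' !at0E /=.
  apply: contra_neq simple => e; rewrite -[RHS]e; ring.
move=> h [h00]; rewrite !(hornerMXaddC, hornerM, hornerD, hornerX, hornerC) => e.
exists h; split => //.
by rewrite mulrDr e /q0' /q1' /q2'; ring.
Qed.

(** A series tau = s^(e+1) h of order so low that the derivative, which carries the
    factor s^(q+1), does not take part in the leading balance: a nonzero root h0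
    of q1^3 h^2 = w is simple. *)
Lemma double_root_series_low (q e : nat) (c0 q1 w : ser R) (h0 : R) :
  q1 0%N ^+ 3 * h0 ^+ 2 = w 0%N -> q1 0%N * h0 != 0 ->
  exists h : ser R, h 0%N = h0 /\
   sX ^+ q.+1 * c0 * (theta h + sC (e.+1%:R / 2) * h) =
     (1 + sX ^+ e.+1 * h) * (q1 ^+ 3 * h ^+ 2 - w).
Proof.
move=> root simple.
have at0E := (@serN R, @serD R, @serM0 R, @sXn0 R, @sCE R, @serXn0, @ser1 R, @ser0 R).
pose K := sX ^+ q.+1 * c0 * sC (e.+1%:R / 2).
have [] := @ser_hensel _ q.+1 c0%:P ((1%:P + (sX ^+ e.+1)%:P * 'X) *
   ((q1 ^+ 3)%:P * 'X * 'X - w%:P) - K%:P * 'X) h0.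
- rewrite !(hornerM, hornerD, hornerN, hornerX, hornerC) /K !at0E /= -root.
  ring.
- move=> k _; rewrite !(derivB, derivD, derivM, derivC, derivX).
  rewrite !(hornerM, hornerD, hornerN, hornerX, hornerC, horner0) /K !at0E /=.
  rewrite -root.
  have : 2 * q1 0%N ^+ 3 * h0 != 0.
    rewrite exprS; apply: contra_neq simple => /eqP.
    rewrite !mulf_eq0 !pnatr_eq0 /= orbb => /orP[|/eqP->]; last by rewrite mulr0.
    by rewrite orbb => /eqP ->; rewrite mul0r.
  apply: contra_neq => e'; rewrite -[RHS]oppr0 -e'; ring.
move=> h [h00]; rewrite !(hornerM, hornerD, hornerN, hornerX, hornerC) => e'.
exists h; split => //; rewrite mulrDr e' /K; ring.
Qed.

(** A series tau = s^(2m+2) h, for which the derivative is of the same order as the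
    other terms.  The condition on k excludes resonances between the
    linearization at h0 and the exponents k / 2. *)
Lemma double_root_series_high (m : nat) (c0 q1 w : ser R) (h0 : R) :
  c0 0%N * m.+1%:R * h0 = q1 0%N ^+ 3 * h0 ^+ 2 - w 0%N ->
  (forall k, (0 < k)%N ->
     k%:R / 2 * c0 0%N + m.+1%:R * c0 0%N - 2 * q1 0%N ^+ 3 * h0 != 0) ->
  exists h : ser R, h 0%N = h0 /\
   c0 * (theta h + sC m.+1%:R * h) =
     (1 + sX ^+ (2 * m).+2 * h) * (q1 ^+ 3 * h ^+ 2 - w).
Proof.
move=> root simple.
have at0E := (@serN R, @serD R, @serM0 R, @sXn0 R, @sCE R, @serXn0, @ser1 R, @ser0 R).
pose K := c0 * sC m.+1%:R.
have [] := @ser_hensel _ 0 c0%:P ((1%:P + (sX ^+ (2 * m).+2)%:P * 'X) *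
   ((q1 ^+ 3)%:P * 'X * 'X - w%:P) - K%:P * 'X) h0.
- rewrite !(hornerM, hornerD, hornerN, hornerX, hornerC) /K !at0E /=.
  by rewrite -[RHS](subrr (c0 0%N * m.+1%:R * h0)) {2}root; ring.
- move=> k k0; rewrite !(derivB, derivD, derivM, derivC, derivX).
  rewrite !(hornerM, hornerD, hornerN, hornerX, hornerC, horner0) /K !at0E /=.
  have := simple _ k0; apply: contra_neq => e'; rewrite -[RHS]e'; ring.
move=> h [h00]; rewrite !(hornerM, hornerD, hornerN, hornerX, hornerC) => e'.
exists h; split => //; rewrite mulrDr -[c0 * theta h]mul1r -(expr0 sX) mulrA e' /K; ring.
Qed.
End OrbitForm.

(** The substitution Y = -2 p0 / (p1 (1 + tau)) centres the equation of the orbits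
    at the double root of its leading part.  The first summand is p1 times the
    discriminant of p0 + p1 Y + p2 Y^2, the second one comes from the motion of
    the centre with x. *)
Definition drift_disc (R : comNzRingType) (p0 p1 p2 : {poly R}) : {poly R} :=
  p1 * (p1 * p1 - p0 * p2 *+ 4) + (p1 * p0^`() - p0 * p1^`()) *+ 4.

Section SimpleRoot.
Variable R : rcfType.
Implicit Types (p r : {poly R}) (a b h g f : ser R).
Local Notation sX := (sX R).

(** Solutions of the form Y = s^(i - j) h.  The two equations between exponents say
    that the three terms of the quadratic have the common factor
    s^(2 (n - m) + 2 i + j), up to the surplus d0 and d1. *)
Lemma simple_root_formal n k0 k1 m (p0 p1 p2 : {poly R}) i j d0 d1 (h0 : R) :
  (size p0 <= k0.+1)%N -> (size p1 <= k1.+1)%N -> (size p2 <= m.+1)%N ->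
  (k0 <= n)%N -> (k1 <= n)%N -> (m <= n)%N ->
  (2 * (n - k0) + 2 * j = d0 + 2 * (n - m) + 2 * i)%N ->
  (2 * (n - k1) + j = d1 + 2 * (n - m) + i)%N ->
  (d0 == 0%N)%:R * p0`_k0 + (d1 == 0%N)%:R * p1`_k1 * h0 + p2`_m * h0 ^+ 2 = 0 ->
  (d1 == 0%N)%:R * p1`_k1 + 2 * p2`_m * h0 != 0 ->
  exists h : ser R, h 0%N = h0 /\ orbit_form n p0 p1 p2 (sX ^+ i * h) (sX ^+ j) = 0.
Proof.
move=> s0 s1 s2 k0n k1n mn e0 e1 root simple.
have [] := @simple_root_series R (2 * m).+1 d0 d1 (qs k0 p0) (qs k1 p1) (qs m p2)
   (i%:R / 2 - j%:R / 2) h0.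
- by rewrite !qs_at0.
- by rewrite !qs_at0.
move=> h [h00 eh]; exists h; split => //.
rewrite /orbit_form (qs_shift s0 k0n) (qs_shift s1 k1n) (qs_shift s2 mn).
have -> : sX ^+ (2 * n + 2) = sX ^+ (2 * m).+2 * sX ^+ (2 * (n - m)).
  by rewrite -exprD; congr (_ ^+ _); lia.
have E0 : sX ^+ (2 * (n - k0)) * (sX ^+ j) ^+ 2 =
  sX ^+ d0 * (sX ^+ (2 * (n - m)) * (sX ^+ i) ^+ 2).
  by rewrite -!exprM -!exprD; congr (_ ^+ _); lia.
have E1 : sX ^+ (2 * (n - k1)) * (sX ^+ j) =
  sX ^+ d1 * (sX ^+ (2 * (n - m)) * sX ^+ i).
  by rewrite -!exprD; congr (_ ^+ _); lia.
rewrite thetaM !thetaXn.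
transitivity (sX ^+ j * (sX ^+ (2 * (n - m)) * (sX ^+ i) ^+ 2) * 0 : ser R);
  last by rewrite mulr0.
rewrite -eh sCD sCN.
have F0 : qs k0 p0 * (sX ^+ (2 * (n - k0)) * sX ^+ j ^+ 2) =
  qs k0 p0 * (sX ^+ d0 * (sX ^+ (2 * (n - m)) * sX ^+ i ^+ 2)) by rewrite E0.
have F1 : qs k1 p1 * (sX ^+ i * h) * (sX ^+ (2 * (n - k1)) * sX ^+ j) =
  qs k1 p1 * (sX ^+ i * h) * (sX ^+ d1 * (sX ^+ (2 * (n - m)) * sX ^+ i)).
  by rewrite E1.
set X1 := sX ^+ j * (_ + _ + _).
have -> : X1 = sX ^+ j * (qs k0 p0 * (sX ^+ (2 * (n - k0)) * sX ^+ j ^+ 2) +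
   qs k1 p1 * (sX ^+ i * h) * (sX ^+ (2 * (n - k1)) * sX ^+ j) +
   sX ^+ (2 * (n - m)) * qs m p2 * (sX ^+ i * h) ^+ 2) by rewrite /X1; ring.
rewrite F0 F1; ring.
Qed.

Lemma qs_drift_disc n' (p0 p1 p2 : {poly R}) (n := n'.+1) :
  (size p0 <= n.+1)%N -> (size p1 <= n.+1)%N -> (size p2 <= n.+1)%N ->
  qs (n + (n + n)) (drift_disc p0 p1 p2) =
  qs n p1 * (qs n p1 ^+ 2 - 4%:R * qs n p0 * qs n p2) -
  4%:R * sX ^+ (2 * n + 2) *
    (qs n p1 * theta (qs n p0) - qs n p0 * theta (qs n p1)).
Proof.
move=> s0 s1 s2.
have sM (p r : {poly R}) u v : (size p <= u.+1)%N -> (size r <= v.+1)%N ->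
    (size (p * r)%R <= (u + v).+1)%N.
  by move=> sp sr; apply: leq_trans (size_polyMleq _ _) _; lia.
rewrite /drift_disc qsD qsMn; congr (_ + _).
  rewrite qsM //; last first.
    apply: leq_trans (size_polyD _ _) _; rewrite geq_max size_polyN !sM //=.
    by rewrite -scaler_nat (leq_trans (size_scale_leq _ _)) ?sM.
  rewrite qsB qsMn !qsM // -mulr_natl; ring.
rewrite (@qs_shift _ _ (n + n')); first last.
- by rewrite /n; lia.
- apply: leq_trans (size_polyD _ _) _; rewrite geq_max size_polyN !sM //=; exact: size_deriv_le.
have -> : (2 * (n + (n + n) - (n + n')) = 2 * n + 2)%N by rewrite /n; lia.
rewrite qsB !qsM ?size_deriv_le // !theta_qs -/n.
ring.
Qed.
End SimpleRoot.

Section DoubleRoot.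
Variable R : rcfType.
Implicit Types (p r : {poly R}) (a b h g f : ser R).
Local Notation sX := (sX R).

(** The quadratic p0 b^2 + p1 a b + p2 a^2 becomes p0 (p1^2 tau^2 - D), with D its
    discriminant, for a = -2 p0 and b = p1 (1 + tau). *)
Lemma orbit_form_of_tau n' (p0 p1 p2 : {poly R}) (tau : ser R) (n := n'.+1)
  (Q0 := qs n p0) (Q1 := qs n p1) :
  (size p0 <= n.+1)%N -> (size p1 <= n.+1)%N -> (size p2 <= n.+1)%N ->
  4%:R * sX ^+ (2 * n + 2) * Q0 * Q1 * theta tau =
    (1 + tau) * (Q1 ^+ 3 * tau ^+ 2 - qs (n + (n + n)) (drift_disc p0 p1 p2)) ->
  orbit_form n p0 p1 p2 (- (2%:R * Q0)) (Q1 * (1 + tau)) = 0.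
Proof.
move=> s0 s1 s2; rewrite qs_drift_disc // -/n -/Q0 -/Q1 => e.
have th2 : theta (2%:R : ser R) = 0.
  by rewrite (_ : 2%:R = 1 + 1 :> ser R) // thetaD theta1 addr0.
rewrite /orbit_form -/Q0 -/Q1 thetaN !thetaM th2 thetaD theta1.
transitivity (Q0 * ((1 + tau) * (Q1 ^+ 3 * tau ^+ 2 -
   (Q1 * (Q1 ^+ 2 - 4%:R * Q0 * qs n p2) - 4%:R * sX ^+ (2 * n + 2) *
    (Q1 * theta Q0 - Q0 * theta Q1))) - 4%:R * sX ^+ (2 * n + 2) * Q0 * Q1 * theta tau)).
  by ring.
by rewrite e subrr mulr0.
Qed.

(** At a double root the terms of degree 2 k1 of the discriminant cancel, and the
    other summand has degree at most k0 + k1 - 1 < 3 k1. *)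
Lemma size_drift_disc k0 k1 m (p0 p1 p2 : {poly R}) :
  (size p0 <= k0.+1)%N -> (size p1 <= k1.+1)%N -> (size p2 <= m.+1)%N ->
  (2 * k1 = k0 + m)%N -> (0 < k1)%N -> p1`_k1 ^+ 2 = 4 * p0`_k0 * p2`_m ->
  (size (drift_disc p0 p1 p2) <= 3 * k1)%N.
Proof.
move=> s0 s1 s2 e k10 disc.
have sQ : (size (p1 * p1 - p0 * p2 *+ 4)%R <= 2 * k1)%N.
  have : (size (p1 * p1 - p0 * p2 *+ 4)%R <= (2 * k1).+1)%N.
    apply: leq_trans (size_polyD _ _) _; rewrite geq_max size_polyN -scaler_nat.
    rewrite (size_mul_le s1 s1) ?(leq_trans (size_scale_leq _ _)) //; last by lia.
    by apply: (size_mul_le s0 s2); lia.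
  rewrite leq_eqVlt => /orP[/eqP se|//].
  have : (p1 * p1 - p0 * p2 *+ 4)`_(2 * k1) = 0.
    rewrite coefB coefMn {2}e mul2n -addnn !coefM_top // -expr2 disc; ring.
  have -> : (2 * k1 = (size (p1 * p1 - p0 * p2 *+ 4)%R).-1)%N by rewrite se.
  by move/eqP; rewrite -lead_coefE lead_coef_eq0 => /eqP z; move: se; rewrite z size_poly0.
rewrite /drift_disc; apply: leq_trans (size_polyD _ _) _; rewrite geq_max.
rewrite (size_mul_le s1 sQ) /=; last by lia.
rewrite -scaler_nat (leq_trans (size_scale_leq _ _)) //.
apply: leq_trans (size_polyD _ _) _; rewrite geq_max size_polyN.
rewrite (size_mul_le s1 (size_deriv_le s0)); last by lia.
by rewrite (size_mul_le s0 (size_deriv_le s1)) //; lia.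
Qed.

(** Comparing orders, tau^2 is of the order of drift_disc / p1^3, that is
    s^(2 (3 k1 - om)), as long as this dominates s^(4m+4).  Then the sign of the
    leading coefficients decides whether tau is real.  Otherwise tau is of order
    s^(2m+2) and its leading coefficient solves a quadratic equation, whose
    discriminant is the last condition. *)
Lemma double_root_formal n' k0 k1 m (p0 p1 p2 : {poly R}) (n := n'.+1)
    (W := drift_disc p0 p1 p2) (om := (size W).-1) :
  (size p0 <= k0.+1)%N -> (size p1 <= k1.+1)%N -> (size p2 <= m.+1)%N ->
  (k0 <= n)%N -> (k1 <= n)%N -> (m <= n)%N ->
  (2 * k1 = k0 + m)%N -> (0 < k1)%N -> p1`_k1 ^+ 2 = 4 * p0`_k0 * p2`_m ->
  p0`_k0 < 0 -> p1`_k1 != 0 ->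
  (W != 0 -> (3 * k1 < om + 2 * m + 2)%N -> 0 < p1`_k1 * lead_coef W) ->
  (W != 0 -> (3 * k1 = om + 2 * m + 2)%N ->
     0 <= 16 * p0`_k0 ^+ 2 * m.+1%:R ^+ 2 + 4 * p1`_k1 * lead_coef W) ->
  exists tau : ser R, tau 0%N = 0 /\
    orbit_form n p0 p1 p2 (- (2%:R * qs n p0)) (qs n p1 * (1 + tau)) = 0.
Proof.
move=> s0 s1 s2 k0n k1n mn e k10 disc a0 b0 condA condB.
have sW : (size W <= 3 * k1)%N := size_drift_disc s0 s1 s2 e k10 disc.
suff [tau [t0 et]] : exists tau : ser R, tau 0%N = 0 /\
   4%:R * sX ^+ (2 * n + 2) * qs n p0 * qs n p1 * theta tau =
    (1 + tau) * (qs n p1 ^+ 3 * tau ^+ 2 - qs (n + (n + n)) W).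
  exists tau; split => //; apply: orbit_form_of_tau => //;
  [apply: leq_trans s0 _ | apply: leq_trans s1 _ | apply: leq_trans s2 _]; rewrite /n; lia.
rewrite (qs_shift s0 k0n) (qs_shift s1 k1n).
set q0 := qs k0 p0; set q1 := qs k1 p1.
pose a := p0`_k0; pose b := p1`_k1.
have q00 : q0 0%N = a by rewrite /q0 qs_at0.
have q10 : q1 0%N = b by rewrite /q1 qs_at0.
have Eq3 : (sX ^+ (2 * (n - k1)) * q1) ^+ 3 = sX ^+ (6 * (n - k1)) * q1 ^+ 3.
  by rewrite exprMn -exprM; congr (sX ^+ _ * _); lia.
rewrite Eq3.
have Elhs : sX ^+ (2 * n + 2) * sX ^+ (2 * (n - k0)) * sX ^+ (2 * (n - k1)) =
   sX ^+ (6 * (n - k1)) * sX ^+ (2 * m).+2.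
  by rewrite -!exprD; congr (_ ^+ _); lia.
case: (boolP ((W != 0) && (3 * k1 < om + 2 * m + 2)%N)) => [/andP[W0 lt]|].
  have lc := condA W0 lt.
  pose e1 := (3 * k1 - om)%N.
  have sW0 : (0 < size W)%N by rewrite size_poly_gt0.
  have [q qe] : exists q, q.+1 = ((2 * m).+2 - e1)%N by exists ((2 * m).+1 - e1)%N; lia.
  have [e2 ee] : exists e2, e2.+1 = e1 by exists e1.-1; rewrite /e1 /om; lia.
  have lW : qs om W 0%N = lead_coef W by rewrite qs_at0.
  have bl : 0 < lead_coef W / b ^+ 3.
    have -> : lead_coef W / b ^+ 3 = (b * lead_coef W) / b ^+ 4 by rewrite /b; field.
    rewrite divr_gt0 //; rewrite (_ : b ^+ 4 = (b ^+ 2) ^+ 2); last by ring.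
    by rewrite exprn_even_gt0 // expf_neq0.
  have [] := @double_root_series_low R q e2 (4%:R * q0 * q1) q1 (qs om W) (Num.sqrt (lead_coef W / b ^+ 3)).
  - by rewrite lW q10 sqr_sqrtr ?ltW // mulrC divfK // expf_neq0.
  - by rewrite q10 mulf_neq0 // sqrtr_eq0 -ltNge.
  move=> h [h0 eh]; exists (sX ^+ e2.+1 * h); split.
    by rewrite coef_sXnM.
  have -> : qs (n + (n + n)) W = sX ^+ (6 * (n - k1)) * (sX ^+ e2.+1) ^+ 2 * qs om W.
    rewrite (@qs_shift _ _ om); first last.
    - by rewrite /om; lia.
    - by rewrite /om prednK.
    by congr (_ * _); rewrite -exprM -exprD; congr (_ ^+ _); rewrite ee /e1; lia.
  rewrite thetaM thetaXn.
  transitivity (4%:R * (sX ^+ (2 * n + 2) * sX ^+ (2 * (n - k0)) * sX ^+ (2 * (n - k1)))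
     * q0 * q1 * (sC (e2.+1%:R / 2) * sX ^+ e2.+1 * h + sX ^+ e2.+1 * theta h)).
    ring.
  rewrite Elhs.
  have -> : sX ^+ (2 * m).+2 = sX ^+ q.+1 * sX ^+ e2.+1.
    by rewrite -exprD; congr (_ ^+ _); rewrite ee /e1; lia.
  transitivity (sX ^+ (6 * (n - k1)) * (sX ^+ e2.+1) ^+ 2 *
    ((1 + sX ^+ e2.+1 * h) * (q1 ^+ 3 * h ^+ 2 - qs om W))); last by ring.
  rewrite -eh; ring.
rewrite negb_and negbK -leqNgt => caseB.
have pos16 : 0 <= 16 * a ^+ 2 * m.+1%:R ^+ 2 by apply: mulr_ge0; rewrite ?sqr_ge0 //; apply: mulr_ge0; rewrite ?sqr_ge0.
have [w [w0 ew]] : exists w : ser R,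
   0 <= 16 * a ^+ 2 * m.+1%:R ^+ 2 + 4 * b * w 0%N /\
   qs (n + (n + n)) W = sX ^+ (6 * (n - k1)) * (sX ^+ (2 * m).+2) ^+ 2 * w.
  case: (eqVneq W 0) => [->|W0].
    exists 0; rewrite qs0 mulr0 ser0 mulr0 addr0; split => //.
  move: caseB; rewrite (negPf W0) /= => le.
  have sW0 : (0 < size W)%N by rewrite size_poly_gt0.
  exists (sX ^+ (2 * (3 * k1 - (om + 2 * m + 2))) * qs om W); split.
    rewrite serM0 sXn0 qs_at0 -lead_coefE muln_eq0 /=.
    case: eqP => [e2|_]; first by rewrite mul1r; apply: condB => //; lia.
    by rewrite mul0r mulr0 addr0.
  rewrite (@qs_shift _ _ om); first last.
  - by rewrite /om; lia.
  - by rewrite /om prednK.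
  by rewrite mulrA; congr (_ * _); rewrite -exprM -!exprD; congr (_ ^+ _); lia.
pose d := Num.sqrt (16 * a ^+ 2 * m.+1%:R ^+ 2 + 4 * b * w 0%N).
(* With this choice of the sign of the square root the linearization is
    nonnegative and a < 0, so the exponents k / 2 cannot resonate. *)
pose h0 := (4 * a * m.+1%:R + d) / (2 * b ^+ 2).
have d2 : d ^+ 2 = 16 * a ^+ 2 * m.+1%:R ^+ 2 + 4 * b * w 0%N by rewrite sqr_sqrtr.
have b2 : 2 * b ^+ 2 != 0 by rewrite mulf_neq0 ?pnatr_eq0 // expf_neq0.
have eh0 : 2 * b ^+ 2 * h0 = 4 * a * m.+1%:R + d by rewrite /h0 mulrC divfK.
have at00 : (4%:R * q0 * q1) 0%N = 4 * a * b.
  by rewrite !serM0 q00 q10 (_ : 4%:R = sC 4%:R) ?sCE // /sC rmorph_nat rmorph_nat.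
have [] := @double_root_series_high R m (4%:R * q0 * q1) q1 w h0.
- rewrite at00 q10.
  have -> : w 0%N = (d ^+ 2 - 16 * a ^+ 2 * m.+1%:R ^+ 2) / (4 * b).
    by rewrite d2 /b; field.
  have -> : d = 2 * b ^+ 2 * h0 - 4 * a * m.+1%:R by rewrite eh0; ring.
  by rewrite /b; field.
- move=> k kp; rewrite at00 q10.
  have -> : k%:R / 2 * (4 * a * b) + m.+1%:R * (4 * a * b) - 2 * b ^+ 3 * h0 =
     b * (2 * k%:R * a + 4 * a * m.+1%:R - 2 * b ^+ 2 * h0) by field.
  rewrite eh0 mulf_neq0 // lt_eqF //.
  have d0 : 0 <= d := sqrtr_ge0 _.
  have : 2 * k%:R * a < 0 by rewrite pmulr_rlt0 // mulr_gt0 // ltr0n.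
  by lra.
move=> h [h00 eh]; exists (sX ^+ (2 * m).+2 * h); split; first by rewrite coef_sXnM.
rewrite ew thetaM thetaXn.
transitivity (4%:R * (sX ^+ (2 * n + 2) * sX ^+ (2 * (n - k0)) * sX ^+ (2 * (n - k1)))
     * q0 * q1 * (sC ((2 * m)%N.+2%:R / 2) * sX ^+ (2 * m).+2 * h + sX ^+ (2 * m).+2 * theta h)).
  ring.
rewrite Elhs.
have -> : (2 * m)%N.+2%:R / 2 = m.+1%:R :> R.
  have -> : ((2 * m).+2 = 2 * m.+1)%N by lia.
  by rewrite natrM mulrC mulKf ?pnatr_eq0.
transitivity (sX ^+ (6 * (n - k1)) * (sX ^+ (2 * m).+2) ^+ 2 *
    ((1 + sX ^+ (2 * m).+2 * h) * (q1 ^+ 3 * h ^+ 2 - w))); last by ring.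
rewrite -eh; ring.
Qed.
End DoubleRoot.

(** * Formal invariant curves as series solutions *)

Section Translate.
Variable R : realType.
Implicit Types (p r P : {poly R}) (f g : ser R).
Local Notation sX := (sX R).

Lemma sC_is_zmod : zmod_morphism (@sC R).
Proof. by move=> a b; rewrite sCD sCN. Qed.
Lemma sC_is_monoid : monoid_morphism (@sC R).
Proof. by split; [exact: sC1 | exact: sCM]. Qed.
HB.instance Definition _ := GRing.isZmodMorphism.Build R (ser R) (@sC R) sC_is_zmod.
HB.instance Definition _ := GRing.isMonoidMorphism.Build R (ser R) (@sC R) sC_is_monoid.

(** Evaluation is packaged as a ring morphism in two steps, inner variable first, so
    that the vector fields can be substituted by rewriting. *)
Definition ev1 f := horner_morph (fun x : R => mulrC f (sC x)).
HB.instance Definition _ f := GRing.RMorphism.copy (ev1 f)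
  (horner_morph (fun x : R => mulrC f (sC x))).
Definition ev2 f g := horner_morph (fun x : {poly R} => mulrC g (ev1 f x)).

HB.instance Definition _ f g := GRing.RMorphism.copy (ev2 f g)
  (horner_morph (fun x : {poly R} => mulrC g (ev1 f x))).

Lemma ev1X f : ev1 f 'X = f. Proof. exact: horner_morphX. Qed.
Lemma ev1C f c : ev1 f c%:P = sC c. Proof. exact: horner_morphC. Qed.
Lemma ev2X f g : ev2 f g 'X = g. Proof. exact: horner_morphX. Qed.
Lemma ev2C f g P : ev2 f g P%:P = ev1 f P. Proof. exact: horner_morphC. Qed.

Lemma fps_expE f m : fps_exp f m = f ^+ m.
Proof.
elim: m => [|m IH]; last by rewrite exprS -IH.
by apply/funext => k; rewrite expr0 ser1.
Qed.

Lemma fps_evalE (p : {poly {poly R}}) f g : fps_eval p f g = ev2 f g p.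
Proof.
have sum_at (I : Type) (l : seq I) (F : I -> ser R) k :
    (\sum_(i <- l) F i) k = \sum_(i <- l) F i k.
  by elim: l => [|x l IH]; rewrite ?big_nil ?ser0 // !big_cons serD IH.
apply/funext => k; rewrite /fps_eval /ev2 /horner_morph horner_poly sum_at.
apply: eq_bigr => j _; rewrite /ev1 /horner_morph horner_poly mulr_suml sum_at.
apply: eq_bigr => i _; rewrite !fps_expE -mulrA coef_sCM //.
Qed.

Definition flip (sg : R) P : {poly R} := \poly_(i < size P) (sg ^+ i.+1 * P`_i).

Lemma coef_flip sg P i : (flip sg P)`_i = sg ^+ i.+1 * P`_i.
Proof.
by rewrite coef_poly; case: ltnP => // h; rewrite nth_default ?mulr0.
Qed.
Lemma size_flip sg P : (size (flip sg P) <= size P)%N.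
Proof. exact: size_poly. Qed.
Lemma horner_flip sg P x : (flip sg P).[x] = sg * P.[sg * x].
Proof.
rewrite horner_poly horner_coef big_distrr; apply: eq_bigr => i _ /=.
by rewrite exprMn exprS; ring.
Qed.

Section Neg.
Variables (n : nat) (neg : bool).
Let sg : R := (-1) ^+ neg.
Let u : ser R := sC sg * sX ^+ 2.
Hypothesis nodd : odd n.

Let sg2 : sg ^+ 2 = 1. Proof. by rewrite /sg sqrr_sign. Qed.

Lemma sg_odd j k : odd j = odd k -> sg ^+ j = sg ^+ k.
Proof. by move=> e; rewrite /sg -!exprM -signr_odd -[RHS]signr_odd !oddM e. Qed.

Lemma fps_uE : fps_u R neg = u.
Proof.
apply/funext => k; rewrite /u /fps_u coef_sCM sXnE /ser_of_poly coefXn -/sg.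
by case: eqP; rewrite ?mulr1 ?mulr0.
Qed.

(** Here n odd matters: the coefficient of u^i in the reversed polynomial gets the
    sign sg^i, the one in the reversal of sg P(sg x) the sign sg^(n - i + 1). *)
Lemma ev1_tilde P : ev1 u (tilde n P) = qs n (flip sg P).
Proof.
rewrite /ev1 /horner_morph.
have -> : map_poly (@sC R) (tilde n P) = \poly_(i < n.+1) sC P`_(n - i).
  apply/polyP => i; rewrite coef_map !coef_poly.
  by case: ifP => // _; rewrite sC0.
rewrite horner_poly /qs /qp raddf_sum [RHS](reindex_inj rev_ord_inj) /=.
apply: eq_bigr => i _; rewrite -mul_polyC rmorphM /= rmorphXn coef_flip subSS.
have ip : (i <= n)%N by rewrite -ltnS.
rewrite subKn // -/(sC _) sCM mulrAC [RHS]mulrC; congr (_ * _).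
rewrite /u exprMn -exprM -[sC sg ^+ i]rmorphXn /=; congr (sC _ * _); apply: sg_odd.
by rewrite /= oddB // nodd addTb negbK.
Qed.

Lemma u_pow : u ^+ (n + 2) = u * sX ^+ (2 * n + 2).
Proof.
rewrite addn2 exprS; congr (_ * _); rewrite /u exprMn -exprM mulnS addnC -rmorphXn /=.
by rewrite (@sg_odd _ 0) /= ?nodd // expr0 rmorph1 mul1r.
Qed.

Lemma u_inj f : u * f = 0 -> f = 0.
Proof.
move=> e; apply: (@sXn_inj _ 2); rewrite mulr0 -[RHS](mulr0 (sC sg)) -e /u.
by rewrite !mulrA -sCM -expr2 sg2 sC1 mul1r.
Qed.

(** The equation is u times an orbit form, and u = sg s^2 can be cancelled. *)
Lemma formal_X0 P0 P1 P2 f :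
  formal_invariant_curve (X0 n P0 P1 P2) neg f <->
  orbit_form n (flip sg P0) (flip sg P1) (flip sg P2) 1 f = 0.
Proof.
have -> : formal_invariant_curve (X0 n P0 P1 P2) neg f <->
   - (ev2 u f (X0 n P0 P1 P2).1 * theta f) + u * ev2 u f (X0 n P0 P1 P2).2 = 0.
  rewrite /formal_invariant_curve !fps_evalE fps_uE; split => [h|h k].
    by apply/funext => k; rewrite ser0 -(h k).
  by rewrite -[RHS](ser0 R k) -h.
rewrite /X0 /= !(rmorphD, rmorphM, rmorphXn) /= !ev2X !ev2C.
rewrite !ev1_tilde ?rmorphXn /= ev1X u_pow.
set Q0 := qs _ _; set Q1 := qs _ _; set Q2 := qs _ _.
have -> : - (u * sX ^+ (2 * n + 2) * theta f) + u * (Q0 * f ^+ 3 + Q1 * f ^+ 2 + Q2 * f)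
  = u * orbit_form n (flip sg P0) (flip sg P1) (flip sg P2) 1 f.
  by rewrite /orbit_form theta1 -/Q0 -/Q1 -/Q2; ring.
by split => [/u_inj//|->]; rewrite mulr0.
Qed.

Lemma formal_Y0 P0 P1 P2 f :
  formal_invariant_curve (Y0 n P0 P1 P2) neg f <->
  orbit_form n (flip sg P0) (flip sg P1) (flip sg P2)
    (f + sC (- P1`_n / (2 * P2`_n))) 1 = 0.
Proof.
have -> : formal_invariant_curve (Y0 n P0 P1 P2) neg f <->
   - (ev2 u f (Y0 n P0 P1 P2).1 * theta f) + u * ev2 u f (Y0 n P0 P1 P2).2 = 0.
  rewrite /formal_invariant_curve !fps_evalE fps_uE; split => [h|h k].
    by apply/funext => k; rewrite ser0 -(h k).
  by rewrite -[RHS](ser0 R k) -h.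
rewrite /Y0 /=; move: (- P1`_n / _) => ys.
rewrite !(rmorphD, rmorphM, rmorphN, rmorphXn) /= !ev2X !ev2C.
rewrite !ev1_tilde ?rmorphXn /= ev1X ev1C u_pow.
set Q0 := qs _ _; set Q1 := qs _ _; set Q2 := qs _ _.
have -> : - (- (u * sX ^+ (2 * n + 2)) * (f + sC ys) * theta f) +
    u * (Q0 + Q1 * (f + sC ys) + Q2 * (f + sC ys) ^+ 2)
  = u * orbit_form n (flip sg P0) (flip sg P1) (flip sg P2) (f + sC ys) 1.
  by rewrite /orbit_form theta1 thetaD thetaC -/Q0 -/Q1 -/Q2; ring.
by split => [/u_inj//|->]; rewrite mulr0.
Qed.
End Neg.

(** The symmetry y -> - y of the equation of the orbits. *)
Lemma orbit_form_sign n (ep : R) p0 p1 p2 a b : ep ^+ 2 = 1 ->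
  orbit_form n p0 (ep *: p1) p2 a b = orbit_form n p0 p1 p2 (sC ep * a) b.
Proof.
move=> ep2; have e2 : sC ep ^+ 2 = 1 by rewrite -rmorphXn /= ep2 sC1.
rewrite /orbit_form; have -> : qs n (ep *: p1) = sC ep * qs n p1.
  by rewrite /qs linearZ /= -mul_polyC rmorphM.
rewrite thetaM thetaC.
transitivity (sX ^+ (2 * n + 2) * sC ep ^+ 2 * a * (b * theta a - a * theta b) +
  b * (qs n p0 * b ^+ 2 + sC ep * qs n p1 * (a * b) + qs n p2 * sC ep ^+ 2 * a ^+ 2)).
  by rewrite e2; ring.
ring.
Qed.
End Translate.

(** * Calculus, and solutions that reach infinity *)

Section Calc.
Variable R : realType.
Implicit Types (f g : R -> R) (t a b c : R).

(** The rules of differentiation are restated for abstractions, so that derivatives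
    of compound functions can be written as terms. *)
Lemma dC c t : is_derive t (1 : R) (fun=> c) 0.
Proof. exact: is_derive_cst. Qed.
Lemma dId t : is_derive t (1 : R) (fun s => s) 1.
Proof. exact: is_derive_id. Qed.
Lemma dD f g t a b : is_derive t (1 : R) f a -> is_derive t (1 : R) g b ->
  is_derive t (1 : R) (fun s => f s + g s) (a + b).
Proof. by move=> df dg; exact: is_deriveD. Qed.
Lemma dB f g t a b : is_derive t (1 : R) f a -> is_derive t (1 : R) g b ->
  is_derive t (1 : R) (fun s => f s - g s) (a - b).
Proof. by move=> df dg; exact: is_deriveB. Qed.
Lemma dN f t a : is_derive t (1 : R) f a -> is_derive t (1 : R) (fun s => - f s) (- a).
Proof. by move=> df; exact: is_deriveN. Qed.
Lemma dM f g t a b : is_derive t (1 : R) f a -> is_derive t (1 : R) g b ->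
  is_derive t (1 : R) (fun s => f s * g s) (a * g t + f t * b).
Proof.
move=> df dg; apply: is_derive_eq (is_deriveM df dg) _.
by rewrite /GRing.scale /=; ring.
Qed.
Lemma dcomp f g t a b : is_derive (g t) (1 : R) f a -> is_derive t (1 : R) g b ->
  is_derive t (1 : R) (fun s => f (g s)) (a * b).
Proof. by move=> df dg; exact: (is_derive1_comp df dg). Qed.
Lemma dP (p : {poly R}) f t a : is_derive t (1 : R) f a ->
  is_derive t (1 : R) (fun s => p.[f s]) (p^`().[f t] * a).
Proof. by move=> df; apply: dcomp (is_derive_poly p (f t)) df. Qed.
Lemma dV f t a : f t != 0 -> is_derive t (1 : R) f a ->
  is_derive t (1 : R) (fun s => (f s)^-1) (- a / f t ^+ 2).
Proof.
move=> f0 df; apply: is_derive_eq (is_deriveV f0 df) _.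
by rewrite /GRing.scale /= -exprVn; ring.
Qed.
Lemma dDiv f g t a b : g t != 0 -> is_derive t (1 : R) f a -> is_derive t (1 : R) g b ->
  is_derive t (1 : R) (fun s => f s / g s) ((a * g t - f t * b) / g t ^+ 2).
Proof.
move=> g0 df dg; apply: is_derive_eq (dM df (dV g0 dg)) _.
by field.
Qed.
Lemma dX f n t a : is_derive t (1 : R) f a ->
  is_derive t (1 : R) (fun s => f s ^+ n.+1) (n.+1%:R * f t ^+ n * a).
Proof.
move=> df; have := dP 'X^(n.+1) df; rewrite derivXn hornerMn hornerXn.
by under eq_fun do rewrite hornerXn; rewrite mulr_natl.
Qed.

Lemma is_derive_cont f t a : is_derive t (1 : R) f a -> {for t, continuous f}.
Proof.
by move=> [df _]; apply: differentiable_continuous; exact/derivable1_diffP.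
Qed.

Lemma nondec f (f' : R -> R) a b : a <= b ->
  (forall t, a <= t <= b -> is_derive t (1 : R) f (f' t)) ->
  (forall t, a <= t <= b -> 0 <= f' t) -> f a <= f b.
Proof.
move=> ab df f0.
have sub t : t \in `]a, b[ -> a <= t <= b.
  by rewrite in_itv /= => /andP[/ltW -> /ltW ->].
apply: (@ger0_derive1_ndecr R f a b) => //.
- by move=> t /sub /df [].
- by move=> t /sub tab; rewrite derive1E (derive_val (is_derive := df t tab)) f0.
- apply: derivable_within_continuous => t; rewrite in_itv /= => tab.
  by have [] := df t tab.
Qed.

Lemma const_of_der0 f : (forall t, is_derive t (1 : R) f 0) -> forall a b, f a = f b.
Proof.
move=> df a b; wlog ab : a b / a <= b => [H|].
  by case: (leP a b) => [/H//|/ltW/H].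
apply/eqP; rewrite eq_le; apply/andP; split.
  by apply: (@nondec f (fun=> 0)).
rewrite -lerN2; apply: (@nondec (fun t => - f t) (fun=> 0)) => // t _.
by rewrite -oppr0; apply: dN.
Qed.

Lemma poly_ge_infty (p : {poly R}) : 0 < lead_coef p ->
  exists2 d, 0 < d & exists X0, forall x, X0 <= x -> d <= p.[x].
Proof.
elim/poly_ind: p => [|p c IH]; first by rewrite lead_coef0 ltxx.
have [->|p0] := eqVneq p 0.
  rewrite mul0r add0r lead_coefC => c0; exists c => //; exists 0 => x _.
  by rewrite hornerC.
rewrite lead_coefDl ?lead_coefMX; last first.
  by rewrite size_mulX // size_polyC (leq_ltn_trans (leq_b1 _)) // ltnS size_poly_gt0.
move=> /IH [d d0 [X0 h]]; exists 1 => //; exists (Num.max X0 (Num.max 0 ((1 - c) / d))) => x.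
rewrite !ge_max => /and3P[/h dx x0 xd]; rewrite hornerMXaddC.
move: xd; rewrite ler_pdivrMr // => xd.
have : d * x <= p.[x] * x by rewrite ler_wpM2r.
by lra.
Qed.

Lemma poly_pos_infty N (p : {poly R}) : (size p <= N.+1)%N -> 0 < p`_N ->
  exists X0, forall x, X0 <= x -> 0 < p.[x].
Proof.
move=> sp pN; have e : size p = N.+1.
  apply/eqP; rewrite eqn_leq sp /= ltnNge; apply/negP => h.
  by move: pN; rewrite nth_default // ltxx.
have [|d d0 [X0 h]] := @poly_ge_infty p; first by rewrite lead_coefE e.
by exists X0 => x /h; apply: lt_le_trans.
Qed.

(** A solution Y > 0 of Y Y' = p0 + p1 Y + p2 Y^2 that reaches X = +oo, with a time t
    such that dX/dt = k > 0.  Keeping the time makes it unnecessary to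
    reparametrize orbits by X. *)
Definition end_sol (p0 p1 p2 : {poly R}) : Prop :=
  exists (X y k : R -> R) (T : R), [/\
    forall t, T <= t -> is_derive t (1 : R) X (k t),
    forall t, T <= t -> 0 < k t,
    forall t, T <= t -> 0 < y t,
    forall t, T <= t -> is_derive t (1 : R) y
      (k t * (p0.[X t] + p1.[X t] * y t + p2.[X t] * y t ^+ 2) / y t) &
    forall K, exists2 T', T <= T' & forall t, T' <= t -> K <= X t].

(** Otherwise f + e X does not increase, and f tends to - oo with X. *)
Lemma no_decay (X k f f' : R -> R) (T e B : R) : 0 < e ->
  (forall t, T <= t -> is_derive t (1 : R) X (k t)) ->
  (forall K, exists2 T', T <= T' & forall t, T' <= t -> K <= X t) ->
  (forall t, T <= t -> is_derive t (1 : R) f (f' t)) ->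
  (forall t, T <= t -> f' t <= - e * k t) ->
  (forall t, T <= t -> B <= f t) -> False.
Proof.
move=> e0 dX_ Xoo df f'e fB.
have [T' TT' /(_ T' (lexx _)) XT'] := Xoo ((f T + e * X T - B + 1) / e).
have : - (f T + e * X T) <= - (f T' + e * X T').
  apply: (@nondec (fun t => - (f t + e * X t)) (fun t => - (f' t + (0 * X t + e * k t)))) => //.
    move=> t /andP[Tt _].
    exact: (dN (dD (df t Tt) (dM (dC _ _) (dX_ t Tt)))).
  by move=> t /andP[Tt _]; have := f'e t Tt; lra.
move: XT'; rewrite ler_pdivrMr // => XT'.
have := fB _ TT'; lra.
Qed.

(** The derivative of Y^2 is at most - 2 e dX/dt. *)
Lemma no_end_sol_of_neg p0 p1 p2 e X0 : 0 < e ->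
  (forall x y, X0 <= x -> 0 < y -> p0.[x] + p1.[x] * y + p2.[x] * y ^+ 2 <= - e) ->
  ~ end_sol p0 p1 p2.
Proof.
move=> e0 neg [X [y [k [T [dX_ k0 y0 dy Xoo]]]]].
have [T1 TT1 XT1] := Xoo X0.
have le t : T1 <= t -> T <= t by apply: le_trans.
apply: (@no_decay X k (fun t => y t ^+ 2) (fun t => 2 * y t ^+ 1 *
  (k t * (p0.[X t] + p1.[X t] * y t + p2.[X t] * y t ^+ 2) / y t)) T1 (2 * e) 0).
- by rewrite mulr_gt0.
- by move=> t /le /dX_.
- move=> K; have [T2 _ h] := Xoo K; exists (Num.max T1 T2); first by rewrite le_max lexx.
  by move=> t; rewrite ge_max => /andP[_ /h].
- by move=> t /le tT; exact: (dX 1 (dy t tT)).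
- move=> t tT1; have := neg _ _ (XT1 t tT1) (y0 t (le _ tT1)).
  set S := _ + _ + _ => hS; have yt := y0 t (le _ tT1).
  have -> : 2 * y t ^+ 1 * (k t * S / y t) = 2 * k t * S by field; rewrite gt_eqF.
  have kt := k0 t (le _ tT1).
  have : k t * S <= k t * - e by rewrite ler_pM2l.
  lra.
- by move=> t _; exact: sqr_ge0.
Qed.
End Calc.

(** * Obstructions to solutions that reach infinity *)

Section Contra.
Variable R : realType.
Implicit Types (p : {poly R}).

Lemma poly_neg_infty N p : (size p <= N.+1)%N -> p`_N < 0 ->
  exists X0, forall x, X0 <= x -> p.[x] < 0.
Proof.
move=> sp pN; have [||X0 h] := @poly_pos_infty R N (- p).
- by rewrite size_polyN.
- by rewrite coefN oppr_gt0.
by exists X0 => x /h; rewrite hornerN oppr_gt0.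
Qed.

(** Completing the square, 4 p2 (p0 + p1 y + p2 y^2) >= 4 p0 p2 - p1^2, a polynomial
    with positive leading coefficient of degree k0 + m; as p2 < 0 has degree m,
    the quadratic is at most a negative constant. *)
Lemma no_end_sol_of_neg_disc k0 k1 m (p0 p1 p2 : {poly R}) :
  (size p0 <= k0.+1)%N -> (size p1 <= k1.+1)%N -> (size p2 <= m.+1)%N ->
  (2 * k1 <= k0 + m)%N -> p2`_m < 0 ->
  (if (2 * k1 == k0 + m)%N then p1`_k1 ^+ 2 else 0) < 4 * p0`_k0 * p2`_m ->
  ~ end_sol p0 p1 p2.
Proof.
move=> s0 s1 s2 kk c0; set B := (if _ then _ else _) => lt.
pose gap := 4 * p0`_k0 * p2`_m - B; have gap0 : 0 < gap by rewrite subr_gt0.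
(* Half of the gap is left when k0 = 0 and the two degrees agree. *)
pose e := gap / (- 8 * p2`_m).
have e0 : 0 < e by rewrite divr_gt0 //; move: c0; lra.
pose Dp := 4 *: (p0 * p2) - p1 * p1 + (4 * e) *: p2.
have sD : (size Dp <= (k0 + m).+1)%N.
  rewrite (leq_trans (size_polyD _ _)) // geq_max (leq_trans (size_polyD _ _)) ?geq_max ?size_polyN /=.
    by rewrite (leq_trans (size_scale_leq _ _)) // (leq_trans s2) //; lia.
  rewrite (leq_trans (size_scale_leq _ _)) ?(size_mul_le s0 s2) //=; last by lia.
  by apply: (size_mul_le s1 s1); lia.
have cp : (p1 * p1)`_(k0 + m) = B.
  rewrite /B; case: eqP => e1; first by rewrite -e1 mul2n -addnn coefM_top // expr2.
  rewrite nth_default //; apply: (size_mul_le s1 s1); lia.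
have c2 : p2`_m <= p2`_(k0 + m).
  case: k0 {s0 kk B lt gap gap0 e e0 Dp sD cp} => [|k0]; first by rewrite add0n.
  by rewrite [X in _ <= X]nth_default ?ltW // (leq_trans s2) //; lia.
have ec : 4 * e * p2`_m = - (gap / 2) by rewrite /e; field; rewrite lt_eqF.
have [||X0 hD] := @poly_pos_infty R (k0 + m) Dp => //.
  rewrite /Dp coefD coefB !coefZ cp coefM_top // mulrA.
  have : 4 * e * p2`_m <= 4 * e * p2`_(k0 + m) by rewrite ler_pM2l // mulr_gt0.
  by rewrite ec -/gap; move: gap0; rewrite /gap; lra.
have [X1 h2] := poly_neg_infty s2 c0.
apply: (@no_end_sol_of_neg R p0 p1 p2 e (Num.max X0 X1)) => // x y.
rewrite ge_max => /andP[/hD xD /h2 x2] _.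
rewrite -(ler_nM2l x2).
move: xD; rewrite !(hornerD, hornerN, hornerZ, hornerM) => xD.
have : 0 <= (2 * p2.[x] * y + p1.[x]) ^+ 2 by exact: sqr_ge0.
rewrite -(ler_pM2l (_ : 0 < 4)) //; nra.
Qed.

Lemma no_end_sol_of_neg_leads k0 k1 m (p0 p1 p2 : {poly R}) :
  (size p0 <= k0.+1)%N -> (size p1 <= k1.+1)%N -> (size p2 <= m.+1)%N ->
  p0`_k0 < 0 -> p1`_k1 < 0 -> p2`_m < 0 -> ~ end_sol p0 p1 p2.
Proof.
move=> s0 s1 s2 a0 b0 c0.
have [|d d0 [X0 h0]] := @poly_ge_infty R (- p0).
  rewrite lead_coefN oppr_gt0 lead_coefE (_ : (size p0).-1 = k0) //.
  have : (k0 < size p0)%N.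
    by rewrite ltnNge; apply/negP => h; move: a0; rewrite nth_default // ltxx.
  by move=> h; move: s0 h; case: (size p0) => //= u; lia.
have [X1 h1] := poly_neg_infty s1 b0; have [X2 h2] := poly_neg_infty s2 c0.
apply: (@no_end_sol_of_neg R p0 p1 p2 d (Num.max X0 (Num.max X1 X2))) => // x y.
rewrite !ge_max => /and3P[x0 x1 x2] y0.
have := h0 x x0; rewrite hornerN => ?.
have : p1.[x] * y < 0 by rewrite pmulr_llt0 // h1.
have : p2.[x] * y ^+ 2 < 0 by rewrite pmulr_llt0 ?exprn_gt0 // h2.
by lra.
Qed.

(** In terms of u = 1 + tau = -2 p0 / (p1 Y) > 0 the equation of the orbits is
    u' = u (A (u - 1)^2 + B), with A = p1^2 / (- 4 p0) >= A1 X^m and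
    B = drift_disc / (4 p0 p1) >= B1 X^(- m - 2).  So u increases, and it comes
    arbitrarily close to 1 because A >= A1 is not integrable.  From then on
    z = X^(m+1) (u - 1) satisfies X z' >= (m + 1) z + th (A1 z^2 + B1) with th < 1
    close to 1, a quadratic polynomial without real roots.  Hence atan z grows at
    least like e log X, which is absurd. *)
Lemma no_end_sol_of_bounds m (p0 p1 p2 : {poly R}) A1 B1 X0 :
  0 < A1 -> 0 < B1 -> m.+1%:R ^+ 2 < 4 * A1 * B1 ->
  (forall x, X0 <= x -> [/\ 1 <= x, p0.[x] < 0, 0 < p1.[x],
     - (4 * A1) * x ^+ m * p0.[x] <= p1.[x] ^+ 2 &
     x ^+ m.+2 * (drift_disc p0 p1 p2).[x] <= 4 * B1 * (p0.[x] * p1.[x])]) ->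
  ~ end_sol p0 p1 p2.
Proof.
move=> A0 B0 disc big [X [y [k [T0 [dX0 k00 y00 dy0 Xoo0]]]]].
have [T TT0 XT] := Xoo0 X0.
have dX_ t : T <= t -> is_derive t (1 : R) X (k t) by move=> h; apply/dX0/(le_trans TT0).
have k0 t : T <= t -> 0 < k t by move=> h; apply/k00/(le_trans TT0).
have y0 t : T <= t -> 0 < y t by move=> h; apply/y00/(le_trans TT0).
have dy t : T <= t -> is_derive t (1 : R) y
      (k t * (p0.[X t] + p1.[X t] * y t + p2.[X t] * y t ^+ 2) / y t).
  by move=> h; apply/dy0/(le_trans TT0).
have Xoo K T1 : T <= T1 -> exists2 T', T1 <= T' & forall t, T' <= t -> K <= X t.
  move=> TT1; have [T' _ h] := Xoo0 K; exists (Num.max T1 T'); first by rewrite le_max lexx.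
  by move=> t; rewrite ge_max => /andP[_ /h].
pose u t := - 2 * p0.[X t] / (p1.[X t] * y t).
pose A x := p1.[x] ^+ 2 / (- 4 * p0.[x]).
pose B x := (drift_disc p0 p1 p2).[x] / (4 * (p0.[x] * p1.[x])).
have u0 t : T <= t -> 0 < u t.
  move=> tT; have [_ p00 p10 _ _] := big _ (XT t tT).
  by apply: divr_gt0; [move: p00; lra | rewrite mulr_gt0 ?y0].
have AX t : T <= t -> A1 * X t ^+ m <= A (X t).
  move=> tT; have [_ p00 p10 h _] := big _ (XT t tT).
  rewrite /A ler_pdivlMr; last by move: p00; lra.
  by apply: le_trans h; rewrite le_eqVlt; apply/orP; left; apply/eqP; ring.
have BX t : T <= t -> B1 <= X t ^+ m.+2 * B (X t).
  move=> tT; have [_ p00 p10 _ h] := big _ (XT t tT).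
  have neg : 4 * (p0.[X t] * p1.[X t]) < 0 by rewrite pmulr_rlt0 // nmulr_rlt0.
  rewrite /B [X t ^+ _ * (_ / _)]mulrA ler_ndivlMr //; apply: le_trans h _.
  by rewrite le_eqVlt; apply/orP; left; apply/eqP; ring.
pose u' t := k t * u t * (A (X t) * (u t - 1) ^+ 2 + B (X t)).
have du t : T <= t -> is_derive t (1 : R) u (u' t).
  move=> tT; have [_ p00 p10 _ _] := big _ (XT t tT).
  have yt := y0 t tT.
  have nz : p1.[X t] * y t != 0 by rewrite mulf_neq0 ?gt_eqF.
  have dx := dX_ t tT.
  apply: is_derive_eq (@dDiv R (fun s => - 2 * p0.[X s]) (fun s => p1.[X s] * y s) t _ _ nz (dM (dC (- 2) t) (dP p0 dx)) (dM (dP p1 dx) (dy t tT))) _.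
  rewrite /u' /u /A /B /drift_disc !(hornerD, hornerN, hornerM, hornerMn).
  by field; apply/and3P; split; rewrite ?(gt_eqF p10) ?(gt_eqF yt) ?(lt_eqF p00).
have X1 t : T <= t -> 1 <= X t by move=> tT; have [] := big _ (XT t tT).
have AX1 t : T <= t -> A1 <= A (X t).
  move=> tT; apply: le_trans (AX t tT).
  by rewrite -[X in X <= _]mulr1 ler_pM2l // exprn_ege1 // X1.
have Bp t : T <= t -> 0 < B (X t).
  move=> tT; have := lt_le_trans B0 (BX t tT).
  by rewrite pmulr_rgt0 // exprn_gt0 // (lt_le_trans _ (X1 t tT)).
have A_ge0 t : T <= t -> 0 <= A (X t).
  by move=> tT; apply: le_trans (AX1 t tT); exact: ltW.
have undec a b : T <= a -> a <= b -> u a <= u b.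
  move=> Ta ab; apply: (@nondec R u u' a b ab).
    by move=> t /andP[at_ _]; apply: du; exact: le_trans at_.
  move=> t /andP[at_ _]; have tT := le_trans Ta at_.
  apply: mulr_ge0; first by rewrite mulr_ge0 ?ltW ?k0 ?u0.
  by apply: addr_ge0; [rewrite mulr_ge0 ?sqr_ge0 ?A_ge0 | rewrite ltW ?Bp].
pose M : R := m.+1%:R.
pose r := M ^+ 2 / (4 * A1 * B1).
have AB0 : 0 < 4 * A1 * B1 by rewrite !mulr_gt0.
have r1 : r < 1 by rewrite /r ltr_pdivrMr // mul1r.
have r0 : 0 <= r by rewrite /r divr_ge0 ?sqr_ge0 // ltW.
have rAB : r * (4 * A1 * B1) = M ^+ 2 by rewrite /r divfK // gt_eqF.
(* r < rho^2 by the inequality of the means, and th A1 - e >= rho A1, so the margin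
   left by rho absorbs e (1 + z^2). *)
pose rho := (1 + r) / 2; pose th := (1 + rho) / 2.
pose e := (1 - th) * Num.min A1 B1.
have min0 : 0 < Num.min A1 B1 by rewrite lt_min A0.
have rho1 : 0 < rho < 1 by rewrite /rho; apply/andP; split; lra.
have th1 : 0 < th < 1 by rewrite /th; move: rho1 => /andP[? ?]; apply/andP; split; lra.
have e0 : 0 < e by rewrite mulr_gt0 // subr_gt0; case/andP: th1.
have quad z : e * (1 + z ^+ 2) <= M * z + th * (A1 * z ^+ 2 + B1).
  have eA : e <= (1 - th) * A1.
    by rewrite ler_wpM2l ?ge_min ?lexx // subr_ge0 ltW //; case/andP: th1.
  have eB : e <= (1 - th) * B1.
    by rewrite ler_wpM2l ?ge_min ?lexx ?orbT // subr_ge0 ltW //; case/andP: th1.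
  have h1 : rho * A1 * z ^+ 2 <= (th * A1 - e) * z ^+ 2.
    apply: ler_wpM2r; first exact: sqr_ge0.
    by move: eA; rewrite /th; lra.
  have h2 : rho * B1 <= th * B1 - e by move: eB; rewrite /th; lra.
  suff : 0 <= rho * A1 * z ^+ 2 + M * z + rho * B1 by lra.
  have rA : 0 < 4 * (rho * A1) by rewrite mulr_gt0 // mulr_gt0 //; case/andP: rho1.
  rewrite -(pmulr_rge0 _ rA).
  have rr : M ^+ 2 <= rho ^+ 2 * (4 * A1 * B1).
    rewrite -rAB ler_wpM2r ?(ltW AB0) //.
    have : 0 <= (1 - r) ^+ 2 by exact: sqr_ge0.
    by rewrite /rho; lra.
  have : 0 <= (2 * (rho * A1) * z + M) ^+ 2 by exact: sqr_ge0.
  by lra.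
(* Otherwise (u - 1)^2 would be bounded below, and u unbounded. *)
have [T1 TT1 uT1] : exists2 T1, T <= T1 & th <= u T1.
  apply: contrapT => no.
  have uth t : T <= t -> u t < th.
    by move=> tT; rewrite ltNge; apply/negP => h; apply: no; exists t.
  have th0 : 0 < 1 - th by rewrite subr_gt0; case/andP: th1.
  apply: (@no_decay R X k (fun t => - u t)
     (fun t => - u' t) T (u T * (A1 * (1 - th) ^+ 2)) (- th)).
  - by rewrite mulr_gt0 ?u0 // mulr_gt0 // exprn_gt0.
  - by move=> K; apply: Xoo.
  - by move=> t tT; apply: dN; exact: du.
  - move=> t tT; rewrite /u' mulNr lerN2 mulrC -mulrA.
    rewrite ler_pM2l ?k0 // ler_pM ?undec //.
    + by rewrite ltW ?u0.
    + by rewrite mulr_ge0 ?sqr_ge0 ?ltW.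
    + have sq : (1 - th) ^+ 2 <= (u t - 1) ^+ 2.
        rewrite -[X in _ <= X]sqrrN opprB ler_pXn2r ?nnegrE ?subr_ge0 //.
        * by rewrite lerB // ltW // uth.
        * by rewrite ltW //; case/andP: th1.
        * by rewrite ltW // (lt_trans (uth t tT)) //; case/andP: th1.
      have : A1 * (1 - th) ^+ 2 <= A (X t) * (u t - 1) ^+ 2.
        by apply: ler_pM; rewrite ?sqr_ge0 ?AX1 //; exact: ltW.
      by have := Bp t tT; lra.
  - by move=> t tT; rewrite lerN2 ltW // uth.
have uth t : T1 <= t -> th <= u t by move=> h; apply: le_trans uT1 _; apply: undec.
pose z t := X t ^+ m.+1 * (u t - 1).
have Xp t : T <= t -> 0 < X t by move=> tT; apply: lt_le_trans (X1 t tT).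
have dz t : T <= t -> is_derive t (1 : R) z
   (k t / X t * (M * z t + u t * (X t ^+ m.+2 * A (X t) * (u t - 1) ^+ 2 + X t ^+ m.+2 * B (X t)))).
  move=> tT; apply: is_derive_eq (dM (dX m (dX_ t tT)) (dB (du t tT) (dC 1 t))) _.
  by rewrite /u' /z /M !exprS; field; rewrite gt_eqF ?Xp.
pose F t := atan (z t) - e * ln (X t).
pose F' t :=
  ((1 + z t ^+ 2)^-1 * (k t / X t * (M * z t + u t * (X t ^+ m.+2 * A (X t) * (u t - 1) ^+ 2
     + X t ^+ m.+2 * B (X t)))) - (0 * ln (X t) + e * ((X t)^-1 * k t))).
have dF t : T <= t -> is_derive t (1 : R) F (F' t).
  move=> tT; exact: (dB (dcomp (is_derive1_atan (z t)) (dz t tT))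
    (dM (dC e t) (dcomp (is_derive1_ln (Xp t tT)) (dX_ t tT)))).
have Fnd t : T1 <= t -> F T1 <= F t.
  move=> T1t; apply: (@nondec R F F' T1 t T1t).
    by move=> t1 /andP[h _]; apply: dF; apply: le_trans h.
  move=> {T1t}t /andP[T1t _]; have tT := le_trans TT1 T1t.
  rewrite /F' mul0r add0r subr_ge0.
  have z1 : 0 < 1 + z t ^+ 2 by rewrite ltr_pwDl ?sqr_ge0.
  rewrite [X in _ <= X]mulrC ler_pdivlMr //.
  rewrite [X in _ <= X](_ : _ = (X t)^-1 * k t * (M * z t + u t * (X t ^+ m.+2 * A (X t) * (u t - 1) ^+ 2
     + X t ^+ m.+2 * B (X t)))); last by ring.
  rewrite [X in X <= _](_ : _ = (X t)^-1 * k t * (e * (1 + z t ^+ 2))); last by ring.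
  rewrite ler_pM2l; last by rewrite mulr_gt0 ?k0 // invr_gt0 Xp.
  apply: le_trans (quad (z t)) _; rewrite lerD2l.
  apply: ler_pM; rewrite ?uth //.
  - by rewrite ltW //; case/andP: th1.
  - by apply: addr_ge0; [rewrite mulr_ge0 ?sqr_ge0 ?(ltW A0) | exact: ltW].
  apply: lerD; last exact: BX.
  have -> : A1 * z t ^+ 2 = X t ^+ m.+2 * (A1 * X t ^+ m) * (u t - 1) ^+ 2.
    by rewrite /z !exprS; ring.
  rewrite ler_wpM2r ?sqr_ge0 // ler_wpM2l ?AX //.
  by rewrite exprn_ge0 // ltW ?Xp.
have [T2 T12 h2] := Xoo (expR ((pi / 2 - F T1) / e)) T1 TT1.
have T2T := le_trans TT1 T12.
have := Fnd T2 T12; rewrite {2}/F.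
have := h2 T2 (lexx _); rewrite -ler_ln ?posrE ?expR_gt0 ?Xp // expRK ler_pdivrMr //.
have := atan_ltpi2 (z T2); lra.
Qed.
End Contra.

(** * From solutions that reach infinity to formal solutions *)

Section Degenerate.
Variable R : realType.
Local Notation sX := (sX R).

(** The bounds of the previous obstruction, read off the leading coefficients. *)
Lemma no_end_sol_of_leads k0 k1 m (p0 p1 p2 : {poly R}) (W := drift_disc p0 p1 p2)
    (om := (size W).-1) (A1 B1 : R) :
  (size p0 <= k0.+1)%N -> (size p1 <= k1.+1)%N ->
  (2 * k1 = k0 + m)%N -> p0`_k0 < 0 -> 0 < p1`_k1 -> W != 0 ->
  0 < A1 -> 0 < B1 -> m.+1%:R ^+ 2 < 4 * A1 * B1 ->
  0 < p1`_k1 ^+ 2 + 4 * A1 * p0`_k0 ->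
  (3 * k1 <= om + 2 * m + 2)%N ->
  lead_coef W < (3 * k1 == om + 2 * m + 2)%N%:R * (4 * B1 * p0`_k0 * p1`_k1) ->
  ~ end_sol p0 p1 p2.
Proof.
move=> s0 s1 e a0 b0 W0 A0 B0 disc cA le cB.
have [XA hA] : exists X0, forall x, X0 <= x -> 0 < (p1 * p1 + (4 * A1) *: ('X^m * p0)).[x].
  apply: (@poly_pos_infty R (2 * k1)).
    rewrite (leq_trans (size_polyD _ _)) // geq_max (size_mul_le s1 s1) /=; last by lia.
    rewrite (leq_trans (size_scale_leq _ _)) //.
    by apply: (size_mul_le (u := m.+1) _ s0); rewrite ?size_polyXn //; lia.
  rewrite coefD coefZ {2}e {1}mul2n -addnn coefM_top // -expr2 coefXnM.
  by rewrite ltnNge leq_addl /= addnK.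
have [XB hB] : exists X0, forall x, X0 <= x ->
    0 < ((4 * B1) *: (p0 * p1) - 'X^(m.+2) * W).[x].
  apply: (@poly_pos_infty R (om + m.+2)).
    rewrite (leq_trans (size_polyD _ _)) // geq_max size_polyN.
    rewrite (leq_trans (size_scale_leq _ _)) /=; last first.
      by apply: (size_mul_le s0 s1); lia.
    apply: (size_mul_le (u := m.+3) (v := om.+1)); rewrite ?size_polyXn //; last by lia.
    by rewrite /om leqSpred.
  rewrite coefB coefZ coefXnM ltnNge leq_addl /= addnK -lead_coefE.
  rewrite subr_gt0; apply: lt_le_trans cB _.
  case: eqP => [e1|ne]; last first.
    rewrite mul0r nth_default ?mulr0 //; apply: (size_mul_le s0 s1); lia.
  have -> : (om + m.+2 = k0 + k1)%N by lia.
  by rewrite coefM_top // mul1r !mulrA.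
have [X0 h0] := poly_neg_infty s0 a0.
have [X1 h1] := @poly_pos_infty R k1 p1 s1 b0.
apply: (@no_end_sol_of_bounds R m p0 p1 p2 A1 B1 (Num.max 1 (Num.max XA (Num.max XB (Num.max X0 X1))))) => //.
move=> x; rewrite !ge_max => /andP[x1 /and4P[/hA xA /hB xB /h0 x0 /h1 x2]].
have ev (V p q : {poly R}) (c : R) j :
    (c *: (p * q) - 'X^j * V).[x] = c * (p.[x] * q.[x]) - x ^+ j * V.[x].
  by rewrite hornerD hornerN hornerZ !hornerM hornerXn.
move: xB; rewrite ev subr_gt0 => xB.
move: xA; rewrite hornerD hornerZ hornerM hornerM hornerXn => xA.
split => //; last exact: ltW.
by rewrite -subr_ge0; apply: le_trans (ltW xA) _; rewrite le_eqVlt; apply/orP; left; apply/eqP; ring.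
Qed.

(** The two ways in which the leading equation for tau can fail to have a real root
    are excluded by the real solution. *)
Lemma end_sol_double_root n' k0 k1 m (p0 p1 p2 : {poly R}) (n := n'.+1) :
  (size p0 <= k0.+1)%N -> (size p1 <= k1.+1)%N -> (size p2 <= m.+1)%N ->
  (k0 <= n)%N -> (k1 <= n)%N -> (m <= n)%N ->
  (2 * k1 = k0 + m)%N -> (0 < k1)%N -> p1`_k1 ^+ 2 = 4 * p0`_k0 * p2`_m ->
  p0`_k0 < 0 -> 0 < p1`_k1 -> end_sol p0 p1 p2 ->
  exists tau : ser R, tau 0%N = 0 /\
    orbit_form n p0 p1 p2 (- (2%:R * qs n p0)) (qs n p1 * (1 + tau)) = 0.
Proof.
move=> s0 s1 s2 k0n k1n mn e k10 disc a0 b0 sol.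
set W := drift_disc p0 p1 p2; set om := (size W).-1.
pose a := p0`_k0; pose b := p1`_k1; pose M : R := m.+1%:R.
have M0 : 0 < M by rewrite ltr0n.
pose A0 := b ^+ 2 / (- 4 * a).
have a4 : 0 < - 4 * a by move: a0; rewrite -/a; lra.
have A0p : 0 < A0 by rewrite divr_gt0 // exprn_gt0.
have A0a : A0 * (4 * a) = - b ^+ 2 by rewrite /A0; field; rewrite lt_eqF.
have [n0 nb] : a != 0 /\ b != 0 by rewrite lt_eqF // gt_eqF.
apply: (@double_root_formal R n' k0 k1 m) => //; rewrite -/W -/om.
- move=> W0 lt; rewrite pmulr_rgt0 // ltNge; apply/negP => lW.
  have lW0 : lead_coef W < 0 by rewrite lt_neqAle lW lead_coef_eq0 W0.
  (* In this range B dominates X^(- m - 2), so any constant B1 is allowed. *)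
  apply: (@no_end_sol_of_leads k0 k1 m p0 p1 p2 (A0 / 2) (M ^+ 2 / A0)) sol => //.
  + by rewrite divr_gt0.
  + by rewrite divr_gt0 // exprn_gt0.
  + rewrite -/M (_ : 4 * (A0 / 2) * (M ^+ 2 / A0) = 2 * M ^+ 2).
      by have : 0 < M ^+ 2 := exprn_gt0 2 M0; lra.
    by field; rewrite gt_eqF.
  + rewrite -/a -/b (_ : 4 * (A0 / 2) * a = A0 * (4 * a) / 2); last by field.
    by rewrite A0a; have : 0 < b ^+ 2 := exprn_gt0 2 b0; lra.
  + by rewrite -/W -/om; lia.
  + by rewrite -/W -/om (_ : _ == _ = false) ?mul0r //; lia.
- move=> W0 eq; rewrite leNgt; apply/negP => neg.
  pose w0 := lead_coef W.
  pose B0 := w0 / (4 * a * b).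
  have w0n : w0 < 0.
    rewrite ltNge; apply/negP => w0p; move: neg; rewrite -/a -/b -/w0 ltNge => /negP; apply.
    apply: addr_ge0; first by apply: mulr_ge0; rewrite ?sqr_ge0 // mulr_ge0 ?sqr_ge0.
    by apply: mulr_ge0 => //; rewrite mulr_ge0 // ltW.
  have B0p : 0 < B0.
    by rewrite /B0 nmulr_rgt0 // invr_lt0 pmulr_llt0 // pmulr_rlt0.
  have AB : 4 * A0 * B0 = - (b * w0) / (4 * a ^+ 2).
    by rewrite /A0 /B0; field; apply/andP.
  have ABM : M ^+ 2 < 4 * A0 * B0.
    rewrite AB ltr_pdivlMr; last by rewrite pmulr_rgt0 // exprn_even_gt0.
    by move: neg; rewrite -/a -/b -/w0 -/M; lra.
  have AB0 : 0 < 4 * A0 * B0 by apply: mulr_gt0 => //; apply: mulr_gt0.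
  pose r := M ^+ 2 / (4 * A0 * B0); pose rho := (1 + r) / 2.
  have r0 : 0 <= r by apply: divr_ge0; [exact: sqr_ge0 | exact: ltW].
  have r1 : r < 1 by rewrite /r ltr_pdivrMr // mul1r.
  have rM : r * (4 * A0 * B0) = M ^+ 2 by rewrite /r divfK // gt_eqF.
  have rhop : 0 < rho by rewrite /rho; lra.
  have rho1 : rho < 1 by rewrite /rho; lra.
  have rr : r < rho ^+ 2.
    have : 0 < (1 - r) ^+ 2 by rewrite exprn_gt0 // subr_gt0.
    by rewrite /rho; lra.
  (* The strict inequality between A0 and B0 survives a factor rho < 1 on each. *)
  apply: (@no_end_sol_of_leads k0 k1 m p0 p1 p2 (rho * A0) (rho * B0)) sol => //.
  + by rewrite mulr_gt0.
  + by rewrite mulr_gt0.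
  + rewrite -/M -rM (_ : 4 * (rho * A0) * (rho * B0) = rho ^+ 2 * (4 * A0 * B0)); last by ring.
    by rewrite ltr_pM2r.
  + rewrite -/a -/b (_ : 4 * (rho * A0) * a = rho * (A0 * (4 * a))); last by ring.
    rewrite A0a mulrN subr_gt0 -[X in _ < X]mul1r ltr_pM2r ?exprn_gt0 //.
  + by rewrite -/W -/om eq.
  + rewrite -/W -/om -/w0 eq eqxx mul1r -/a -/b.
    have -> : 4 * (rho * B0) * a * b = rho * w0 by rewrite /B0; field; apply/andP.
    by rewrite -[X in X < _]mul1r ltr_nM2r.
Qed.

End Degenerate.

Section RealToFormal.
Variable R : realType.
Local Notation sX := (sX R).

(** The three terms of p0 + p1 Y + p2 Y^2 are compared at the order of its largest
    root, Y = s^(i - j) h.  The real solution is only needed when the leading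
    quadratic polynomial has no real root or a double one. *)
Lemma end_sol_formal n' k0 k1 m (p0 p1 p2 : {poly R}) (n := n'.+1) i j :
  (size p0 <= k0.+1)%N -> (size p1 <= k1.+1)%N -> (size p2 <= m.+1)%N ->
  (k0 <= n)%N -> (k1 <= n)%N -> (m <= n)%N -> (0 < k0 + m)%N ->
  p0`_k0 != 0 -> p2`_m != 0 -> (p1`_k1 = 0 -> k1 = 0%N) ->
  (0 < p0`_k0 * p2`_m -> p0`_k0 < 0 /\ p2`_m < 0) ->
  (if (k0 + m < 2 * k1)%N then j + 2 * m = i + 2 * k1 else j + m = i + k0)%N ->
  end_sol p0 p1 p2 ->
  exists h : ser R, [/\ h 0%N != 0,
    ((2 * k1 = k0 + m)%N -> p1`_k1 ^+ 2 = 4 * p0`_k0 * p2`_m ->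
       h 0%N = - p1`_k1 / (2 * p2`_m)) &
    orbit_form n p0 p1 p2 (sX ^+ i * h) (sX ^+ j) = 0].
Proof.
move=> s0 s1 s2 k0n k1n mn km0; set a := p0`_k0; set b := p1`_k1; set c := p2`_m.
move=> a0 c0 b0k acn gij sol.
case: (ltngtP (k0 + m)%N (2 * k1)%N) gij => [gt|lt|e] gij.
- (* P1 dominates: y ~ - P1 / P2 *)
  have b0 : b != 0 by apply/eqP => /b0k z; move: gt; rewrite z.
  have [] := @simple_root_formal R n k0 k1 m p0 p1 p2 i j (2 * (2 * k1 - (k0 + m))) 0 (- b / c) => //.
  + by lia.
  + by lia.
  + rewrite -/a -/b -/c eqxx (_ : (2 * (2 * k1 - (k0 + m)) == 0)%N = false) /=; last by lia.
    by field.
  + by rewrite -/b -/c /= (_ : _ + _ = - b) ?oppr_eq0 //; field.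
  move=> h [h0 eh]; exists h; split => //; last by lia.
  by rewrite h0 mulf_neq0 ?oppr_eq0 ?invr_eq0.
- (* P1 is negligible: y^2 ~ - P0 / P2 *)
  have [ac|ac] := ltP 0 (a * c).
    have [_ cn] := acn ac.
    exfalso; apply: (@no_end_sol_of_neg_disc R k0 k1 m p0 p1 p2) sol => //; first exact: ltnW.
    rewrite (_ : (2 * k1 == k0 + m)%N = false); last by lia.
    by rewrite -/a -/c -mulrA mulr_gt0.
  have ac0 : 0 < - a / c.
    rewrite (_ : - a / c = - (a * c) / c ^+ 2); last by field.
    rewrite divr_gt0 ?exprn_even_gt0 // oppr_gt0 lt_neqAle ac andbT.
    by rewrite mulf_neq0.
  have sq : Num.sqrt (- a / c) ^+ 2 = - a / c by rewrite sqr_sqrtr // ltW.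
  have sq0 : Num.sqrt (- a / c) != 0 by rewrite sqrtr_eq0 -ltNge.
  have [] := @simple_root_formal R n k0 k1 m p0 p1 p2 i j 0 (k0 + m - 2 * k1) (Num.sqrt (- a / c)) => //.
  + by lia.
  + by lia.
  + rewrite -/a -/b -/c eqxx sq (_ : (k0 + m - 2 * k1 == 0)%N = false) /=; last by lia.
    by field.
  + rewrite -/b -/c (_ : (k0 + m - 2 * k1 == 0)%N = false) /=; last by lia.
    by rewrite mul0r add0r mulf_neq0 // mulf_neq0 // pnatr_eq0.
  move=> h [h0 eh]; exists h; split => //; last by lia.
  by rewrite h0.
have [lt|gt|dd] := ltgtP (b ^+ 2) (4 * a * c).
- exfalso; apply: (@no_end_sol_of_neg_disc R k0 k1 m p0 p1 p2) sol => //; first by lia.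
    have := le_lt_trans (sqr_ge0 b) lt; rewrite -mulrA pmulr_rgt0 // => /acn[] //.
  by rewrite -e eqxx.
- pose d := b ^+ 2 - 4 * a * c.
  have d0 : 0 < d by rewrite subr_gt0.
  have sq : Num.sqrt d ^+ 2 = d by rewrite sqr_sqrtr // ltW.
  have sq0 : Num.sqrt d != 0 by rewrite sqrtr_eq0 -ltNge.
  pose h0 := (- b + Num.sqrt d) / (2 * c).
  have root : a + b * h0 + c * h0 ^+ 2 = 0.
    have : (2 * c * h0 + b) ^+ 2 = d by rewrite -sq /h0; congr (_ ^+ 2); field.
    move=> e2; apply: (mulfI (_ : 4 * c != 0)); first by rewrite mulf_neq0 // pnatr_eq0.
    by rewrite mulr0 -[RHS](subrr d) -{1}e2 /d; ring.
  have [] := @simple_root_formal R n k0 k1 m p0 p1 p2 i j 0 0 h0 => //.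
  + by lia.
  + by lia.
  + by rewrite -/a -/b -/c eqxx !mul1r.
  + rewrite -/b -/c eqxx mul1r /h0 (_ : _ + _ = Num.sqrt d) //; by field.
  move=> h [h00 eh]; exists h; split => //.
    rewrite h00; apply: contra_neq a0 => z; move: root; rewrite z; lra.
  by move=> _ dd; move: gt; rewrite dd ltxx.
have b0 : b != 0.
  apply: contra_neq a0 => z; move: dd; rewrite z expr0n /= => /esym/eqP.
  by rewrite !mulf_eq0 (negPf c0) pnatr_eq0 orbF /= => /eqP.
have k10 : (0 < k1)%N by lia.
have [an cn] : a < 0 /\ c < 0.
  apply: acn; have : 0 < b ^+ 2 by rewrite exprn_even_gt0.
  by rewrite dd -mulrA pmulr_rgt0.
have bp : 0 < b.
  rewrite lt_neqAle eq_sym b0 leNgt; apply/negP => bn.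
  exact: (no_end_sol_of_neg_leads s0 s1 s2 an bn cn sol).
have [tau [t0 et]] := end_sol_double_root s0 s1 s2 k0n k1n mn (esym e) k10 dd an bp sol.
have [|g eg] := @ser_inv R (qs k1 p1 * (1 + tau)).
  by rewrite serM0 qs_at0 serD t0 addr0 ser1 mulr1.
have g0 : g 0%N = b^-1.
  have := congr1 (fun f : ser R => f 0%N) eg.
  rewrite serM0 serM0 qs_at0 serD t0 addr0 ser1 mulr1 -/b => e1.
  by apply: (mulfI b0); rewrite e1 divff.
have two0 : (2%:R : ser R) 0%N = 2.
  by rewrite (_ : 2%:R = sC 2) ?sCE // /sC rmorph_nat rmorph_nat.
(* Y = -2 p0 / (p1 (1 + tau)), after division by the unit p1 (1 + tau) read at
   infinity. *)
exists (- (2%:R * qs k0 p0 * g)); split.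
- rewrite serN !serM0 two0 qs_at0 g0 oppr_eq0 !mulf_neq0 ?invr_eq0 // pnatr_eq0 //.
- move=> _ _; rewrite serN !serM0 two0 qs_at0 g0 -/a.
  have -> : c = b ^+ 2 / (4 * a) by rewrite dd; field.
  by field; rewrite ?b0 ?a0 ?lt_eqF // b0.
apply: (@orbit_form_cancel R n p0 p1 p2 (2 * (n - k1))).
have := congr1 (fun f => (sX ^+ j * g) ^+ 3 * f) et.
rewrite mulr0 -orbit_formZ (qs_shift s0 k0n) (qs_shift s1 k1n) => <-.
have E : sX ^+ (2 * (n - k1)) * sX ^+ i = sX ^+ j * sX ^+ (2 * (n - k0)).
  by rewrite -!exprD; congr (_ ^+ _); lia.
congr orbit_form.
  by rewrite mulrA E; ring.
transitivity (sX ^+ (2 * (n - k1)) * sX ^+ j * (qs k1 p1 * (1 + tau) * g)).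
  by rewrite eg mulr1.
by ring.
Qed.

Lemma lead_data (n : nat) (p : {poly R}) (k := (size p).-1) :
  (size p <= n.+1)%N -> [/\ (size p <= k.+1)%N, (k <= n)%N &
   (p != 0 -> p`_k != 0) /\ (p`_k = 0 -> k = 0%N)].
Proof.
move=> sp; split; [by rewrite /k leqSpred | by rewrite /k; lia |].
split; first by rewrite -lead_coefE lead_coef_eq0.
by rewrite -lead_coefE => /eqP; rewrite lead_coef_eq0 /k => /eqP->; rewrite size_poly0.
Qed.

Lemma lead_lt (n : nat) (p : {poly R}) (k := (size p).-1) : (0 < n)%N ->
  (size p <= n.+1)%N -> p`_n = 0 -> (k < n)%N.
Proof.
move=> n0 sp pn; rewrite /k; case: (ltngtP (size p) n.+1) sp => // [lt|e] _; first by lia.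
have : lead_coef p = 0 by rewrite lead_coefE e.
by move/eqP; rewrite lead_coef_eq0 => /eqP->; rewrite size_poly0.
Qed.

(** Here p0 dominates, so that Y tends to infinity and v = 1 / Y is a power series
    without constant term. *)
Lemma end_sol_formal_unbounded n (p0 p1 p2 : {poly R}) : (0 < n)%N ->
  (size p0 <= n.+1)%N -> (size p1 <= n.+1)%N -> (size p2 <= n.+1)%N ->
  p0`_n < 0 -> p1`_n = 0 -> p2`_n = 0 -> p2 != 0 -> end_sol p0 p1 p2 ->
  exists f : ser R, [/\ f 0%N = 0, (exists k : nat, f k <> 0) &
     orbit_form n p0 p1 p2 1 f = 0].
Proof.
case: n => // n' _; set n := n'.+1 => s0 s1 s2 a0 b0 c0 p2n sol.
have [S1 k1n [_ b1]] := lead_data s1; have [S2 mn [c1 _]] := lead_data s2.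
have lt1 := lead_lt (isT : 0 < n)%N s1 b0; have lt2 := lead_lt (isT : 0 < n)%N s2 c0.
pose j := (if (n + (size p2).-1 < 2 * (size p1).-1)%N
           then (2 * (size p1).-1 - 2 * (size p2).-1)%N else (n - (size p2).-1)%N).
have [] := @end_sol_formal n' n (size p1).-1 (size p2).-1 p0 p1 p2 0 j => //.
- by rewrite lt_eqF.
- exact: c1.
- by rewrite nmulr_rgt0.
- rewrite /j -/n; case: ltnP => ?; lia.
move=> h [h0 _]; rewrite expr0 mul1r => eh.
have [g hg] := ser_inv h0.
have g0 : g 0%N != 0.
  apply/eqP => z; have := congr1 (fun f : ser R => f 0%N) hg.
  by rewrite serM0 z mulr0 ser1 /= => /eqP; rewrite eq_sym oner_eq0.
exists (sX ^+ j * g); split.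
- by rewrite serM0 sXn0 (_ : _ == _ = false) ?mul0r // /j; case: ltnP => ?; lia.
- by exists j; rewrite coef_sXnM ltnn subnn; apply/eqP.
have := orbit_formZ n p0 p1 p2 g h (sX ^+ j).
by rewrite eh mulr0 [g * h]mulrC hg [g * _]mulrC.
Qed.

(** Here p2 has maximal degree and the leading quadratic polynomial has a double
    root, so that Y is a power series whose constant term is that root. *)
Lemma end_sol_formal_bounded n (p0 p1 p2 : {poly R}) : (0 < n)%N ->
  (size p0 <= n.+1)%N -> (size p1 <= n.+1)%N -> (size p2 <= n.+1)%N ->
  p2`_n < 0 -> p1`_n ^+ 2 = 4 * p0`_n * p2`_n -> p0 != 0 -> end_sol p0 p1 p2 ->
  exists f : ser R, f 0%N = - p1`_n / (2 * p2`_n) /\ orbit_form n p0 p1 p2 f 1 = 0.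
Proof.
case: n => // n' _; set n := n'.+1 => s0 s1 s2 c0 disc p0n sol.
have cn : p2`_n != 0 by rewrite lt_eqF.
have [S0 k0n [a1 _]] := lead_data s0; have [S1 k1n [_ b1]] := lead_data s1.
have kE (p : {poly R}) : (size p <= n.+1)%N -> p`_n != 0 -> (size p).-1 = n.
  move=> sp pn; suff : (n < size p)%N by move=> h; apply/eqP; rewrite eqn_leq; lia.
  by rewrite ltnNge; apply: contraNN pn => h; rewrite nth_default.
have k0E := kE _ s0; have k1E := kE _ s1.
pose k0 := (size p0).-1; pose k1 := (size p1).-1.
pose i := (if (k0 + n < 2 * k1)%N then (2 * n - 2 * k1)%N else (n - k0)%N).
have [] := @end_sol_formal n' k0 k1 n p0 p1 p2 i 0 => //.
- by rewrite addnS.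
- exact: a1.
- by rewrite nmulr_lgt0.
- by rewrite /i; case: ltnP => ?; lia.
move=> h [h0 hd]; rewrite expr0 => eh; exists (sX ^+ i * h); split => //.
have [p0z|p0nz] := eqVneq p0`_n 0.
  have p1z : p1`_n = 0.
    by apply/eqP; rewrite -sqrf_eq0 disc p0z mulr0 mul0r.
  have := lead_lt (isT : 0 < n)%N s0 p0z; rewrite -/k0 => lt0.
  have := lead_lt (isT : 0 < n)%N s1 p1z; rewrite -/k1 => lt1.
  rewrite serM0 sXn0 (_ : _ == _ = false); first by rewrite p1z oppr0 !mul0r.
  by rewrite /i; case: ltnP => ?; lia.
have p1nz : p1`_n != 0.
  by rewrite -sqrf_eq0 disc !mulf_neq0 // pnatr_eq0.
have e0 := k0E p0nz; have e1 := k1E p1nz.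
have -> : i = 0%N by rewrite /i /k0 /k1 e0 e1; case: ltnP => ?; lia.
rewrite expr0 mul1r hd /k0 /k1 ?e0 ?e1 //; lia.
Qed.
End RealToFormal.

(** * From formal solutions to barriers *)

Section Barrier.
Variable R : realType.
Local Notation sX := (sX R).
Implicit Types (f g a b : ser R) (p : {poly R}).

(** A solution of Y Y' = p0 + p1 Y + p2 Y^2 can cross the graph of be only upwards. *)
Definition barrier (p0 p1 p2 : {poly R}) : Prop :=
  exists (be be' : R -> R) (X0 : R), forall x, X0 <= x ->
   [/\ 0 < be x, is_derive x (1 : R) be (be' x) &
       0 < p0.[x] + p1.[x] * be x + p2.[x] * be x ^+ 2 - be x * be' x].

Definition eqmod N f g := exists r, f = g + sX ^+ N * r.

Lemma eqmod_refl N f : eqmod N f f.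
Proof. by exists 0; rewrite mulr0 addr0. Qed.
Lemma eqmodD N f f' g g' : eqmod N f f' -> eqmod N g g' -> eqmod N (f + g) (f' + g').
Proof. by move=> [r ->] [q ->]; exists (r + q); ring. Qed.
Lemma eqmodN N f f' : eqmod N f f' -> eqmod N (- f) (- f').
Proof. by move=> [r ->]; exists (- r); ring. Qed.
Lemma eqmodM N f f' g g' : eqmod N f f' -> eqmod N g g' -> eqmod N (f * g) (f' * g').
Proof. by move=> [r ->] [q ->]; exists (f' * q + r * g' + sX ^+ N * r * q); ring. Qed.
Lemma eqmodX N f f' k : eqmod N f f' -> eqmod N (f ^+ k) (f' ^+ k).
Proof.
move=> h; elim: k => [|k IH]; first exact: eqmod_refl.
by rewrite !exprS; apply: eqmodM.
Qed.
Lemma eqmod_theta N f f' : eqmod N f f' -> eqmod N (theta f) (theta f').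
Proof.
move=> [r ->]; exists (sC (N%:R / 2) * r + theta r).
by rewrite thetaD thetaM thetaXn; ring.
Qed.
Lemma eqmod_trunc N f : eqmod N (ser_of_poly (ser_trunc N f)) f.
Proof.
have h : forall j, (j < N)%N -> (ser_of_poly (ser_trunc N f) - f) j = 0.
  by move=> j jN; rewrite serB /ser_of_poly coef_trunc ?subrr.
by exists (fun j => (ser_of_poly (ser_trunc N f) - f) (N + j)%N); rewrite -(ser_factor h); ring.
Qed.
Lemma eqmod_coef N f g j : eqmod N f g -> (j < N)%N -> f j = g j.
Proof. by move=> [r ->] jN; rewrite serD coef_sXnM jN addr0. Qed.

Lemma eqmod_orbit_form N n p0 p1 p2 a a' b b' : eqmod N a a' -> eqmod N b b' ->
  eqmod N (orbit_form n p0 p1 p2 a b) (orbit_form n p0 p1 p2 a' b').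
Proof.
move=> ha hb; rewrite /orbit_form.
by do ?[apply: eqmodD | apply: eqmodM | apply: eqmodN | apply: eqmodX |
  apply: eqmod_theta | exact: eqmod_refl | assumption].
Qed.

Definition low f v := (forall j, (j < v)%N -> f j = 0) /\ f v != 0.

Lemma low_exists f : f != 0 -> exists v, low f v.
Proof.
move=> f0; have ex : exists v, f v != 0.
  apply: contrapT => no; case/eqP: f0; apply/funext => k; rewrite ser0.
  by apply: contrapT => /eqP h; apply: no; exists k.
case: (ex_minnP ex) => v fv vmin; exists v; split => // j jv.
apply: contrapT => /eqP /vmin; lia.
Qed.

Lemma lowM f g v w : low f v -> low g w ->
  low (f * g) (v + w) /\ (f * g) (v + w)%N = f v * g w.
Proof.
move=> [fz fv] [gz gw]; rewrite (ser_factor fz) (ser_factor gz).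
set f' : ser R := fun j => _; set g' : ser R := fun j => _.
have -> : sX ^+ v * f' * (sX ^+ w * g') = sX ^+ (v + w) * (f' * g').
  by rewrite exprD; ring.
have e : (sX ^+ (v + w) * (f' * g')) (v + w)%N = f v * g w.
  by rewrite coef_sXnM ltnn subnn serM0 /f' /g' !addn0.
have e1 : (sX ^+ v * f') v = f v by rewrite coef_sXnM ltnn subnn /f' addn0.
have e2 : (sX ^+ w * g') w = g w by rewrite coef_sXnM ltnn subnn /g' addn0.
rewrite e e1 e2; split => //; split; last by rewrite e mulf_neq0.
by move=> j jl; rewrite coef_sXnM jl.
Qed.

Lemma poly_low_pos p v : (forall j, (j < v)%N -> p`_j = 0) -> 0 < p`_v ->
  exists2 d, 0 < d & forall s, 0 < s < d -> 0 < p.[s].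
Proof.
move=> pz pv.
have [r er] : exists r, p = 'X^v * r.
  exists (drop_poly v p); rewrite mulrC -[LHS](poly_take_drop v).
  rewrite (_ : take_poly v p = 0) ?add0r //; apply/polyP => i.
  by rewrite coef_take_poly coef0; case: ifP => // /pz.
have r0 : 0 < r.[0] by move: pv; rewrite er coefXnM ltnn subnn horner_coef0.
have : \forall s \near (0 : R), 0 < r.[s].
  have : {for (0:R), continuous (horner r)} by apply: continuous_horner.
  by move=> /cvgr_gt; apply.
move=> /nbhs_ballP [d /= d0 h]; exists d => // s /andP[s0 sd].
rewrite er hornerM hornerXn mulr_gt0 ?exprn_gt0 //; apply: h.
by rewrite /ball /= sub0r normrN gtr0_norm.
Qed.

Definition theta_poly p : {poly R} := 2^-1 *: ('X * p^`()).
Lemma theta_polyE p : ser_of_poly (theta_poly p) = theta (ser_of_poly p).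
Proof.
apply/funext => k; rewrite /theta_poly /theta /ser_of_poly coefZ coefXM.
case: k => [|k] /=; first by rewrite mulr0 !mul0r.
by rewrite coef_deriv -mulr_natr; ring.
Qed.

Definition orbit_formP n (p0 p1 p2 A B : {poly R}) : {poly R} :=
  'X^(2 * n + 2) * A * (B * theta_poly A - A * theta_poly B)
  + B * (qp n p0 * B ^+ 2 + qp n p1 * (A * B) + qp n p2 * A ^+ 2).

Lemma orbit_formPE n p0 p1 p2 A B :
  ser_of_poly (orbit_formP n p0 p1 p2 A B) =
  orbit_form n p0 p1 p2 (ser_of_poly A) (ser_of_poly B).
Proof.
by rewrite /orbit_formP /orbit_form !(rmorphD, rmorphM, rmorphXn, rmorphN) /= !theta_polyE.
Qed.

(** The residual of the barrier be = ep A / B has the sign of B times the orbit form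
    of (A, B); the derivative of s = x^(-1/2) is - s^3 / 2. *)
Lemma residual n (p0 p1 p2 A B : {poly R}) (s ep : R) :
  (size p0 <= n.+1)%N -> (size p1 <= n.+1)%N -> (size p2 <= n.+1)%N ->
  s != 0 -> B.[s] != 0 -> ep ^+ 2 = 1 ->
  let be := ep * (A.[s] / B.[s]) in
  let be' := ep * ((A^`().[s] * B.[s] - A.[s] * B^`().[s]) / B.[s] ^+ 2 * (- s ^+ 3 / 2)) in
  p0.[s ^- 2] + (ep *: p1).[s ^- 2] * be + p2.[s ^- 2] * be ^+ 2 - be * be' =
  (orbit_formP n p0 p1 p2 A B * B).[s] / (s ^+ (2 * n) * B.[s] ^+ 4).
Proof.
move=> s0 s1 s2 sn Bn ep2 be be'.
have ph p : (size p <= n.+1)%N -> p.[s ^- 2] = (qp n p).[s] / s ^+ (2 * n).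
  by move=> sp; rewrite horner_qp // mulrC mulKf // expf_neq0.
have -> : (orbit_formP n p0 p1 p2 A B * B).[s] = B.[s] * (s ^+ (2 * n) * s ^+ 2 * A.[s] *
    (B.[s] * (2^-1 * (s * A^`().[s])) - A.[s] * (2^-1 * (s * B^`().[s]))) +
    B.[s] * ((qp n p0).[s] * B.[s] ^+ 2 + (qp n p1).[s] * (A.[s] * B.[s]) +
      (qp n p2).[s] * A.[s] ^+ 2)).
  rewrite /orbit_formP /theta_poly !(hornerM, hornerD, hornerN, hornerZ, hornerXn, horner_exp, hornerX).
  by rewrite exprD; ring.
rewrite hornerZ !ph //.
have -> : be ^+ 2 = (A.[s] / B.[s]) ^+ 2 by rewrite /be exprMn ep2 mul1r.
rewrite (_ : be * be' = ep ^+ 2 * (A.[s] / B.[s] * ((A^`().[s] * B.[s] - A.[s] * B^`().[s]) / B.[s] ^+ 2 * (- s ^+ 3 / 2)))); last by rewrite /be /be'; ring.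
rewrite (_ : ep * _ * be = ep ^+ 2 * ((qp n p1).[s] / s ^+ (2 * n) * (A.[s] / B.[s]))); last by rewrite /be; ring.
rewrite ep2.
have : s ^+ (2 * n) != 0 by rewrite expf_neq0.
move: (s ^+ (2 * n)) => S Sn.
by field; apply/andP.
Qed.

Lemma low_eqmod N f g v : eqmod N f g -> (v < N)%N -> low g v ->
  low f v /\ f v = g v.
Proof.
move=> h vN [gz gv]; rewrite /low (eqmod_coef h vN); split => //; split => // j jv.
by rewrite (eqmod_coef h) ?gz //; lia.
Qed.

(** Perturb b to b + c s^M and truncate.  The first-order change of the orbit form is
    c s^M (K - (M / 2) s^(2n+2) a^2), where K does not depend on M.  For large M the
    coefficient of s^w in the bracket is nonzero, so its leading coefficient, of
    order l <= w < M, survives both the quadratic terms and the truncation, and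
    the sign of c makes the residual positive. *)
Lemma formal_barrier n (p0 p1 p2 : {poly R}) a b :
  (size p0 <= n.+1)%N -> (size p1 <= n.+1)%N -> (size p2 <= n.+1)%N ->
  a != 0 -> b != 0 -> orbit_form n p0 p1 p2 a b = 0 ->
  exists ep : R, ep ^+ 2 = 1 /\ barrier p0 (ep *: p1) p2.
Proof.
move=> sz0 sz1 sz2 a0 b0 Eab.
have [va la] := low_exists a0; have [vb lb] := low_exists b0.
pose Q0 := qs n p0; pose Q1 := qs n p1; pose Q2 := qs n p2.
pose K : ser R := 3%:R * Q0 * b ^+ 2 + 2%:R * Q1 * (a * b) + Q2 * a ^+ 2
  + sX ^+ (2 * n + 2) * (a * theta a).
pose w := (2 * n + 2 + (va + va))%N.
have [la2 a2v] := lowM la la.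
have [M [Mw Mb MK]] : exists M, [/\ (w < M)%N, (vb < M)%N & K w < M%:R / 2 * a va ^+ 2].
  have av2 : 0 < a va ^+ 2 by rewrite exprn_even_gt0 //; case: la.
  have [N hN] : exists N : nat, K w / (a va ^+ 2 / 2) < N%:R.
    exists (Num.bound `|K w / (a va ^+ 2 / 2)|).
    exact: le_lt_trans (ler_norm _) (archi_boundP (normr_ge0 _)).
  exists (maxn (maxn w.+1 vb.+1) N); split; try lia.
  move: hN; rewrite ltr_pdivrMr; last by rewrite divr_gt0.
  move=> /lt_le_trans; apply; rewrite mulrA [X in X <= _]mulrAC ler_pM2r //.
  by rewrite ler_wpM2r // ?invr_ge0 // ler_nat leq_maxr.
pose La : ser R := K - sC (M%:R / 2) * (sX ^+ (2 * n + 2) * (a * a)).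
have Law : La w != 0.
  rewrite /La serB coef_sCM /w coef_sXnM ltnNge leq_addr /= addKn a2v -expr2 -/w.
  by rewrite subr_eq0 lt_eqF.
have [l ll] : exists l, low La l.
  by apply: low_exists; apply: contraNneq Law => ->; rewrite ser0.
have lw : (l <= w)%N.
  by rewrite leqNgt; apply/negP => h; case/eqP: Law; case: ll => + _; apply.
pose c := La l * b vb.
have c0 : c != 0 by rewrite mulf_neq0 //; [case: ll | case: lb].
pose ka := Num.sg c.
pose de : ser R := sC ka * sX ^+ M.
have EF : exists E, orbit_form n p0 p1 p2 a (b + de) = sX ^+ M * (sC ka * La + sX ^+ M * E).
  exists (sC ka ^+ 2 * (3%:R * Q0 * b + Q1 * a) + sX ^+ M * sC ka ^+ 3 * Q0).
  rewrite -[LHS]subr0 -[X in _ - X]Eab /orbit_form /La /K -/Q0 -/Q1 -/Q2 /de thetaD !thetaM thetaC thetaXn.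
  by ring.
have [E eE] := EF.
have lF : low (orbit_form n p0 p1 p2 a (b + de)) (M + l) /\
   orbit_form n p0 p1 p2 a (b + de) (M + l)%N = ka * La l.
  have lt : (l < M)%N by lia.
  have coefE j : (j < M)%N -> (sC ka * La + sX ^+ M * E) j = ka * La j.
    by move=> jM; rewrite serD coef_sCM coef_sXnM jM addr0.
  have e : orbit_form n p0 p1 p2 a (b + de) (M + l)%N = ka * La l.
    by rewrite eE coef_sXnM ltnNge leq_addr /= addKn coefE.
  split => //; split; last by rewrite e mulf_neq0 ?sgr_eq0 //; case: ll.
  move=> j jl; rewrite eE coef_sXnM; case: ltnP => // Mj.
  have jl' : (j - M < l)%N by lia.
  by rewrite coefE ?(ll.1 _ jl') ?mulr0 //; lia.
(* Any order above M + l will do. *)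
pose N := (2 * M).+1.
pose A := ser_trunc N a; pose B := ser_trunc N (b + de).
have hA : eqmod N (ser_of_poly A) a by exact: eqmod_trunc.
have hB : eqmod N (ser_of_poly B) (b + de) by exact: eqmod_trunc.
have vaN : (va < N)%N by rewrite /N; move: Mw; rewrite /w; lia.
have vbN : (vb < N)%N by rewrite /N; lia.
have MlN : (M + l < N)%N by rewrite /N; lia.
have [lA eA] := low_eqmod hA vaN la.
have lbd : low (b + de) vb /\ (b + de) vb = b vb.
  have z j : (j < M)%N -> (b + de) j = b j.
    by move=> jM; rewrite /de serD coef_sCM sXnE /ser_of_poly coefXn ltn_eqF // mulr0 addr0.
  split; last by rewrite z.
  split; last by rewrite z //; case: lb.
  by move=> j jv; rewrite z ?lb.1 //; lia.
have [lB eB] := low_eqmod hB vbN lbd.1.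
have [lE eE'] := low_eqmod (eqmod_orbit_form n p0 p1 p2 hA hB) MlN lF.1.
move: lE eE'; rewrite -orbit_formPE lF.2 => lE eE'.
move: eB; rewrite lbd.2 => eB.
have [lEB eEB] := lowM lE lB.
have [lAB eAB] := lowM lA lB.
move: lEB eEB lAB eAB; rewrite -!rmorphM /= eE' eA eB => lEB eEB lAB eAB.
pose ep := Num.sg (a va * b vb).
have ab0 : a va * b vb != 0 by rewrite mulf_neq0 //; [case: la | case: lb].
have ep2 : ep ^+ 2 = 1 by rewrite /ep sqr_sg ab0.
have [|d1 d10 h1] := @poly_low_pos (orbit_formP n p0 p1 p2 A B * B) (M + l + vb) lEB.1.
  rewrite (_ : _`_ _ = ka * La l * b vb) // -mulrA -/c /ka.
  by rewrite -normrEsg normr_gt0.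
have [||d2 d20 h2] := @poly_low_pos (ep *: (A * B)) (va + vb).
- by move=> j jl; rewrite coefZ (_ : (A * B)`_j = 0) ?mulr0 //; apply: lAB.1.
- rewrite coefZ (_ : (A * B)`_ _ = a va * b vb) // /ep.
  by rewrite -normrEsg normr_gt0.
exists ep; split => //.
pose sx (x : R) := (Num.sqrt x)^-1.
pose dd := Num.min d1 d2.
have dd0 : 0 < dd by rewrite lt_min d10.
have big x : (dd ^- 2 + 1) <= x -> [/\ 0 < x, 0 < sx x < d1, 0 < sx x < d2 & sx x ^- 2 = x].
  move=> hx.
  have x0 : 0 < x by apply: lt_le_trans hx; rewrite ltr_wpDl // invr_ge0 exprn_ge0 // ltW.
  have s0 : 0 < sx x by rewrite invr_gt0 sqrtr_gt0.
  have e2 : sx x ^- 2 = x by rewrite /sx exprVn invrK sqr_sqrtr // ltW.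
  have sd : sx x < dd.
    rewrite -ltf_pV2 ?posrE // invrK -(ltr_pXn2r (_ : (0 < 2)%N)) ?nnegrE ?sqrtr_ge0 ?invr_ge0 ?ltW //.
    by rewrite sqr_sqrtr ?ltW // exprVn; lra.
  by move: sd; rewrite lt_min => /andP[-> ->]; rewrite s0.
exists (fun x => ep * (A.[sx x] / B.[sx x])),
  (fun x => ep * ((A^`().[sx x] * B.[sx x] - A.[sx x] * B^`().[sx x]) / B.[sx x] ^+ 2
     * (- sx x ^+ 3 / 2))), (dd ^- 2 + 1) => x /big[x0 /h1 E0 s2 e2].
have := h2 _ s2; rewrite hornerZ hornerM => AB0.
have s0 : 0 < sx x by case/andP: s2.
have B0 : B.[sx x] != 0.
  by apply/eqP => z; move: AB0; rewrite z !mulr0 ltxx.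
have B2 : 0 < B.[sx x] ^+ 2 by rewrite exprn_even_gt0.
split.
- rewrite (_ : ep * _ = ep * (A.[sx x] * B.[sx x]) / B.[sx x] ^+ 2); last by field.
  by rewrite divr_gt0.
- have ds : is_derive x (1 : R) sx (- sx x ^+ 3 / 2).
    have sq0 : Num.sqrt x != 0 by rewrite gt_eqF // sqrtr_gt0.
    apply: is_derive_eq (@dV R Num.sqrt x _ sq0 (is_derive1_sqrt x0)) _.
    by rewrite /sx; field.
  apply: is_derive_eq (dM (dC ep x) (@dDiv R (fun x => A.[sx x]) (fun x => B.[sx x]) x _ _ B0
    (dP A ds) (dP B ds))) _.
  by field.
have := @residual n p0 p1 p2 A B (sx x) ep sz0 sz1 sz2 _ B0 ep2.
rewrite e2 => ->; last by rewrite gt_eqF.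
apply: divr_gt0 => //; apply: mulr_gt0; first by rewrite exprn_gt0.
by rewrite exprn_even_gt0.
Qed.
End Barrier.

(** * Global solutions of bounded Lipschitz systems *)

Section ODE.
Variable R : realType.
Implicit Types (f g : R -> R) (t a b c : R).

Lemma primitive_loc f N : 0 < N -> continuous f ->
  exists F : R -> R, F 0 = 0 /\ forall t, - N < t < N -> is_derive t (1 : R) F (f t).
Proof.
move=> N0 cf.
pose F0 x := (\int[lebesgue_measure]_(t in `[- N, x]) f t)%R.
have int : lebesgue_measure.-integrable `[- N, N] (EFin \o f).
  apply: continuous_compact_integrable; first exact: segment_compact.
  exact: continuous_subspaceT.
exists (fun x => F0 x - F0 0); split; first by rewrite subrr.
move=> t /andP[tl tr].
have [dF eF] := continuous_FTC1_closed tr int tl (cf t).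
rewrite -[f t]subr0; apply: dB (dC _ _).
by apply: DeriveDef => //; rewrite -derive1E.
Qed.

Lemma primitive_unique F G f N : F 0 = 0 -> G 0 = 0 ->
  (forall t, - N < t < N -> is_derive t (1 : R) F (f t)) ->
  (forall t, - N < t < N -> is_derive t (1 : R) G (f t)) ->
  forall t, - N < t < N -> F t = G t.
Proof.
move=> F0 G0 dF dG t tN.
have dd s : - N < s < N -> is_derive s (1 : R) (fun x => F x - G x) 0.
  by move=> sN; rewrite -(subrr (f s)); exact: (dB (dF s sN) (dG s sN)).
have dd' s : - N < s < N -> is_derive s (1 : R) (fun x => - (F x - G x)) 0.
  by move=> sN; rewrite -oppr0; exact: (dN (dd s sN)).
have [/andP[tl tr]] := tN.
have N0 : 0 < N by lra.
apply/eqP; rewrite -subr_eq0 eq_le.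
case: (leP 0 t) => t0.
  have sub s : 0 <= s <= t -> - N < s < N.
    by move=> /andP[s0 st]; apply/andP; split; lra.
  have := @nondec R _ (fun=> 0) 0 t t0 (fun s h => dd s (sub s h)) (fun _ _ => lexx _).
  have := @nondec R _ (fun=> 0) 0 t t0 (fun s h => dd' s (sub s h)) (fun _ _ => lexx _).
  by rewrite F0 G0 subrr oppr0 oppr_ge0 => -> ->.
have sub s : t <= s <= 0 -> - N < s < N.
  by move=> /andP[s0 st]; apply/andP; split; lra.
have := @nondec R _ (fun=> 0) t 0 (ltW t0) (fun s h => dd s (sub s h)) (fun _ _ => lexx _).
have := @nondec R _ (fun=> 0) t 0 (ltW t0) (fun s h => dd' s (sub s h)) (fun _ _ => lexx _).
by rewrite F0 G0 subrr oppr0 oppr_le0 => -> ->.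
Qed.

(** The primitives on the intervals ]-N, N[ that vanish at 0 agree where they are
    both defined. *)
Lemma primitive f : continuous f ->
  exists F : R -> R, F 0 = 0 /\ forall t, is_derive t (1 : R) F (f t).
Proof.
move=> cf.
have ex (N : R) : exists F : R -> R, 0 < N ->
    F 0 = 0 /\ forall t, - N < t < N -> is_derive t (1 : R) F (f t).
  case: (ltP 0 N) => N0; last by exists (fun=> 0).
  by have [F hF] := primitive_loc N0 cf; exists F.
have [P hP] := choice ex.
exists (fun t => P (`|t| + 1) t); split.
  have p1 : 0 < `|0 : R| + 1 by rewrite normr0 add0r.
  by have [F0 _] := hP _ p1.
move=> t.
pose N := `|t| + 2.
have N0 : 0 < N by rewrite /N; have := normr_ge0 t; lra.
have tN : - N < t < N.
  by rewrite -ltr_norml /N; lra.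
have [G0 dG] := hP N N0.
suff near_eq : \near t, P N t = P (`|t| + 1) t by exact: near_eq_is_derive near_eq (dG t tN).
have : \forall s \near t, `|t - s| < 1.
  by apply/nbhs_ballP; exists 1 => //= s.
apply: filterS => s ts.
have s1 : - (`|s| + 1) < s < `|s| + 1 by rewrite -ltr_norml; lra.
have p1 : 0 < `|s| + 1 by have := normr_ge0 s; lra.
have sN : `|s| + 1 < N.
  by have := ler_normB t (t - s); rewrite subKr /N; lra.
have [F0 dF] := hP _ p1.
apply: (primitive_unique G0 F0 (f := f) (N := `|s| + 1)) => // u /andP[ul ur].
by apply: dG; apply/andP; split; lra.
Qed.
End ODE.

Section Picard.
Variable R : realType.
Implicit Types (f : R -> R) (t a b c : R).

Lemma le_half_pow (x y c : R) : (forall k : nat, x <= y + c * 2^-1 ^+ k) -> x <= y.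
Proof.
move=> h; rewrite leNgt; apply/negP => yx.
pose k := Num.bound (`|c| / (x - y)).
have xy : 0 < x - y by rewrite subr_gt0.
have := archi_boundP (_ : 0 <= `|c| / (x - y)).
rewrite -/k => /(_ (divr_ge0 (normr_ge0 _) (ltW xy))).
rewrite ltr_pdivrMr // => ck.
have kp : (k%:R : R) <= 2 ^+ k by rewrite -natrX ler_nat ltnW // ltn_expl.
have p2 : 0 < (2 : R) ^+ k by rewrite exprn_gt0.
have := h k; rewrite exprVn -lerBlDl ler_pdivlMr // => xc.
have : k%:R * (x - y) <= 2 ^+ k * (x - y) by rewrite ler_wpM2r // ltW.
have := ler_norm c; lra.
Qed.

Lemma geo_limit (u : nat -> R) (c : R) : 0 <= c ->
  (forall k, `|u k.+1 - u k| <= c * 2^-1 ^+ k) ->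
  exists l, forall k, `|u k - l| <= 2 * c * 2^-1 ^+ k.
Proof.
move=> c0 hu.
pose e k : R := 2 * c * 2^-1 ^+ k.
have eS k : e k.+1 = e k - c * 2^-1 ^+ k by rewrite /e exprS; field.
have e0 k : 0 <= e k by rewrite !mulr_ge0 // exprn_ge0 // invr_ge0.
have up k m : u (k + m)%N + e (k + m)%N <= u k + e k.
  elim: m => [|m IH]; first by rewrite addn0.
  apply: le_trans IH; rewrite addnS eS.
  by have := hu (k + m)%N; rewrite ler_norml => /andP[_]; lra.
have dn k m : u k - e k <= u (k + m)%N - e (k + m)%N.
  elim: m => [|m IH]; first by rewrite addn0.
  apply: le_trans IH _; rewrite addnS eS.
  by have := hu (k + m)%N; rewrite ler_norml => /andP[+ _]; lra.
have cross k m : u k - e k <= u m + e m.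
  apply: le_trans (dn k m) _; rewrite addnC; apply: le_trans (up m k).
  by have := e0 (m + k)%N; lra.
pose S := [set u k - e k | k in [set: nat]].
have S0 : S !=set0 by exists (u 0%N - e 0%N); exists 0%N.
have Sub : has_ubound S.
  by exists (u 0%N + e 0%N) => _ [k _ <-]; exact: cross.
exists (sup S) => k; rewrite -/(e k) ler_norml; apply/andP; split.
  suff : sup S <= u k + e k by lra.
  by apply: ge_sup => // _ [m _ <-]; exact: cross.
suff : u k - e k <= sup S by lra.
by apply: ub_le_sup => //; exists k.
Qed.

(** The exponential weight makes Picard iteration contract by a fixed factor on the
    whole line at once. *)
Lemma der_bound_exp f (f' : R -> R) (K al : R) : 0 < al -> 0 <= K -> f 0 = 0 ->
  (forall t, is_derive t (1 : R) f (f' t)) ->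
  (forall t, `|f' t| <= K * expR (al * `|t|)) ->
  forall t, `|f t| <= K / al * expR (al * `|t|).
Proof.
move=> al0 K0.
have half h (h' : R -> R) : h 0 = 0 -> (forall t, is_derive t (1 : R) h (h' t)) ->
    (forall t, 0 <= t -> h' t <= K * expR (al * t)) ->
    forall t, 0 <= t -> h t <= K / al * expR (al * t).
  move=> h0 dh bh t t0.
  pose E' s := K / al * (expR (al * s) * al).
  have dE s : is_derive s (1 : R) (fun s => K / al * expR (al * s)) (E' s).
    apply: is_derive_eq (dM (dC _ s) (dcomp (is_derive_expR _) (dM (dC al s) (dId s)))) _.
    by rewrite /E'; ring.
  have Kal : 0 <= K / al by rewrite divr_ge0 // ltW.
  suff : K / al * expR (al * 0) - h 0 <= K / al * expR (al * t) - h t.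
    by rewrite h0 mulr0 expR0; lra.
  apply: (@nondec R _ _ 0 t t0 (fun s _ => dB (dE s) (dh s))) => s /andP[s0 _].
  rewrite subr_ge0; apply: le_trans (bh s s0) _.
  by rewrite /E' le_eqVlt; apply/orP; left; apply/eqP; field; rewrite gt_eqF.
move=> f0 df bf.
have pos h (h' : R -> R) : h 0 = 0 -> (forall t, is_derive t (1 : R) h (h' t)) ->
    (forall t, `|h' t| <= K * expR (al * `|t|)) ->
    forall t, 0 <= t -> `|h t| <= K / al * expR (al * t).
  move=> h0 dh bh t t0; rewrite ler_norml lerNl; apply/andP; split.
    apply: (half (fun s => - h s) (fun s => - h' s) _ (fun s => dN (dh s)) _ t t0).
      by rewrite h0 oppr0.
    by move=> s s0; have := bh s; rewrite [`|s|]ger0_norm // ler_norml => /andP[+ _]; lra.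
  apply: (half h h') => // s s0.
  by have := bh s; rewrite [`|s|]ger0_norm // ler_norml => /andP[_ +].
move=> t; case: (leP 0 t) => t0; first by rewrite [`|t|]ger0_norm //; apply: (pos f f').
have df' s : is_derive s (1 : R) (fun s => f (- s)) (f' (- s) * (- 1)).
  exact: (dcomp (df _) (dN (dId s))).
have bf' s : `|f' (- s) * (- 1)| <= K * expR (al * `|s|).
  by rewrite mulrN1 normrN; have := bf (- s); rewrite normrN.
have f0' : f (- 0) = 0 by rewrite oppr0.
have t0' : 0 <= - t by rewrite oppr_ge0 ltW.
by have := pos (fun s => f (- s)) _ f0' df' bf' _ t0'; rewrite opprK [`|t|]ltr0_norm.
Qed.

Lemma lip_continuous f (C : R) : (forall s t, `|f s - f t| <= C * `|s - t|) ->
  continuous f.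
Proof.
move=> lip t; apply/cvgrPdist_lt => e e0.
pose C' := `|C| + 1; have C'0 : 0 < C' by rewrite ltr_wpDl.
have : \forall s \near t, `|t - s| < e / C'.
  by apply/nbhs_ballP; exists (e / C') => //=; exact: divr_gt0.
apply: filterS => s; rewrite ltr_pdivlMr // => ts.
apply: le_lt_trans (lip t s) _; apply: le_lt_trans ts.
rewrite mulrC ler_wpM2l // /C'; have := ler_norm C; lra.
Qed.

Lemma lip_of_der f (f' : R -> R) (B : R) : (forall t, is_derive t (1 : R) f (f' t)) ->
  (forall t, `|f' t| <= B) -> forall s t, `|f s - f t| <= B * `|s - t|.
Proof.
move=> df bf s t; wlog st : s t / t <= s => [H|].
  by case: (leP t s) => [/H//|/ltW/H]; rewrite distrC [X in _ * X]distrC.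
rewrite [`|s - t|]ger0_norm ?subr_ge0 // ler_norml; apply/andP; split.
  have := @nondec R _ _ t s st (fun u _ => dD (df u) (dM (dC B u) (dId u))).
  move=> /(_ _); rewrite mulr1 => h; suff : f t + B * t <= f s + B * s by lra.
  by apply: h => u _; have := bf u; rewrite ler_norml => /andP[]; lra.
have := @nondec R _ _ t s st (fun u _ => dB (dM (dC B u) (dId u)) (df u)).
move=> /(_ _); rewrite mulr1 => h; suff : B * t - f t <= B * s - f s by lra.
by apply: h => u _; have := bf u; rewrite ler_norml => /andP[]; lra.
Qed.

Section Global.
Variables (d : nat) (V : ('I_d -> R) -> 'I_d -> R) (L B : R).
Hypotheses (L0 : 0 < L) (B0 : 0 <= B).
Hypothesis bndV : forall x i, `|V x i| <= B.
Hypothesis lipV : forall x y i, `|V x i - V y i| <= L * \sum_j `|x j - y j|.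
Variable x0 : 'I_d -> R.

(** Picard iteration.  With al = 2 (d + 1) L the distance of two iterates, weighted
    by exp (- al |t|), is at least halved at each step; all iterates are
    B-Lipschitz, which makes the limit continuous. *)
Lemma global_solution : exists g : R -> 'I_d -> R,
  (forall i, g 0 i = x0 i) /\
  forall i t, is_derive t (1 : R) (fun s => g s i) (V (g t) i).
Proof.
have : forall f, exists F : R -> R, continuous f ->
    F 0 = 0 /\ forall t, is_derive t (1 : R) F (f t).
  move=> f; have [cf|ncf] := pselect (continuous f).
    by have [F hF] := primitive cf; exists F.
  by exists (fun=> 0).
move=> /choice[Pr hPr].
pose nxt (g : R -> 'I_d -> R) : R -> 'I_d -> R :=
  fun t i => x0 i + Pr (fun s => V (g s) i) t.
pose isLip (g : R -> 'I_d -> R) := forall i s t, `|g s i - g t i| <= B * `|s - t|.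
have contV g : isLip g -> forall i, continuous (fun s => V (g s) i).
  move=> lg i; apply: (@lip_continuous _ (L * (d%:R * B))) => s t.
  apply: le_trans (lipV _ _ _) _; rewrite -mulrA ler_pM2l //.
  apply: le_trans (ler_sum _ (fun j _ => lg j s t)) _.
  by rewrite sumr_const card_ord -[X in X <= _]mulr_natl mulrA.
have nxtP g : isLip g -> (forall i, nxt g 0 i = x0 i) /\
    forall i t, is_derive t (1 : R) (fun s => nxt g s i) (V (g t) i).
  move=> lg; split=> i; have [P0 dP] := hPr _ (contV g lg i).
    by rewrite /nxt P0 addr0.
  by move=> t; rewrite -[V (g t) i]add0r; exact: (dD (dC _ t) (dP t)).
have nxtL g : isLip g -> isLip (nxt g).
  move=> lg i; have [_ dn] := nxtP g lg.
  exact: (lip_of_der (dn i) (fun t => bndV (g t) i)).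
pose G k := iter k nxt (fun _ => x0).
have GL k : isLip (G k).
  elim: k => [|k IH]; last exact: nxtL.
  by move=> i s t; rewrite subrr normr0 mulr_ge0.
pose al := 2 * (d%:R + 1) * L.
have d1 : 0 < (d%:R + 1 : R) by rewrite ltr_wpDl.
have al0 : 0 < al by rewrite !mulr_gt0.
pose C := B / al.
have C0 : 0 <= C by rewrite divr_ge0 // ltW.
have step (g h : R -> 'I_d -> R) (c : R) : 0 <= c -> isLip g -> isLip h ->
    (forall i t, `|g t i - h t i| <= c * expR (al * `|t|)) ->
    forall i t, `|nxt g t i - nxt h t i| <= c / 2 * expR (al * `|t|).
  move=> c0 lg lh gh i t.
  have [g0 dg] := nxtP g lg; have [h0 dh] := nxtP h lh.
  have K0 : 0 <= L * ((d%:R + 1) * c) by apply: mulr_ge0; [exact: ltW | apply: mulr_ge0 => //; exact: ltW].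
  have -> : c / 2 = L * ((d%:R + 1) * c) / al.
    by rewrite /al; field; rewrite !gt_eqF.
  apply: (@der_bound_exp (fun s => nxt g s i - nxt h s i) (fun s => V (g s) i - V (h s) i)
    _ _ al0 K0 _ (fun s => dB (dg i s) (dh i s))).
  - by rewrite g0 h0 subrr.
  - move=> s; apply: le_trans (lipV _ _ _) _; rewrite -[X in _ <= X]mulrA ler_pM2l // -[X in _ <= X]mulrA.
    apply: le_trans (ler_sum _ (fun j _ => gh j s)) _.
    rewrite sumr_const card_ord -[X in X <= _]mulr_natl ler_wpM2r ?lerDl // mulr_ge0 ?expR_ge0 //.
have Gdiff k i t : `|G k.+1 t i - G k t i| <= C * 2^-1 ^+ k * expR (al * `|t|).
  elim: k i t => [|k IH] i t.
    rewrite expr0 mulr1.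
    have [g0 dg] := nxtP (G 0%N) (GL 0%N).
    have dg' s : is_derive s (1 : R) (fun s => nxt (G 0%N) s i - x0 i) (V (G 0%N s) i).
      by rewrite -[V _ i]subr0; exact: (dB (dg i s) (dC _ s)).
    apply: (@der_bound_exp (fun s => nxt (G 0%N) s i - x0 i) _ B _ al0 B0 _ dg').
    - by rewrite g0 subrr.
    - move=> s; apply: le_trans (bndV _ _) _.
      by rewrite ler_peMr // -expR0 ler_expR mulr_ge0 // ltW.
  have c0 : 0 <= C * 2^-1 ^+ k by rewrite mulr_ge0 // exprn_ge0 // invr_ge0.
  rewrite exprS mulrCA [2^-1 * _]mulrC; apply: (step (G k.+1) (G k) _ c0) => //.
have lim i t : exists l, forall k, `|G k t i - l| <= 2 * (C * expR (al * `|t|)) * 2^-1 ^+ k.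
  apply: (@geo_limit (fun k => G k t i)); first by rewrite mulr_ge0 // expR_ge0.
  by move=> k; apply: le_trans (Gdiff k i t) _; rewrite mulrAC.
have /choice[gg hgg] : forall p : 'I_d * R, exists l, forall k,
    `|G k p.2 p.1 - l| <= 2 * (C * expR (al * `|p.2|)) * 2^-1 ^+ k.
  by move=> [i t]; exact: lim.
pose g t i := gg (i, t).
have hg k i t : `|G k t i - g t i| <= 2 * (C * expR (al * `|t|)) * 2^-1 ^+ k.
  exact: (hgg (i, t)).
have gL : isLip g.
  move=> i s t.
  apply: (@le_half_pow _ _ (2 * (C * expR (al * `|s|)) + 2 * (C * expR (al * `|t|)))) => k.
  rewrite mulrDl.
  have := hg k i s; have := hg k i t; have := GL k i s t.
  rewrite !ler_norml => /andP[? ?] /andP[? ?] /andP[? ?].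
  by apply/andP; split; lra.
have [gg0 dgg] := nxtP g gL.
have gE t i : nxt g t i = g t i.
  apply/eqP; rewrite -subr_eq0 -normr_le0.
  apply: (@le_half_pow _ _ (4 * (C * expR (al * `|t|)))) => k; rewrite add0r.
  have h1 : `|G k.+1 t i - nxt g t i| <= 2 * (C * 2^-1 ^+ k) / 2 * expR (al * `|t|).
    apply: (step (G k) g) => //.
      by apply: mulr_ge0 => //; apply: mulr_ge0 => //; rewrite exprn_ge0 // invr_ge0.
    by move=> j s; apply: le_trans (hg k j s) _; rewrite le_eqVlt; apply/orP; left; apply/eqP; ring.
  have := hg k.+1 i t; rewrite exprS.
  move: h1; set E := expR _; set P := 2^-1 ^+ k.
  rewrite !ler_norml => /andP[? ?] /andP[? ?]; apply/andP; split; lra.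
exists g; split => [i|i t]; first by rewrite -gE gg0.
have -> : (fun s => g s i) = (fun s => nxt g s i) by apply/funext => s; rewrite gE.
exact: dgg.
Qed.
End Global.
End Picard.

(** * Complete orbits on the Poincare sphere *)

Section BoundedLipschitz.
Variable R : realType.
Variable d : nat.
Local Notation St := ('I_d -> R).

(** Bounded Lipschitz functions are closed under products, contrary to Lipschitz
    functions: this gives the Lipschitz bounds of polynomials in clamped
    coordinates for free. *)
Definition BL (f : St -> R) := exists2 C, 0 <= C &
  forall x y, `|f x| <= C /\ `|f x - f y| <= C * \sum_j `|x j - y j|.

Let dist (x y : St) : 0 <= \sum_j `|x j - y j|.
Proof. by apply: sumr_ge0. Qed.

Lemma BLc c : BL (fun=> c).
Proof.
by exists `|c| => // x y; split => //; rewrite subrr normr0 mulr_ge0.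
Qed.
Lemma BLD f g : BL f -> BL g -> BL (fun x => f x + g x).
Proof.
move=> [C C0 hf] [D D0 hg]; exists (C + D); first exact: addr_ge0.
move=> x y; have [f1 f2] := hf x y; have [g1 g2] := hg x y; split.
  by apply: le_trans (ler_normD _ _) _; exact: lerD.
rewrite (_ : f x + g x - (f y + g y) = (f x - f y) + (g x - g y)); last by ring.
by apply: le_trans (ler_normD _ _) _; rewrite mulrDl lerD.
Qed.
Lemma BLM f g : BL f -> BL g -> BL (fun x => f x * g x).
Proof.
move=> [C C0 hf] [D D0 hg]; exists (2 * (C * D) + C * D); first by rewrite !(addr_ge0, mulr_ge0).
move=> x y; have [f1 f2] := hf x y; have [g1 g2] := hg x y; have [f3 _] := hf y x; split.
  rewrite normrM; apply: le_trans (_ : C * D <= _); first exact: ler_pM.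
  by rewrite lerDr !mulr_ge0.
rewrite (_ : f x * g x - f y * g y = (f x - f y) * g x + f y * (g x - g y)); last by ring.
apply: le_trans (ler_normD _ _) _; rewrite !normrM.
apply: le_trans (_ : 2 * (C * D) * \sum_j `|x j - y j| <= _); last first.
  by rewrite ler_wpM2r ?dist // lerDl mulr_ge0.
rewrite (_ : 2 * _ * _ = (C * \sum_j `|x j - y j|) * D + C * (D * \sum_j `|x j - y j|)); last by ring.
by apply: lerD; apply: ler_pM.
Qed.
Lemma BLN f : BL f -> BL (fun x => - f x).
Proof.
move=> [C C0 hf]; exists C => // x y; have [f1 f2] := hf x y.
by rewrite normrN -opprD normrN.
Qed.
Lemma BLsum (I : Type) (r : seq I) (F : I -> St -> R) :
  (forall i, BL (F i)) -> BL (fun x => \sum_(i <- r) F i x).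
Proof.
move=> h; elim: r => [|i r IH].
  by under eq_fun do rewrite big_nil; exact: BLc.
by under eq_fun do rewrite big_cons; exact: BLD.
Qed.
Lemma BLX f k : BL f -> BL (fun x => f x ^+ k).
Proof.
move=> h; elim: k => [|k IH]; first by under eq_fun do rewrite expr0; exact: BLc.
by under eq_fun do rewrite exprS; exact: BLM.
Qed.

Definition clamp (a b r : R) := Num.max a (Num.min b r).
Lemma clamp_lip a b r s : `|clamp a b r - clamp a b s| <= `|r - s|.
Proof.
have h1 : r - s <= `|r - s| := ler_norm _.
have h2 : s - r <= `|r - s| by rewrite distrC; exact: ler_norm.
rewrite ler_norml /clamp /Num.max /Num.min.
by do !case: ifPn; rewrite -?leNgt => *; apply/andP; split; lra.
Qed.
Lemma clamp_bnd a b r : a <= b -> a <= clamp a b r <= b.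
Proof.
move=> ab; rewrite /clamp /Num.max /Num.min.
by do !case: ifPn; rewrite -?leNgt => *; apply/andP; split; lra.
Qed.
Lemma clamp_id a b r : a <= r <= b -> clamp a b r = r.
Proof.
move=> /andP[ar rb]; rewrite /clamp /Num.max /Num.min.
by do !case: ifPn; rewrite -?leNgt => *; lra.
Qed.

Lemma BLclamp a b f : a <= b -> (exists2 C, 0 <= C & forall x y, `|f x - f y| <= C * \sum_j `|x j - y j|) ->
  BL (fun x => clamp a b (f x)).
Proof.
move=> ab [C C0 h]; exists (`|a| + `|b| + C); first by rewrite !addr_ge0.
move=> x y; split.
  have /andP[h1 h2] := clamp_bnd (f x) ab.
  have := lerNnormlW (lexx `|a|); have := ler_norm b; have := normr_ge0 a; have := normr_ge0 b.
  by rewrite ler_norml => *; apply/andP; split; lra.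
apply: le_trans (clamp_lip _ _ _ _) _; apply: le_trans (h x y) _.
by rewrite ler_wpM2r ?dist // lerDr addr_ge0.
Qed.
Lemma BLcoord a b j : a <= b -> BL (fun x => clamp a b (x j)).
Proof.
move=> ab; apply: BLclamp => //; exists 1 => // x y.
by rewrite mul1r (bigD1 j) //= lerDl sumr_ge0.
Qed.
Lemma BL_lip f : BL f -> exists2 C, 0 <= C & forall x y, `|f x - f y| <= C * \sum_j `|x j - y j|.
Proof. by move=> [C C0 h]; exists C => // x y; have [] := h x y. Qed.

Lemma BL_solution (V : 'I_d -> St -> R) (x0 : St) : (forall i, BL (V i)) ->
  exists g : R -> St, (forall i, g 0 i = x0 i) /\
   forall i t, is_derive t (1 : R) (fun s => g s i) (V i (g t)).
Proof.
move=> hV.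
have ex (i : 'I_d) : exists C, 0 <= C /\ forall x y, `|V i x| <= C /\
    `|V i x - V i y| <= C * \sum_j `|x j - y j|.
  by have [C C0 h] := hV i; exists C.
have [C hC] := choice ex.
have C0 i : 0 <= C i := (hC i).1.
pose B := \sum_i C i.
have CB i : C i <= B by rewrite /B (bigD1 i) //= lerDl sumr_ge0.
have B0 : 0 <= B by apply: sumr_ge0.
apply: (@global_solution R d (fun x i => V i x) (B + 1) B) => //.
- by rewrite ltr_wpDl.
- by move=> x i; have [h _] := (hC i).2 x x; apply: le_trans h _.
- move=> x y i; have [_ h] := (hC i).2 x y; apply: le_trans h _.
  rewrite ler_wpM2r ?dist //; apply: le_trans (CB i) _; by rewrite lerDl.
Qed.
End BoundedLipschitz.

Section Orbit.
Variable R : realType.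
Implicit Type X : planar_field R.

(** f^2 exp (2 C t) does not decrease and f^2 exp (- 2 C t) does not increase, so f has
    no zero. *)
Lemma gronwall_pos (f al : R -> R) (C : R) :
  (forall t, is_derive t (1 : R) f (al t * f t)) -> (forall t, `|al t| <= C) ->
  0 < f 0 -> forall t, 0 < f t.
Proof.
move=> df alC f0.
have nz t : f t != 0.
  have dE (c s : R) : is_derive s (1 : R) (fun s => f s ^+ 2 * expR (c * s))
     ((2 * al s + c) * (f s ^+ 2 * expR (c * s))).
    apply: is_derive_eq (dM (dX 1 (df s)) (dcomp (is_derive_expR _) (dM (dC c s) (dId s)))) _.
    by ring.
  have pos s c : 0 <= f s ^+ 2 * expR (c * s) by rewrite mulr_ge0 ?sqr_ge0 ?expR_ge0.
  apply/eqP => z; case: (leP 0 t) => t0.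
    have := @nondec R _ _ 0 t t0 (fun s _ => dE (2 * C) s).
    rewrite z mulr0 expR0 mulr1 expr0n /= mul0r => h.
    have : f 0 ^+ 2 <= 0.
      apply: h => s _; rewrite mulr_ge0 //.
      by have := alC s; rewrite ler_norml => /andP[? ?]; lra.
    by rewrite leNgt exprn_gt0.
  have := @nondec R _ _ t 0 (ltW t0) (fun s _ => dN (dE (- (2 * C)) s)).
  rewrite z mulr0 expR0 mulr1 expr0n /= mul0r oppr0 => h.
  have : 0 <= - f 0 ^+ 2.
    apply: h => s _; rewrite -mulNr mulr_ge0 //.
    by have := alC s; rewrite ler_norml => /andP[? ?]; lra.
  by rewrite leNgt oppr_lt0 exprn_gt0.
move=> t; rewrite ltNge; apply/negP => ft.
have cf a b : {within `[a, b], continuous f}.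
  by apply: continuous_subspaceT => s; exact: (is_derive_cont (df s)).
case: (leP 0 t) => t0.
  have [|c _ fc] := @IVT R f 0 t 0 t0 (cf _ _).
    by rewrite ge_min ft orbT le_max (ltW f0).
  by have := nz c; rewrite fc eqxx.
have [|c _ fc] := @IVT R f t 0 0 (ltW t0) (cf _ _).
  by rewrite ge_min ft le_max (ltW f0) orbT.
by have := nz c; rewrite fc eqxx.
Qed.

Lemma is_derive_row (g : R -> 'rV[R]_3) (v : 'rV[R]_3) t :
  (forall i, is_derive t (1 : R) (fun s => g s 0 i) (v 0 i)) -> is_derive t (1 : R) g v.
Proof.
move=> dg.
have dd : derivable g t 1.
  by apply/derivable_mxP => i j; rewrite ord1; have [] := dg j.
apply: DeriveDef => //; rewrite derive_mx //; apply/matrixP => i j.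
by rewrite mxE ord1; exact: derive_val.
Qed.

Definition box (x : 'I_3 -> R) : 'rV[R]_3 := \row_j clamp (-2) 2 (x j).

(** The vector field from which the compactified one is obtained by projection on
    the tangent planes of the sphere. *)
Definition hom_field X (q : 'rV[R]_3) (i : 'I_3) : R :=
  [:: homogenize (field_degree X) X.1 q; homogenize (field_degree X) X.2 q; 0]`_i.

Lemma box_id (q : 'rV[R]_3) : (forall i, -1 <= q 0 i <= 1) -> box (q 0) = q.
Proof.
move=> h; apply/rowP => i; rewrite mxE clamp_id //.
by have /andP[? ?] := h i; apply/andP; split; lra.
Qed.

Lemma BL_box j : BL (fun x => box x 0 j).
Proof.
have -> : (fun x => box x 0 j) = (fun x => clamp (-2) 2 (x j)).
  by apply/funext => x; rewrite mxE.
by apply: BLcoord; lra.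
Qed.

Lemma BL_hom_field X i : BL (fun x => hom_field X (box x) i).
Proof.
have BLh p : BL (fun x => homogenize (field_degree X) p (box x)).
  rewrite /homogenize; apply: BLsum => j; apply: BLsum => k.
  exact: (BLM (BLM (BLM (BLc _ _) (BLX _ (BL_box _))) (BLX _ (BL_box _))) (BLX _ (BL_box _))).
by case: i => -[|[|[|//]]] hi; rewrite /hom_field /=; [exact: BLh | exact: BLh | exact: BLc].
Qed.

Lemma poincare_fieldE X q i : poincare_field X q 0 i =
  hom_field X q i - (\sum_j hom_field X q j * q 0 j) * q 0 i.
Proof.
rewrite /poincare_field !mxE; congr (_ - _ * _).
by apply: eq_bigr => j _; rewrite !mxE.
Qed.

Lemma poincare_lip X i : exists2 C, 0 <= C & forall p q : 'rV[R]_3,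
  (forall j, -1 <= p 0 j <= 1) -> (forall j, -1 <= q 0 j <= 1) ->
  `|poincare_field X p 0 i - poincare_field X q 0 i| <= C * \sum_j `|p 0 j - q 0 j|.
Proof.
have : BL (fun x => poincare_field X (box x) 0 i).
  under eq_fun do rewrite poincare_fieldE.
  apply: BLD; first exact: BL_hom_field.
  apply: BLN; apply: BLM; last exact: BL_box.
  by apply: BLsum => j; apply: BLM; [exact: BL_hom_field | exact: BL_box].
move=> [C C0 h]; exists C => // p q hp hq.
by have [_] := h (p 0) (q 0); rewrite !box_id.
Qed.

(** On the sphere the compactified field is |q|^2 w - <w, q> q, which is tangent to
    all the spheres around the origin.  Evaluating it at the clamped point, and
    cutting it off by a function of the clamped point which vanishes as soon as
    one coordinate is clamped, makes it bounded and Lipschitz without losing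
    tangency.  Hence its solutions stay on the sphere; they stay in the open
    hemisphere because the last coordinate satisfies a linear equation. *)
Lemma finite_orbit_exists X (q0 : 'rV[R]_3) : sphere2 q0 -> 0 < q0 0 2%:R ->
  exists g, g 0 = q0 /\ finite_orbit X g.
Proof.
move=> q01 q02.
pose nn x : R := \sum_i box x 0 i ^+ 2.
pose ww x : R := \sum_i hom_field X (box x) i * box x 0 i.
pose chi x : R := clamp 0 1 (2 - nn x).
pose V (i : 'I_3) (x : 'I_3 -> R) : R :=
  chi x * (nn x * hom_field X (box x) i - ww x * box x 0 i).
have BLk := BL_box; have BLw := BL_hom_field X.
have BLnn : BL nn by apply: BLsum => i; exact: BLX.
have BLww : BL ww by apply: BLsum => i; exact: BLM.
have BLchi : BL chi.
  apply: BLclamp => //; apply: BL_lip; apply: BLD; [exact: BLc | exact: BLN].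
have BLV i : BL (V i).
  apply: BLM => //; apply: BLD; first exact: BLM.
  by apply: BLN; apply: BLM.
have [h [h0 dh]] := BL_solution (fun i => q0 0 i) BLV.
pose g t : 'rV[R]_3 := \row_i h t i.
have tang x : \sum_i x i * V i x = 0.
  case: (boolP [forall i, -2 <= x i <= 2]) => [/forallP hx|].
    have kx i : box x 0 i = x i by rewrite mxE clamp_id.
    have nx : nn x = \sum_i x i * x i by apply: eq_bigr => i _; rewrite kx expr2.
    have wx : ww x = \sum_i x i * hom_field X (box x) i.
      by apply: eq_bigr => i _; rewrite kx mulrC.
    transitivity (chi x * (nn x * (\sum_i x i * hom_field X (box x) i) - ww x * (\sum_i x i * x i))).
      rewrite mulrBr !mulr_sumr -sumrB; apply: eq_bigr => i _; rewrite /V kx; ring.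
    by rewrite -nx -wx; ring.
  move=> /forallPn[i hi].
  have ki : box x 0 i ^+ 2 = 4.
    rewrite mxE /clamp /Num.max /Num.min; move: hi; rewrite negb_and -!ltNge => /orP[hi|hi];
    by do !case: ifPn; rewrite -?leNgt => *; try (exfalso; lra); ring.
  have n4 : 4 <= nn x by rewrite /nn (bigD1 i) //= ki lerDl sumr_ge0 // => j _; exact: sqr_ge0.
  have c0 : chi x = 0.
    rewrite /chi /clamp /Num.max /Num.min; do !case: ifPn; rewrite -?leNgt => *; lra.
  by rewrite big1 // => j _; rewrite /V c0 mul0r mulr0.
have sph t : \sum_i h t i ^+ 2 = 1.
  have ds s : is_derive s (1 : R) (fun s => \sum_i h s i ^+ 2) 0.
    have e : (\sum_i 2 * h s i * V i (h s)) = 0.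
      by under eq_bigr do rewrite -mulrA; rewrite -mulr_sumr tang mulr0.
    have -> : (fun s => \sum_i h s i ^+ 2) = (fun s => h s ord0 ^+ 2 +
       (h s (lift ord0 ord0) ^+ 2 + (h s (lift ord0 (lift ord0 ord0)) ^+ 2 + 0))).
      by apply/funext => u; rewrite !big_ord_recl big_ord0.
    apply: is_derive_eq (dD (dX 1 (dh _ s)) (dD (dX 1 (dh _ s)) (dD (dX 1 (dh _ s)) (dC _ s)))) _.
    by rewrite -[RHS]e !big_ord_recl big_ord0; ring.
  rewrite (const_of_der0 ds t 0) -[RHS]q01 !big_ord_recl big_ord0 !h0 addr0 addrA.
  by congr (_ + _ + _); congr (q0 _ _ ^+ 2); apply/val_inj.
have gsph t : sphere2 (g t).
  rewrite /sphere2 /= !mxE -(sph t) !big_ord_recl big_ord0 addr0 addrA.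
  by congr (_ + _ + _); congr (h t _ ^+ 2); apply/val_inj.
have le1 t i : -1 <= h t i <= 1.
  have : h t i ^+ 2 <= 1.
    by rewrite -(sph t) (bigD1 i) //= lerDl sumr_ge0 // => j _; exact: sqr_ge0.
  by rewrite -ler_norml -real_normK ?num_real // expr_le1.
have kg t : box (h t) = g t.
  apply/rowP => i; rewrite !mxE clamp_id //.
  by have /andP[? ?] := le1 t i; apply/andP; split; lra.
have ng t : nn (h t) = 1.
  by rewrite -(sph t); apply: eq_bigr => i _; rewrite kg mxE.
have cg t : chi (h t) = 1.
  by rewrite /chi ng (_ : 2 - 1 = 1 :> R) ?clamp_id ?ler01 ?lexx //; ring.
have Vg t i : V i (h t) = poincare_field X (g t) 0 i.
  by rewrite /V cg ng !mul1r /ww kg poincare_fieldE.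
have dg t : is_derive t (1 : R) g (poincare_field X (g t)).
  apply: is_derive_row => i; rewrite -Vg.
  have -> : (fun s => g s 0 i) = (fun s => h s i) by apply/funext => s; rewrite mxE.
  exact: dh.
exists g; split; first by apply/rowP => i; rewrite mxE h0.
have pos : forall t, 0 < h t 2%:R.
  have [C C0 hC] := BLww.
  apply: (@gronwall_pos (fun t => h t 2%:R) (fun t => - ww (h t)) C).
  - move=> t; apply: is_derive_eq (dh _ t) _.
    by rewrite /V cg ng !mul1r kg mxE /hom_field /=; ring.
  - by move=> t; rewrite normrN; have [] := hC (h t) (h t).
  - by rewrite h0.
by move=> t; split; [exact: gsph | rewrite mxE | exact: dg].
Qed.
End Orbit.

(** * Crossings in one direction and convergence *)

Section Eventually.
Variable R : realType.
Implicit Types (f : R -> R) (t a b c : R).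

Lemma real_ind (P : R -> Prop) a :
  (forall t, a <= t -> (forall s, a <= s < t -> P s) -> P t) ->
  (forall t, a <= t -> P t -> exists2 e, 0 < e & forall s, t < s < t + e -> P s) ->
  forall t, a <= t -> P t.
Proof.
move=> cl op t at_; apply: contrapT => nPt.
pose A := [set s | a <= s /\ ~ P s].
have At : A t by [].
have lbA : has_lbound A by exists a => s [].
have infA : has_inf A by split => //; exists t.
pose T := inf A.
have aT : a <= T by apply: lb_le_inf; [exists t | move=> s []].
have before s : a <= s < T -> P s.
  move=> /andP[as_ sT]; apply: contrapT => nPs.
  by move: sT; rewrite ltNge => /negP; apply; apply: ge_inf.
have PT : P T by apply: cl => // s; exact: before.
have [e e0 after] := op T aT PT.
have : T + e <= T.
  apply: lb_le_inf; first by exists t.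
  move=> s [as_ nPs]; rewrite leNgt; apply/negP => sTe; apply: nPs.
  case: (ltgtP s T) => [sT|Ts|->//]; first by apply: before; rewrite as_.
  by apply: after; rewrite Ts.
by rewrite gerDl leNgt e0.
Qed.

Lemma der_pos_right f t v : is_derive t (1 : R) f v -> 0 < v ->
  exists2 e, 0 < e & (forall s, t < s < t + e -> f t < f s) /\
                     (forall s, t - e < s < t -> f s < f t).
Proof.
move=> [df dv] v0.
have cv : (fun h => h^-1 *: (f (h *: (1 : R) + t) - f t)) @ (0:R)^' --> v.
  by rewrite -dv; exact: df.
have : \forall h \near (0:R)^', 0 < h^-1 *: (f (h *: (1 : R) + t) - f t).
  by move/cvgr_gt: cv; apply.
move=> /nbhs_ballP[e /= e0 he]; exists e => //.
have he' h : h != 0 -> `|h| < e -> 0 < h^-1 * (f (h + t) - f t).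
  move=> h0 hlt; have := he h; rewrite /ball /= sub0r normrN => /(_ hlt h0).
  by rewrite /GRing.scale /= mulr1.
split => s /andP[s1 s2].
  have h0 : 0 < s - t by rewrite subr_gt0.
  have := he' (s - t); rewrite gt_eqF // subrK gtr0_norm // ltrBlDl => /(_ isT s2).
  by rewrite pmulr_rgt0 ?invr_gt0 // subr_gt0.
have h0 : s - t < 0 by rewrite subr_lt0.
have := he' (s - t); rewrite lt_eqF // subrK ltr0_norm // opprB ltrBlDl -ltrBlDr.
by move=> /(_ isT s1); rewrite nmulr_rgt0 ?invr_lt0 // subr_lt0.
Qed.

Lemma cont_left_ge f t a : {for t, continuous f} -> a < t ->
  (forall s, a <= s < t -> 0 <= f s) -> 0 <= f t.
Proof.
move=> cf at_ h; rewrite leNgt; apply/negP => ft.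
have : \forall s \near t, f s < 0 by move/cvgr_lt: cf; apply.
move=> /nbhs_ballP[e /= e0 he].
pose s := Num.max a (t - e / 2).
have st : s < t by rewrite /s gt_max at_ ltrBlDr ltrDl divr_gt0.
have := he s; rewrite /ball /= gtr0_norm ?subr_gt0 // => hh.
have : f s < 0.
  apply: hh; rewrite ltrBlDr -ltrBlDl; apply: lt_le_trans (_ : t - e / 2 <= _).
    by rewrite ltrD2l ltrN2 ltr_pdivrMr // ltr_pMr // ltr1n.
  by rewrite /s le_max lexx orbT.
by rewrite ltNge h // /s le_max lexx st.
Qed.

Lemma cont_right_gt f t : {for t, continuous f} -> 0 < f t ->
  exists2 e, 0 < e & forall s, t < s < t + e -> 0 < f s.
Proof.
move=> cf ft.
have : \forall s \near t, 0 < f s by move/cvgr_gt: cf; apply.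
move=> /nbhs_ballP[e /= e0 he]; exists e => // s /andP[ts se]; apply: he.
by rewrite /ball /= ltr0_norm ?subr_lt0 // opprB ltrBlDl.
Qed.

(** At a first zero f would have a nonpositive derivative. *)
Lemma stay_pos f (f' : R -> R) T : (forall t, T <= t -> is_derive t (1 : R) f (f' t)) ->
  (forall t, T <= t -> f t = 0 -> 0 < f' t) -> 0 < f T ->
  forall t, T <= t -> 0 < f t.
Proof.
move=> df f0 fT; apply: real_ind => t Tt.
  move=> before; case: (eqVneq t T) => [->//|tT].
  have lt : T < t by rewrite lt_neqAle eq_sym tT.
  have ft : 0 <= f t.
    apply: (cont_left_ge (is_derive_cont (df t Tt)) lt) => s h; exact: ltW (before s h).
  rewrite lt_neqAle ft andbT eq_sym; apply/eqP => z.
  have [e e0 [_ left]] := der_pos_right (df t Tt) (f0 t Tt z).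
  pose s := Num.max T (t - e / 2).
  have st : s < t by rewrite /s gt_max lt ltrBlDr ltrDl divr_gt0.
  have : f s < f t.
    apply: left; rewrite st andbT; apply: lt_le_trans (_ : t - e / 2 <= _).
      by rewrite ltrD2l ltrN2 ltr_pdivrMr // ltr_pMr // ltr1n.
    by rewrite /s le_max lexx orbT.
  by rewrite z ltNge ltW // before // st andbT /s le_max lexx.
move=> ft; exact: cont_right_gt (is_derive_cont (df t Tt)) ft.
Qed.

Lemma eventually_sign f (f' : R -> R) T :
  (forall t, T <= t -> is_derive t (1 : R) f (f' t)) ->
  (forall t, T <= t -> f t = 0 -> 0 < f' t) ->
  (exists2 T', T <= T' & forall t, T' <= t -> 0 < f t) \/ (forall t, T <= t -> f t < 0).
Proof.
move=> df f0.
have [[t1 Tt1 ft1]|no] := pselect (exists2 t1, T <= t1 & 0 < f t1).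
  left; exists t1 => //.
  by apply: (@stay_pos f f' t1) => // t h; [apply: df | apply: f0]; exact: le_trans h.
have le0 t : T <= t -> f t <= 0.
  by move=> Tt; rewrite leNgt; apply/negP => h; apply: no; exists t.
right => t Tt; rewrite lt_neqAle le0 // andbT; apply/eqP => z.
have [e e0 [right _]] := der_pos_right (df t Tt) (f0 t Tt z).
have : f t < f (t + e / 2).
  by apply: right; rewrite ltrDl divr_gt0 //= ltrD2l ltr_pdivrMr // ltr_pMr // ltr1n.
rewrite z ltNge le0 //; apply: le_trans Tt _; by rewrite lerDl ltW // divr_gt0.
Qed.

Lemma poly_bound (p : {poly R}) a b : exists2 M, 0 <= M & forall x, a <= x <= b -> `|p.[x]| <= M.
Proof.
pose K := `|a| + `|b|.
exists (\sum_(i < size p) `|p`_i| * K ^+ i).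
  by apply: sumr_ge0 => i _; rewrite mulr_ge0 // exprn_ge0 // addr_ge0.
move=> x /andP[ax xb]; rewrite horner_coef.
apply: le_trans (ler_norm_sum _ _ _) _; apply: ler_sum => i _.
rewrite normrM normrX; apply: ler_wpM2l => //; apply: lerXn2r; rewrite ?nnegrE ?addr_ge0 //.
rewrite ler_norml /K; have := ler_norm b; have := normr_ge0 a; have := normr_ge0 b.
by have := ler_norm (- a); rewrite normrN => *; apply/andP; split; lra.
Qed.

(** The derivative of log Y along the curve is p0 / Y^2 + p1 / Y + p2 times that of
    X, and this factor is bounded. *)
Lemma log_growth (p0 p1 p2 : {poly R}) (X Y C : R -> R) T b K :
  (forall t, T <= t -> is_derive t (1 : R) X (C t * Y t)) ->
  (forall t, T <= t -> is_derive t (1 : R) Y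
     (C t * (p0.[X t] + p1.[X t] * Y t + p2.[X t] * Y t ^+ 2))) ->
  (forall t, T <= t -> 0 < C t) -> 0 < b -> (forall t, T <= t -> b <= Y t) ->
  (forall t, T <= t -> X T <= X t <= K) ->
  exists M, forall t, T <= t -> Y t <= M.
Proof.
move=> dX_ dY C0 b0 bY XK.
have [M0 M00 h0] := poly_bound p0 (X T) K.
have [M1 M10 h1] := poly_bound p1 (X T) K.
have [M2 M20 h2] := poly_bound p2 (X T) K.
pose D := M0 / b ^+ 2 + M1 / b + M2.
have D0 : 0 <= D by rewrite !addr_ge0 // divr_ge0 ?sqr_ge0 // ltW.
have Y0 t : T <= t -> 0 < Y t by move=> /bY; exact: lt_le_trans.
exists (expR (ln (Y T) + D * (K - X T))) => t Tt.
rewrite -[Y t]lnK ?posrE ?Y0 // ler_expR.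
pose F' s := (0 * X s + D * (C s * Y s)) -
  (Y s)^-1 * (C s * (p0.[X s] + p1.[X s] * Y s + p2.[X s] * Y s ^+ 2)).
have : D * X T - ln (Y T) <= D * X t - ln (Y t).
  apply: (@nondec R (fun s => D * X s - ln (Y s)) F' T t Tt) => s /andP[Ts _].
    exact: (dB (dM (dC D s) (dX_ s Ts)) (dcomp (is_derive1_ln (Y0 s Ts)) (dY s Ts))).
  have Ys := Y0 s Ts; have XKs := XK s Ts.
  rewrite /F' mul0r add0r subr_ge0.
  have -> : (Y s)^-1 * (C s * (p0.[X s] + p1.[X s] * Y s + p2.[X s] * Y s ^+ 2)) =
     C s * Y s * (p0.[X s] / Y s ^+ 2 + p1.[X s] / Y s + p2.[X s]).
    by field; rewrite gt_eqF.
  rewrite [X in _ <= X]mulrC ler_pM2l; last by rewrite mulr_gt0 ?C0.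
  have q (p : {poly R}) M k : `|p.[X s]| <= M -> p.[X s] / Y s ^+ k <= M / b ^+ k.
    move=> hM; have Yk : 0 < Y s ^+ k by rewrite exprn_gt0.
    apply: (@le_trans _ _ (M / Y s ^+ k)).
      by rewrite ler_pM2r ?invr_gt0 //; apply: le_trans (ler_norm _) hM.
    apply: ler_wpM2l; first by apply: le_trans hM.
    by rewrite lef_pV2 ?posrE ?exprn_gt0 // lerXn2r ?nnegrE ?bY // ltW.
  rewrite /D; apply: lerD; last by apply: le_trans (ler_norm _) (h2 _ XKs).
  by apply: lerD; [exact: q (h0 _ XKs) | exact: (q _ _ 1%N (h1 _ XKs))].
have /andP[_ Xt] := XK t Tt.
have : D * X t <= D * K by rewrite ler_wpM2l.
lra.
Qed.

Lemma nonroot_between (p : {poly R}) a b : p != 0 -> a < b ->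
  exists2 x, a < x < b & p.[x] != 0.
Proof.
move=> p0 ab; apply: contrapT => no.
pose x (i : nat) : R := a + (b - a) / i.+2%:R.
have xab i : a < x i < b.
  rewrite /x ltrDl divr_gt0 ?subr_gt0 ?ltr0n //=.
  by rewrite -ltrBrDl ltr_pdivrMr ?ltr0n // ltr_pMr ?subr_gt0 // ltr1n.
have root_ i : root p (x i).
  by apply: contrapT => /negP h; apply: no; exists (x i).
have inj : injective x.
  move=> i j /addrI /(mulfI (_ : b - a != 0)); rewrite gt_eqF ?subr_gt0 // => /(_ isT).
  by move=> /invr_inj /eqP; rewrite eqr_nat => /eqP[].
have := @max_poly_roots R p [seq x i | i <- iota 0 (size p)] p0.
rewrite size_map size_iota ltnn map_inj_uniq // iota_uniq => h.
have: false by apply: h => //; apply/allP => _ /mapP[i _ ->].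
by [].
Qed.

(** A bounded function that crosses almost every level only finitely often cannot
    oscillate. *)
Lemma eventually_cvg (psi : R -> R) (p : {poly R}) : p != 0 ->
  (forall t, 0 <= t -> 0 <= psi t <= 1) ->
  (forall la, 0 < la < 1 -> p.[la] != 0 ->
     (exists2 T, 0 <= T & forall t, T <= t -> la <= psi t) \/
     (exists2 T, 0 <= T & forall t, T <= t -> psi t <= la)) ->
  exists2 l, 0 <= l <= 1 & forall e, 0 < e -> exists2 T, 0 <= T & forall t, T <= t -> `|psi t - l| <= e.
Proof.
move=> p0 psi01 ev.
pose A := [set la | exists2 T, 0 <= T & forall t, T <= t -> la <= psi t].
have A0 : A 0 by exists 0 => // t /psi01 /andP[].
have Aub : ubound A 1.
  by move=> la [T T0 h]; apply: le_trans (h T (lexx _)) _; case/andP: (psi01 T T0).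
have hub : has_ubound A by exists 1.
pose l := sup A.
have l0 : 0 <= l by apply: ub_le_sup.
have l1 : l <= 1 by apply: ge_sup => //; exists 0.
exists l; first by rewrite l0.
move=> e e0.
have [T1 T10 h1] : exists2 T, 0 <= T & forall t, T <= t -> l - e <= psi t.
  have [la [T T0 h] lla] := sup_adherent e0 (conj (ex_intro _ 0 A0) hub).
  by exists T => // t /h; apply: le_trans; exact: ltW.
have [T2 T20 h2] : exists2 T, 0 <= T & forall t, T <= t -> psi t <= l + e.
  case: (ltP (l + e) 1) => le1; last first.
    by exists 0 => // t /psi01 /andP[_] h; apply: le_trans h _.
  have lle : l < l + e by rewrite ltrDl.
  have [la /andP[lla lae] pla] := nonroot_between p0 lle.
  have la01 : 0 < la < 1 by rewrite (le_lt_trans l0 lla) (lt_trans lae le1).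
  have [hA|[T T0 h]] := ev la la01 pla.
    by have := ub_le_sup hub (hA : A la); rewrite leNgt lla.
  by exists T => // t /h hh; apply: le_trans hh _; exact: ltW.
exists (Num.max T1 T2); first by rewrite le_max T10.
move=> t; rewrite ge_max => /andP[/h1 ? /h2 ?].
by rewrite ler_norml; apply/andP; split; lra.
Qed.
End Eventually.

(** * From orbits to solutions that reach infinity *)

Section Orbits.
Variable R : realType.

(** tau = 1 and tau = -1 stand for the two directions of time. *)
Definition tends (tau : R) (g : R -> 'rV[R]_3) (q : 'rV[R]_3) :=
  forall e, 0 < e -> exists2 T, 0 <= T &
    forall t, T <= t -> forall i, `|g (tau * t) 0 i - q 0 i| <= e.

Lemma cvg_coords (F : set_system R) {FF : Filter F} (g : R -> 'rV[R]_3) (q : 'rV[R]_3) :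
  (g t @[t --> F] --> q) <->
  (forall e, 0 < e -> \forall t \near F, forall i, `|g t 0 i - q 0 i| < e).
Proof.
split=> [h e e0|h].
  have hb : \forall t \near F, ball q e (g t) by exact: (cvg_ballP g q).1 h e e0.
  refine (@filterS _ F FF _ _ _ hb) => t [_ ht] i.
  by rewrite distrC; exact: ht.
apply/cvg_ballP => e e0; refine (@filterS _ F FF _ _ _ (h e e0)) => t ht; split => // i j.
by rewrite ord1 /ball /= distrC; exact: ht.
Qed.

Lemma tends_cvg (g : R -> 'rV[R]_3) (q : 'rV[R]_3) : tends 1 g q \/ tends (-1) g q <->
  (g t @[t --> +oo] --> q) \/ (g t @[t --> -oo] --> q).
Proof.
split=> -[h|h].
- left; apply/cvg_coords => e e0; have [T T0 hT] := h (e / 2) (divr_gt0 e0 (ltr0Sn _ 1)).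
  exists T; split; first exact: num_real.
  move=> t /ltW Tt i; have := hT t Tt i; rewrite mul1r => /le_lt_trans; apply.
  by rewrite ltr_pdivrMr // ltr_pMr // ltr1n.
- right; apply/cvg_coords => e e0; have [T T0 hT] := h (e / 2) (divr_gt0 e0 (ltr0Sn _ 1)).
  exists (- T); split; first exact: num_real.
  move=> t tT i; have := hT (- t) _ i; rewrite mulN1r opprK.
  rewrite lerNr => /(_ (ltW tT)) /le_lt_trans; apply.
  by rewrite ltr_pdivrMr // ltr_pMr // ltr1n.
- left => e e0; have [M [_ hM]] := (cvg_coords _ _).1 h e e0.
  exists (`|M| + 1); first by rewrite addr_ge0.
  move=> t Mt i; rewrite mul1r ltW //; apply: hM; apply: lt_le_trans Mt.
  by have := ler_norm M; lra.
- right => e e0; have [M [_ hM]] := (cvg_coords _ _).1 h e e0.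
  exists (`|M| + 1); first by rewrite addr_ge0.
  move=> t Mt i; rewrite mulN1r ltW //; apply: hM.
  by have := ler_norm (- M); rewrite normrN; lra.
Qed.

Section Coords.
Variables (P0 P1 P2 : {poly R}) (g : R -> 'rV[R]_3) (sg ep : R).
Hypotheses (sg2 : sg ^+ 2 = 1) (ep2 : ep ^+ 2 = 1).
Hypothesis orb : finite_orbit (cherkas P0 P1 P2) g.

(** The orbit in the coordinates X = sg x and Y = ep y.  Its time is multiplied by
    sg ep, so that X increases wherever Y > 0. *)
Definition oG t := g (sg * ep * t).
Definition oX t := sg * (oG t 0 0 / oG t 0 2%:R).
Definition oY t := ep * (oG t 0 1 / oG t 0 2%:R).
Definition oC t := oG t 0 2%:R ^+ field_degree (cherkas P0 P1 P2) / oG t 0 2%:R.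

Lemma oC_gt0 t : 0 < oC t.
Proof. by have [_ h _] := orb (sg * ep * t); rewrite /oC divr_gt0 // exprn_gt0. Qed.

Lemma oX_der t : is_derive t (1 : R) oX (oC t * oY t).
Proof.
have [dx _] := finite_orbit_plane (sg * ep * t) orb.
have dt : is_derive t (1 : R) (fun s => sg * ep * s) (0 * t + sg * ep * 1).
  exact: (dM (dC _ t) (dId t)).
apply: is_derive_eq (dM (dC sg t) (@dcomp R (fun s => g s 0 0 / g s 0 2%:R) _ t _ _ dx dt)) _.
rewrite /cherkas /= hornerX hornerC /oC /oY /oG.
set c := _ ^+ _ / _; set y := g _ 0 1 / _.
transitivity (sg ^+ 2 * (ep * c * y)); first by ring.
by rewrite sg2; ring.
Qed.

Lemma oY_der t : is_derive t (1 : R) oY (oC t *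
  ((flip sg P0).[oX t] + (ep *: flip sg P1).[oX t] * oY t + (flip sg P2).[oX t] * oY t ^+ 2)).
Proof.
have [_ dy] := finite_orbit_plane (sg * ep * t) orb.
have dt : is_derive t (1 : R) (fun s => sg * ep * s) (0 * t + sg * ep * 1).
  exact: (dM (dC _ t) (dId t)).
apply: is_derive_eq (dM (dC ep t) (@dcomp R (fun s => g s 0 1 / g s 0 2%:R) _ t _ _ dy dt)) _.
rewrite /cherkas /= !(hornerD, hornerM, hornerXn, hornerX, hornerC, horner_exp) hornerZ !horner_flip.
have -> : sg * oX t = oG t 0 0 / oG t 0 2%:R by rewrite /oX mulrA -expr2 sg2 mul1r.
rewrite /oC /oY /oG.
set c := _ ^+ _ / _; set y := g _ 0 1 / _; set x := g _ 0 0 / _.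
transitivity (c * (ep ^+ 2 * sg * P0.[x] + ep ^+ 2 * sg * P1.[x] * y + ep ^+ 2 * sg * P2.[x] * y ^+ 2)).
  by ring.
transitivity (c * (sg * P0.[x] + sg * P1.[x] * y * ep ^+ 2 + sg * P2.[x] * y ^+ 2 * ep ^+ 2)).
  by rewrite ep2; ring.
ring.
Qed.
End Coords.

Lemma sgsq (x : R) : x != 0 -> Num.sg x ^+ 2 = 1.
Proof. by move=> x0; rewrite sqr_sg x0. Qed.

Lemma poly_eventually_sign (p : {poly R}) : p != 0 ->
  exists K, forall x, K <= x -> 0 < Num.sg (lead_coef p) * p.[x].
Proof.
move=> p0; have l0 : lead_coef p != 0 by rewrite lead_coef_eq0.
have [|d d0 [K h]] := @poly_ge_infty R (Num.sg (lead_coef p) *: p).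
  by rewrite lead_coefZ -normrEsg normr_gt0.
by exists K => x /h; rewrite hornerZ; apply: lt_le_trans.
Qed.

Lemma end_sol_of_orbit P0 P1 P2 g sg ep : sg ^+ 2 = 1 -> ep ^+ 2 = 1 ->
  finite_orbit (cherkas P0 P1 P2) g ->
  (exists2 T, 0 <= T & forall t, T <= t -> 0 < oY g sg ep t) ->
  (forall K, exists2 T, 0 <= T & forall t, T <= t -> K <= oX g sg ep t) ->
  end_sol (flip sg P0) (ep *: flip sg P1) (flip sg P2).
Proof.
move=> sg2 ep2 orb [T T0 Y0] Xoo.
exists (oX g sg ep), (oY g sg ep), (fun t => oC P0 P1 P2 g sg ep t * oY g sg ep t), T; split.
- by move=> t _; exact: oX_der.
- by move=> t Tt; rewrite mulr_gt0 ?Y0 // oC_gt0.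
- exact: Y0.
- move=> t Tt; apply: is_derive_eq (oY_der sg2 ep2 orb t) _.
  by field; rewrite gt_eqF ?Y0.
- move=> K; have [T' _ h] := Xoo K; exists (Num.max T T'); first by rewrite le_max lexx.
  by move=> t; rewrite ge_max => /andP[_ /h].
Qed.

(** If the limit is an end of the y axis then |y| tends to infinity, and so does |x|,
    by [log_growth].  Otherwise |x| tends to infinity, and y can change its sign
    only in the direction given by the sign of P0, hence at most once. *)
Lemma nonmonodromic_end_sol P0 P1 P2 : P0 != 0 ->
  ~ monodromic_at_infinity (cherkas P0 P1 P2) ->
  exists sg ep : R, [/\ sg ^+ 2 = 1, ep ^+ 2 = 1 &
    end_sol (flip sg P0) (ep *: flip sg P1) (flip sg P2)].
Proof.
move=> P0n /contrapT[g [q [orb [qs q2 _] lim]]].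
have [tau [tau2 lim']] : exists tau : R, tau ^+ 2 = 1 /\ tends tau g q.
  case/tends_cvg: lim => h; first by exists 1; rewrite expr1n.
  by exists (-1); rewrite sqrrN expr1n.
have G2 t : 0 < g t 0 2%:R by have [] := orb t.
have divoo i : q 0 i != 0 -> forall K, exists2 T, 0 <= T &
    forall t, T <= t -> K <= Num.sg (q 0 i) * (g (tau * t) 0 i / g (tau * t) 0 2%:R).
  move=> qi K; set s := Num.sg _.
  have aq : 0 < `|q 0 i| by rewrite normr_gt0.
  pose K' := `|K| + 1; have K'0 : 0 < K' by rewrite ltr_wpDl.
  have [T T0 hT] := lim' (`|q 0 i| / 2) (divr_gt0 aq (ltr0Sn _ 1)).
  have [T' T'0 hT'] := lim' (`|q 0 i| / 2 / K') (divr_gt0 (divr_gt0 aq (ltr0Sn _ 1)) K'0).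
  exists (Num.max T T'); first by rewrite le_max T0.
  move=> t; rewrite ge_max => /andP[/hT /(_ i) h1 /hT' /(_ 2%:R)].
  rewrite q2 subr0 gtr0_norm // ler_pdivlMr // => h2.
  have h3 : `|q 0 i| / 2 <= s * g (tau * t) 0 i.
    have e1 : `|q 0 i| = s * q 0 i by rewrite normrEsg.
    have : `|s * (g (tau * t) 0 i - q 0 i)| <= `|q 0 i| / 2.
      by rewrite normrM /s normr_sg qi mul1r.
    rewrite ler_norml => /andP[+ _]; rewrite mulrBr -e1; lra.
  rewrite mulrA ler_pdivlMr //.
  apply: le_trans (_ : K' * g (tau * t) 0 2%:R <= _).
    by rewrite ler_pM2r // /K'; have := ler_norm K; lra.
  by apply: le_trans h3; rewrite mulrC.
have [q00|q00] := eqVneq (q 0 0) 0.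
  (* the orbit tends to an end of the y axis *)
  have q10 : q 0 1 != 0.
    apply/eqP => z; move: qs; rewrite /sphere2 /= q00 q2 z !expr0n /= !addr0 => /eqP.
    by rewrite eq_sym oner_eq0.
  pose ep := Num.sg (q 0 1); pose sg := tau * ep.
  have ep2 : ep ^+ 2 = 1 by rewrite sgsq.
  have sg2 : sg ^+ 2 = 1 by rewrite exprMn tau2 ep2 mulr1.
  have se : sg * ep = tau by rewrite /sg -mulrA -expr2 ep2 mulr1.
  exists sg, ep; split => //.
  have Yoo K : exists2 T, 0 <= T & forall t, T <= t -> K <= oY g sg ep t.
    by have [T T0 h] := divoo 1 q10 K; exists T => // t /h; rewrite /oY /oG se.
  have [T1 T10 Y1] := Yoo 1.
  have Y0 t : T1 <= t -> 0 < oY g sg ep t by move=> /Y1; apply: lt_le_trans.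
  apply: (end_sol_of_orbit sg2 ep2 orb); first by exists T1.
  have Xnd a b : T1 <= a -> a <= b -> oX g sg ep a <= oX g sg ep b.
    move=> Ta ab; apply: (@nondec R _ _ a b ab (fun t _ => oX_der ep sg2 orb t)).
    move=> t /andP[at_ _]; apply: mulr_ge0; first exact: ltW (oC_gt0 _ _ orb t).
    by rewrite ltW // Y0 // (le_trans Ta).
  move=> K; apply: contrapT => no.
  have XK t : T1 <= t -> oX g sg ep T1 <= oX g sg ep t <= K.
    move=> Tt; rewrite Xnd ?lexx //= leNgt; apply/negP => h; apply: no.
    exists t; first exact: le_trans Tt.
    by move=> t' tt'; apply: le_trans (ltW h) _; apply: Xnd.
  have [M hM] := @log_growth R _ _ _ (oX g sg ep) (oY g sg ep) _ T1 1 K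
    (fun t _ => oX_der ep sg2 orb t) (fun t _ => oY_der sg2 ep2 orb t)
    (fun t _ => oC_gt0 _ _ orb t) ltr01 Y1 XK.
  have [T2 T20 h2] := Yoo (M + 1).
  have := h2 (Num.max T1 T2); rewrite le_max lexx orbT => /(_ isT).
  have := hM (Num.max T1 T2); rewrite le_max lexx => /(_ isT); lra.
(* |x| tends to infinity *)
pose sg := Num.sg (q 0 0).
have sg2 : sg ^+ 2 = 1 by rewrite sgsq.
pose e0 := tau * sg.
have e02 : e0 ^+ 2 = 1 by rewrite exprMn tau2 sg2 mulr1.
have se : sg * e0 = tau by rewrite /e0 mulrCA -expr2 sg2 mulr1.
have Xoo K : exists2 T, 0 <= T & forall t, T <= t -> K <= oX g sg e0 t.
  by have [T T0 h] := divoo 0 q00 K; exists T => // t /h; rewrite /oX /oG se.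
have p0n : flip sg P0 != 0.
  apply/eqP => z; case/eqP: P0n; apply/polyP => i; rewrite coef0.
  have := congr1 (fun p : {poly R} => p`_i) z; rewrite coef_flip coef0 => /eqP.
  have sn : sg != 0 by rewrite sgr_eq0.
  by rewrite mulf_eq0 expf_eq0 (negPf sn) andbF /= => /eqP.
have [K hK] := poly_eventually_sign p0n.
set s1 := Num.sg (lead_coef _) in hK.
have [T T0 hT] := Xoo K.
have dD t : T <= t -> is_derive t (1 : R) (fun t => s1 * oY g sg e0 t) _ :=
  fun _ => dM (dC s1 t) (oY_der sg2 e02 orb t).
(* X would not increase, whereas it tends to infinity. *)
have noneg T' : T <= T' -> (forall t, T' <= t -> oY g sg e0 t < 0) -> False.
  move=> TT' neg.
  have [T2 T20 h2] := Xoo (oX g sg e0 T' + 1).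
  pose t := Num.max T' T2.
  have tT' : T' <= t by rewrite le_max lexx.
  have : oX g sg e0 T' + 1 <= oX g sg e0 t by apply: h2; rewrite le_max lexx orbT.
  have : - oX g sg e0 T' <= - oX g sg e0 t.
    apply: (@nondec R _ _ T' t tT' (fun t _ => dN (oX_der e0 sg2 orb t))).
    move=> u /andP[uT' _]; rewrite -mulrN; apply: mulr_ge0; first exact: ltW (oC_gt0 _ _ orb u).
    by rewrite oppr_ge0 ltW // neg.
  lra.
have s12 : (s1 == 1) || (s1 == -1).
  by rewrite -sqrf_eq1 /s1 sgsq // lead_coef_eq0.
have T'0 T' : T <= T' -> 0 <= T' by apply: le_trans.
exists sg, e0; split => //; apply: (end_sol_of_orbit sg2 e02 orb) => //.
have [|[T' TT' pos]|neg] := eventually_sign dD.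
- move=> t Tt /eqP; rewrite mulf_eq0 sgr_eq0 lead_coef_eq0 (negPf p0n) /= => /eqP z.
  rewrite z !mulr0 expr0n /= ?mulr0 ?mul0r ?add0r ?addr0 mulrCA mulr_gt0 ?(oC_gt0 _ _ orb) //.
  exact: hK (hT _ Tt).
- case/orP: s12 => /eqP e1.
    by exists T'; [exact: T'0 | move=> t /pos; rewrite e1 mul1r].
  exfalso; apply: (noneg T' TT') => t /pos.
  by rewrite e1 mulN1r oppr_gt0.
case/orP: s12 => /eqP e1.
  exfalso; apply: (noneg T (lexx _)) => t /neg.
  by rewrite e1 mul1r.
by exists T => // t /neg; rewrite e1 mulN1r oppr_lt0.
Qed.
End Orbits.

(** * From barriers to orbits *)

Section FromBarrier.
Variable R : realType.

Lemma near_pinftyE (P : R -> Prop) :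
  (\forall t \near +oo, P t) <-> exists2 T, 0 <= T & forall t, T <= t -> P t.
Proof.
split=> [[M [_ hM]]|[T T0 h]].
  exists (`|M| + 1); first by rewrite addr_ge0.
  by move=> t Mt; apply: hM; apply: lt_le_trans Mt; have := ler_norm M; lra.
by exists T; split; [exact: num_real | move=> t /ltW /h].
Qed.

(** The velocity converges to the value of the field at the limit; were it nonzero,
    a coordinate would be unbounded. *)
Lemma orbit_limit_equilibrium (X : planar_field R) g (q : 'rV[R]_3) (tau : R) :
  tau ^+ 2 = 1 -> finite_orbit X g -> tends tau g q -> poincare_field X q = 0.
Proof.
move=> tau2 orb lim.
have box1 t j : -1 <= g t 0 j <= 1.
  have [sph _ _] := orb t; move: sph; rewrite /sphere2 /= => sph.
  have : g t 0 j ^+ 2 <= 1.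
    rewrite -sph; have s0 := sqr_ge0 (g t 0 0); have s1 := sqr_ge0 (g t 0 1).
    have s2 := sqr_ge0 (g t 0 2%:R).
    have : [\/ j = 0, j = 1 | j = 2%:R].
      by case: j => -[|[|[|//]]] hj; [constructor 1|constructor 2|constructor 3]; apply/val_inj.
    by case=> ->; lra.
  by rewrite -ler_norml -real_normK ?num_real // expr_le1.
have boxq j : -1 <= q 0 j <= 1.
  rewrite -ler_norml; apply/ler_addgt0Pr => e e0.
  have [T _ h] := lim e e0; have := h T (lexx _) j.
  have := box1 (tau * T) j; rewrite -ler_norml => h1 h2.
  have := ler_normB (g (tau * T) 0 j) (g (tau * T) 0 j - q 0 j); rewrite subKr; lra.
apply/rowP => i; rewrite [RHS]mxE; apply: contrapT => /eqP v0.
set v := poincare_field X q 0 i in v0.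
have [C C0 lip] := poincare_lip X i.
have av : 0 < `|v| by rewrite normr_gt0.
have [T T0 hT] := lim (`|v| / 2 / (3 * C + 1)) (divr_gt0 (divr_gt0 av (ltr0Sn _ 1)) (ltr_wpDl (mulr_ge0 (ler0n _ 3) C0) ltr01)).
have close t : T <= t -> `|poincare_field X (g (tau * t)) 0 i - v| <= `|v| / 2.
  move=> /hT h; apply: le_trans (lip _ _ (box1 _) boxq) _.
  apply: le_trans (_ : C * (\sum_(j < 3) (`|v| / 2 / (3 * C + 1))) <= _).
    by rewrite ler_wpM2l // ler_sum.
  rewrite sumr_const card_ord; have C1 : 0 < 3 * C + 1 by rewrite ltr_wpDl // mulr_ge0.
  rewrite (_ : C * _ = `|v| / 2 * (3 * C) / (3 * C + 1)); last by field; rewrite gt_eqF.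
  by rewrite ler_pdivrMr // ler_pM2l ?divr_gt0 // lerDl.
have dg t : is_derive t (1 : R) (fun s => - (tau * Num.sg v) * g (tau * s) 0 i)
   (- Num.sg v * poincare_field X (g (tau * t)) 0 i).
  have [_ _ d] := orb (tau * t); have di := is_derive_coord i d.
  have dt : is_derive t (1 : R) (fun s => tau * s) (0 * t + tau * 1).
    exact: (dM (dC _ t) (dId t)).
  apply: is_derive_eq (dM (dC (- (tau * Num.sg v)) t) (@dcomp R (fun s => g s 0 i) _ t _ _ di dt)) _.
  transitivity (tau ^+ 2 * (- Num.sg v * poincare_field X (g (tau * t)) 0 i)).
    by ring.
  by rewrite tau2 mul1r.
apply: (@no_decay R (fun t => t) (fun=> 1) _ _ T (`|v| / 2) (-1) _ (fun t _ => dId t) _ (fun t _ => dg t)).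
- by rewrite divr_gt0.
- by move=> K; exists (Num.max T K); [rewrite le_max lexx | move=> t; rewrite ge_max => /andP[]].
- move=> t /close; rewrite mulr1 mulNr.
  have e : `|Num.sg v * (poincare_field X (g (tau * t)) 0 i - v)| = `|poincare_field X (g (tau * t)) 0 i - v|.
    by rewrite normrM normr_sg v0 mul1r.
  by rewrite -e ler_norml mulrBr -normrEsg => /andP[+ _]; lra.
- move=> t _; suff : `|- (tau * Num.sg v) * g (tau * t) 0 i| <= 1 by rewrite ler_norml => /andP[].
  have tau1 : `|tau| = 1.
    by apply/eqP; rewrite -sqrp_eq1 // real_normK ?num_real // tau2.
  by rewrite normrM normrN normrM normr_sg v0 mulr1 tau1 mul1r ler_norml.
Qed.

Section Build.
Variables (P0 P1 P2 : {poly R}) (sg ep : R).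
Hypotheses (sg2 : sg ^+ 2 = 1) (ep2 : ep ^+ 2 = 1) (P2n : P2 != 0).
Let p0 := flip sg P0.
Let p1 := ep *: flip sg P1.
Let p2 := flip sg P2.
Variables (be be' : R -> R) (X0 : R).
Hypothesis X01 : 1 <= X0.
Hypothesis bar : forall x, X0 <= x ->
   [/\ 0 < be x, is_derive x (1 : R) be (be' x) &
       0 < p0.[x] + p1.[x] * be x + p2.[x] * be x ^+ 2 - be x * be' x].
Variable g : R -> 'rV[R]_3.
Hypothesis orb : finite_orbit (cherkas P0 P1 P2) g.
Let X := oX g sg ep.
Let Y := oY g sg ep.
Let C := oC P0 P1 P2 g sg ep.
Hypotheses (X00 : X 0 = X0) (Y00 : be X0 < Y 0).

Let dX_ t : is_derive t (1 : R) X (C t * Y t) := oX_der ep sg2 orb t.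
Let dY_ t : is_derive t (1 : R) Y (C t * (p0.[X t] + p1.[X t] * Y t + p2.[X t] * Y t ^+ 2))
  := oY_der sg2 ep2 orb t.
Let C0 t : 0 < C t := oC_gt0 sg ep orb t.

(** By real induction: at a first contact with the graph of be the difference
    Y - be(X) would be increasing.  The bound on X is proved along, since be is only
    known to be a barrier beyond X0. *)
Lemma above t : 0 <= t -> X0 <= X t /\ be (X t) < Y t.
Proof.
have dphi s : X0 <= X s -> is_derive s (1 : R) (fun s => Y s - be (X s))
   (C s * (p0.[X s] + p1.[X s] * Y s + p2.[X s] * Y s ^+ 2) - be' (X s) * (C s * Y s)).
  by move=> Xs; have [_ db _] := bar Xs; exact: (dB (dY_ s) (dcomp db (dX_ s))).
move: t; apply: real_ind => t t0.
  move=> before; case: (eqVneq t 0) => [->|tn0]; first by rewrite X00 lexx.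
  have tp : 0 < t by rewrite lt_neqAle eq_sym tn0.
  have Xt : X0 <= X t.
    rewrite -subr_ge0; have dXX := dB (dX_ t) (dC X0 t).
    by apply: (cont_left_ge (is_derive_cont dXX) tp) => s /before[]; rewrite subr_ge0.
  split => //.
  have ft : 0 <= Y t - be (X t).
    apply: (cont_left_ge (is_derive_cont (dphi t Xt)) tp) => s /before[_].
    by rewrite subr_ge0; exact: ltW.
  rewrite -subr_gt0 lt_neqAle ft andbT eq_sym; apply/eqP => z.
  have Yb : Y t = be (X t) by apply/eqP; rewrite -subr_eq0 z.
  have [_ _ res] := bar Xt.
  have dpos : 0 < C t * (p0.[X t] + p1.[X t] * Y t + p2.[X t] * Y t ^+ 2) - be' (X t) * (C t * Y t).
    rewrite (_ : _ - _ = C t * (p0.[X t] + p1.[X t] * Y t + p2.[X t] * Y t ^+ 2 - Y t * be' (X t))); last by ring.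
    by rewrite mulr_gt0 // Yb.
  have [e e0 [_ left]] := der_pos_right (dphi t Xt) dpos.
  pose s := Num.max 0 (t - e / 2).
  have st : s < t by rewrite /s gt_max tp ltrBlDr ltrDl divr_gt0.
  have : Y s - be (X s) < Y t - be (X t).
    apply: left; rewrite st andbT; apply: lt_le_trans (_ : t - e / 2 <= _).
      by rewrite ltrD2l ltrN2 ltr_pdivrMr // ltr_pMr // ltr1n.
    by rewrite /s le_max lexx orbT.
  have [|_ hs] := before s; first by rewrite st andbT /s le_max lexx.
  by rewrite z subr_lt0 ltNge ltW.
move=> [Xt Yt]; have [bp _ _] := bar Xt.
have Yp : 0 < Y t := lt_trans bp Yt.
have f0 : 0 < Y t - be (X t) by rewrite subr_gt0.
have [e1 e10 h1] := cont_right_gt (is_derive_cont (dphi t Xt)) f0.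
have [e2 e20 [h2 _]] := der_pos_right (dX_ t) (mulr_gt0 (C0 t) Yp).
exists (Num.min e1 e2); first by rewrite lt_min e10.
move=> s /andP[ts se]; have se1 : t < s < t + e1.
  by rewrite ts (lt_le_trans se) // lerD2l ge_min lexx.
have se2 : t < s < t + e2.
  by rewrite ts (lt_le_trans se) // lerD2l ge_min lexx orbT.
split; first by apply: le_trans Xt (ltW (h2 s se2)).
by rewrite -subr_gt0; apply: h1.
Qed.

Let Yp t : 0 <= t -> 0 < Y t.
Proof. by move=> /above[Xt]; apply: lt_trans; have [] := bar Xt. Qed.

Let Xnd a b : 0 <= a -> a <= b -> X a <= X b.
Proof.
move=> a0 ab; apply: (@nondec R _ _ a b ab (fun t _ => dX_ t)) => t /andP[at_ _].
by rewrite ltW // mulr_gt0 // Yp // (le_trans a0).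
Qed.

(** If X stays bounded, so does Y; the orbit then stays in a compact part of the
    plane, where its speed dX/dt is bounded below. *)
Lemma X_unbounded K : exists2 T, 0 <= T & forall t, T <= t -> K <= X t.
Proof.
apply: contrapT => no.
have XK t : 0 <= t -> X 0 <= X t <= K.
  move=> t0; rewrite Xnd ?lexx //= leNgt; apply/negP => h; apply: no.
  by exists t => // t' tt'; apply: le_trans (ltW h) _; apply: Xnd.
have X0K : X0 <= K by have /andP[] := XK 0 (lexx _); rewrite X00.
have [b b0 hb] : exists2 b, 0 < b & forall x, X0 <= x <= K -> b <= be x.
  have cont : {within `[X0, K], continuous be}.
    apply: derivable_within_continuous => x; rewrite in_itv /= => /andP[Xx _].
    by have [_ []] := bar Xx.
  have [c cK hc] := EVT_min X0K cont.
  exists (be c); first by move: cK; rewrite in_itv /= => /andP[/bar[]].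
  by move=> x xK; apply: hc; rewrite in_itv.
have bY t : 0 <= t -> b <= Y t.
  move=> t0; have [_ h] := above t0; apply: le_trans (ltW h); apply: hb.
  by have := XK t t0; rewrite X00.
have [M hM] := @log_growth R _ _ _ X Y C 0 b K (fun t _ => dX_ t) (fun t _ => dY_ t)
  (fun t _ => C0 t) b0 bY XK.
pose D := 1 + K ^+ 2 + M ^+ 2.
have D1 : 0 < D by rewrite /D -addrA ltr_pwDl // addr_ge0 ?sqr_ge0.
pose z t := oG g sg ep t 0 2%:R.
have z0 t : 0 < z t by have [_ h _] := orb (sg * ep * t).
have zE t : (1 + X t ^+ 2 + Y t ^+ 2) * z t ^+ 2 = 1.
  have [sph _ _] := orb (sg * ep * t); move: sph; rewrite /sphere2 /= => sph.
  rewrite /X /Y /oX /oY !exprMn sg2 ep2 !mul1r -[RHS]sph /z /oG.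
  by field; rewrite gt_eqF //; exact: z0.
have z1 t : z t <= 1.
  rewrite -(@expr_le1 _ 2) //; last exact: ltW.
  rewrite -[X in _ <= X](zE t) ler_peMl ?sqr_ge0 // -addrA lerDl addr_ge0 ?sqr_ge0 //.
have zD t : 0 <= t -> D^-1 <= z t.
  move=> t0; rewrite -[D^-1]mul1r ler_pdivrMr // -(zE t).
  apply: le_trans (_ : D * z t ^+ 2 <= _).
    rewrite ler_wpM2r ?sqr_ge0 // /D !lerD //.
    - have /andP[h1 h2] := XK t t0; have x0 : 0 <= X t by rewrite (le_trans _ h1) // X00 (le_trans _ X01).
      by rewrite lerXn2r ?nnegrE // (le_trans x0).
    - have h := hM t t0; have y0 := Yp t0.
      by rewrite lerXn2r ?nnegrE ?(ltW y0) // (le_trans (ltW y0)).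
  rewrite mulrC ler_pM2r // expr2 ler_piMl // ltW //; exact: z0.
pose dd := field_degree (cherkas P0 P1 P2).
have CD t : 0 <= t -> (D^-1) ^+ dd <= C t.
  move=> t0; rewrite /C /oC -/dd ler_pdivlMr; last exact: z0.
  apply: le_trans (_ : D^-1 ^+ dd <= _).
    by rewrite ler_piMr ?exprn_ge0 ?invr_ge0 ?(ltW D1) //; exact: z1.
  by rewrite lerXn2r ?nnegrE ?invr_ge0 ?(ltW D1) //; [exact: ltW (z0 t) | exact: zD].
have e0 : 0 < (D^-1) ^+ dd * b by rewrite mulr_gt0 // exprn_gt0 // invr_gt0.
apply: (@no_decay R (fun t => t) (fun=> 1) (fun t => - X t) (fun t => - (C t * Y t)) 0
  _ (- K) e0 (fun t _ => dId t) _ (fun t _ => dN (dX_ t))).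
- by move=> L; exists (Num.max 0 L); [rewrite le_max lexx | move=> t; rewrite ge_max => /andP[]].
- move=> t t0; rewrite mulr1 lerN2; apply: ler_pM; rewrite ?CD ?bY //; last exact: ltW.
  by rewrite exprn_ge0 // invr_ge0 ltW.
- by move=> t t0; rewrite lerN2; have /andP[] := XK t t0.
Qed.

Let Xp t : 0 <= t -> 0 < X t.
Proof. by move=> /above[Xt _]; apply: lt_le_trans Xt; apply: lt_le_trans X01. Qed.

Let psi t := Y t / (X t + Y t).

(** psi = Y / (X + Y) parametrizes the lines through the origin.  On the line of slope
    r = la / (1 - la) the direction of crossing is the sign of a polynomial in X,
    whose coefficient of degree m + 2 vanishes for at most two values of la. *)
Lemma psi_cvg : exists2 l : R, 0 <= l <= 1 & psi t @[t --> +oo] --> l.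
Proof.
pose m := (size P2).-1.
pose a' := p0`_m.+2; pose b' := p1`_m.+1; pose c := p2`_m.
have sn0 : sg != 0 by rewrite -sqrf_eq0 sg2 oner_eq0.
have c0 : c != 0.
  by rewrite /c /p2 coef_flip mulf_neq0 ?expf_neq0 // -lead_coefE lead_coef_eq0.
pose E : {poly R} := a'%:P * (1 - 'X) ^+ 2 + b'%:P * 'X * (1 - 'X) + c%:P * 'X ^+ 2.
have hE x : E.[x] = a' * (1 - x) ^+ 2 + b' * x * (1 - x) + c * x ^+ 2.
  by rewrite /E !(hornerD, hornerM, hornerN, hornerXn, hornerX, hornerC, horner_exp).
have E0 : E != 0.
  by apply/eqP => z; have := hE 1; rewrite z horner0 subrr => /esym/eqP;
    rewrite expr0n expr1n /= !mulr0 !add0r mulr1 (negPf c0).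
have psi01 t : 0 <= t -> 0 <= psi t <= 1.
  move=> t0; have xp := Xp t0; have yp := Yp t0; have xy : 0 < X t + Y t by rewrite addr_gt0.
  rewrite /psi divr_ge0 ?(ltW yp) ?(ltW xy) //= ler_pdivrMr // mul1r; lra.
have [|l l01 hl] := eventually_cvg E0 psi01.
  move=> la /andP[la0 la1] Ela.
  have l1 : 0 < 1 - la by rewrite subr_gt0.
  pose r := la / (1 - la).
  pose H : {poly R} := (1 - la) *: (p0 + r *: (p1 * 'X) + r ^+ 2 *: (p2 * 'X^2)) - (la * r) *: 'X.
  have hH x : H.[x] = (1 - la) * (p0.[x] + p1.[x] * (r * x) + p2.[x] * (r * x) ^+ 2) - la * (r * x).
    rewrite /H !(hornerD, hornerN, hornerZ, hornerM, hornerXn, hornerX); ring.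
  have H0 : H != 0.
    apply/eqP => z; have := congr1 (fun p : {poly R} => p`_m.+2) z.
    rewrite coef0 /H coefB !coefZ !coefD !coefZ coefMX coefMXn coefX /=.
    rewrite !subSS subn0 -/a' -/b' -/c mulr0 subr0 => e.
    case/eqP: Ela; rewrite hE.
    have -> : la = r * (1 - la) by rewrite /r divfK // gt_eqF.
    transitivity ((1 - la) * ((1 - la) * (a' + r * b' + r ^+ 2 * c)) : R); last by rewrite e mulr0.
    have er : 1 - r * (1 - la) = 1 - la by rewrite /r divfK // gt_eqF.
    by rewrite er; ring.
  have [K hK] := poly_eventually_sign H0; set s := Num.sg (lead_coef H) in hK.
  have [T T0 hT] := X_unbounded K.
  have s1 : s = 1 \/ s = -1.
    by have := sgsq (_ : lead_coef H != 0); rewrite lead_coef_eq0 => /(_ H0) /eqP;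
      rewrite sqrf_eq1 => /orP[] /eqP; [left | right].
  pose D t := s * ((1 - la) * Y t - la * X t).
  pose D' t := 0 * ((1 - la) * Y t - la * X t) + s *
    ((0 * Y t + (1 - la) * (C t * (p0.[X t] + p1.[X t] * Y t + p2.[X t] * Y t ^+ 2)))
    - (0 * X t + la * (C t * Y t))).
  have dD_ t : T <= t -> is_derive t (1 : R) D (D' t).
    move=> _; exact: (dM (dC s t) (dB (dM (dC _ t) (dY_ t)) (dM (dC _ t) (dX_ t)))).
  have Dpos t : T <= t -> D t = 0 -> 0 < D' t.
    move=> Tt Dz.
    have Yr : Y t = r * X t.
      have : s != 0 by rewrite sgr_eq0 lead_coef_eq0.
      move=> sn; have : (1 - la) * Y t - la * X t = 0.
        by apply: (mulfI sn); rewrite mulr0.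
      move/eqP; rewrite subr_eq0 => /eqP e; rewrite /r mulrAC -e mulrC mulKf //.
      by rewrite gt_eqF.
    have -> : D' t = C t * (s * H.[X t]) by rewrite hH /D' -Yr; ring.
    by rewrite mulr_gt0 // hK // hT.
  have trans t : T <= t -> (0 <= (1 - la) * Y t - la * X t -> la <= psi t) /\
      ((1 - la) * Y t - la * X t <= 0 -> psi t <= la).
    move=> Tt; have t0 := le_trans T0 Tt.
    have xy : 0 < X t + Y t by rewrite addr_gt0 ?Xp ?Yp.
    by rewrite /psi; split=> h; rewrite ?ler_pdivlMr ?ler_pdivrMr //; lra.
  have [[T' TT' h]|h] := eventually_sign dD_ Dpos.
    case: s1 => es; [left | right]; exists T'; try exact: le_trans TT';
      move=> t tT'; have [h1 h2] := trans t (le_trans TT' tT'); [apply: h1 | apply: h2];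
      have := h t tT'; rewrite /D es; lra.
  case: s1 => es; [right | left]; exists T => // t tT;
    have [h1 h2] := trans t tT; [apply: h2 | apply: h1];
    have := h t tT; rewrite /D es; lra.
exists l => //; apply/cvgrPdist_le => e e0.
apply/near_pinftyE; have [T T0 h] := hl e e0; exists T => // t /h.
by rewrite distrC.
Qed.

(** On the sphere the orbit is determined by psi and by its height z, which is at
    most 1 / X. *)
Lemma built_orbit_converges : exists q : 'rV[R]_3,
  [/\ sphere2 q, q 0 2%:R = 0 & tends (sg * ep) g q].
Proof.
have [l /andP[l0 l1] cpsi] := psi_cvg.
pose nn := (1 - l) ^+ 2 + l ^+ 2.
have nn0 : 0 < nn.
  rewrite lt_neqAle eq_sym addr_ge0 ?sqr_ge0 // andbT; apply/eqP => z.
  have : 0 <= (1 - 2 * l) ^+ 2 by exact: sqr_ge0.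
  by move: z; rewrite /nn; lra.
pose z t : R := oG g sg ep t 0 2%:R.
have z0 t : 0 < z t by have [_ h _] := orb (sg * ep * t).
have gx t : oG g sg ep t 0 0 = sg * (X t * z t).
  by rewrite /X /oX -/(z t) mulrA mulrA -expr2 sg2 mul1r divfK // gt_eqF.
have gy t : oG g sg ep t 0 1 = ep * (Y t * z t).
  by rewrite /Y /oY -/(z t) mulrA mulrA -expr2 ep2 mul1r divfK // gt_eqF.
have sph t : (X t * z t) ^+ 2 + (Y t * z t) ^+ 2 + z t ^+ 2 = 1.
  have [sph _ _] := orb (sg * ep * t); move: sph; rewrite /sphere2 /=.
  by rewrite -/(oG g sg ep t) gx gy [(sg * _) ^+ 2]exprMn [(ep * _) ^+ 2]exprMn sg2 ep2 !mul1r.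
have cz : z t @[t --> +oo] --> (0 : R).
  apply/cvgrPdist_le => e e0; apply/near_pinftyE.
  have [T T0 h] := X_unbounded e^-1; exists T => // t Tt.
  have t0 := le_trans T0 Tt.
  rewrite sub0r normrN gtr0_norm //.
  have eX : 1 <= e * X t by rewrite -ler_pdivrMl // mulr1; exact: h.
  have Xz : X t * z t <= 1.
    have xz0 : 0 <= X t * z t by rewrite mulr_ge0 // ltW // Xp.
    rewrite -(@expr_le1 _ 2) // -(sph t) -addrA lerDl addr_ge0 ?sqr_ge0 //.
  apply: le_trans (_ : e * X t * z t <= _); first by rewrite ler_peMl // ltW.
  by rewrite -mulrA ler_piMr // ltW.
pose w t := Num.sqrt ((1 - z t * z t) / ((1 - psi t) * (1 - psi t) + psi t * psi t)).
have cw : w t @[t --> +oo] --> Num.sqrt ((1 - 0 * 0) / nn).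
  have c1 : (1 - psi t) @[t --> +oo] --> 1 - l by apply: cvgB => //; exact: cvg_cst.
  have inner : ((1 - z t * z t) / ((1 - psi t) * (1 - psi t) + psi t * psi t)) @[t --> +oo]
      --> (1 - 0 * 0) / nn.
    apply: cvgM; first by apply: cvgB; [exact: cvg_cst | exact: cvgM].
    apply: cvgV; first by rewrite gt_eqF.
    by rewrite /nn !expr2; apply: cvgD; apply: cvgM.
  exact: (cvg_comp _ _ inner (@sqrt_continuous R _)).
set w0 := Num.sqrt _ in cw.
have wE t : 0 <= t -> w t = (X t + Y t) * z t.
  move=> t0; have xp := Xp t0; have yp := Yp t0; have xy : 0 < X t + Y t by rewrite addr_gt0.
  rewrite /w -[RHS]ger0_norm; last by rewrite mulr_ge0 // ltW.
  rewrite -sqrtr_sqr; congr Num.sqrt.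
  have -> : 1 - z t * z t = (X t * z t) ^+ 2 + (Y t * z t) ^+ 2 by rewrite -(sph t); ring.
  rewrite /psi; field; rewrite gt_eqF //=.
  have -> : X t + Y t - Y t = X t by ring.
  by rewrite gt_eqF // addr_gt0 // mulr_gt0.
pose q : 'rV[R]_3 := \row_i [:: sg * ((1 - l) * w0); ep * (l * w0); 0]`_i.
have w02 : w0 ^+ 2 = nn^-1.
  by rewrite /w0 mul0r subr0 mul1r sqr_sqrtr // invr_ge0 ltW.
exists q; split.
- rewrite /sphere2 /= !mxE /= !exprMn sg2 ep2 w02 !mul1r expr0n /= addr0.
  by rewrite -mulrDl divff // gt_eqF.
- by rewrite mxE.
have c0 : oG g sg ep t 0 0 @[t --> +oo] --> q 0 0.
  rewrite mxE /=.
  have : (sg * ((1 - psi t) * w t)) @[t --> +oo] --> sg * ((1 - l) * w0).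
    apply: cvgM; first exact: cvg_cst.
    by apply: cvgM => //; apply: cvgB => //; exact: cvg_cst.
  apply: cvg_trans; apply: near_eq_cvg; apply/near_pinftyE; exists 0 => // t t0.
  rewrite gx wE // /psi; field; rewrite gt_eqF // addr_gt0 ?Xp ?Yp //.
have c1 : oG g sg ep t 0 1 @[t --> +oo] --> q 0 1.
  rewrite mxE /=.
  have : (ep * (psi t * w t)) @[t --> +oo] --> ep * (l * w0).
    by apply: cvgM; [exact: cvg_cst | exact: cvgM].
  apply: cvg_trans; apply: near_eq_cvg; apply/near_pinftyE; exists 0 => // t t0.
  rewrite gy wE // /psi; field; rewrite gt_eqF // addr_gt0 ?Xp ?Yp //.
move=> e e0.
move/cvgrPdist_le: c0 => /(_ e e0) /near_pinftyE[T0 T00 h0].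
move/cvgrPdist_le: c1 => /(_ e e0) /near_pinftyE[T1 T10 h1].
move/cvgrPdist_le: cz => /(_ e e0) /near_pinftyE[T2 T20 h2].
exists (Num.max T0 (Num.max T1 T2)); first by rewrite le_max T00.
move=> t; rewrite !ge_max => /and3P[/h0 a0 /h1 a1 /h2 a2] i.
rewrite distrC; have : [\/ i = 0, i = 1 | i = 2%:R].
  by case: i => -[|[|[|//]]] hi; [constructor 1|constructor 2|constructor 3]; apply/val_inj.
case=> ->; [exact: a0 | exact: a1 |].
by have -> : q 0 2%:R = 0 by rewrite mxE.
Qed.
End Build.

(** The orbit starts one unit above the barrier. *)
Lemma barrier_nonmonodromic P0 P1 P2 (sg ep : R) : sg ^+ 2 = 1 -> ep ^+ 2 = 1 -> P2 != 0 ->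
  barrier (flip sg P0) (ep *: flip sg P1) (flip sg P2) ->
  ~ monodromic_at_infinity (cherkas P0 P1 P2).
Proof.
move=> sg2 ep2 P2n [be [be' [X0' bar']]].
pose X0 := Num.max 1 X0'.
have X01 : 1 <= X0 by rewrite le_max lexx.
have bar x : X0 <= x -> [/\ 0 < be x, is_derive x (1 : R) be (be' x) &
       0 < (flip sg P0).[x] + (ep *: flip sg P1).[x] * be x + (flip sg P2).[x] * be x ^+ 2 - be x * be' x].
  by rewrite ge_max => /andP[_ /bar'].
pose Y0 := be X0 + 1.
have beX0 : 0 < be X0 by have [] := bar X0 (lexx _).
pose D := 1 + X0 ^+ 2 + Y0 ^+ 2.
have D0 : 0 < D by rewrite /D -addrA ltr_pwDl // addr_ge0 ?sqr_ge0.
pose N := Num.sqrt D.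
have N0 : 0 < N by rewrite sqrtr_gt0.
have N2 : N ^+ 2 = D by rewrite sqr_sqrtr // ltW.
pose q0 : 'rV[R]_3 := \row_i [:: sg * X0 / N; ep * Y0 / N; N^-1]`_i.
have [||g [g0 orb]] := @finite_orbit_exists R (cherkas P0 P1 P2) q0.
- rewrite /sphere2 /= !mxE /= !exprMn sg2 ep2 !mul1r exprVn N2.
  by rewrite /D; field; rewrite gt_eqF.
- by rewrite mxE /= invr_gt0.
have oX0 : oX g sg ep 0 = X0.
  rewrite /oX /oG mulr0 g0 !mxE /= invrK divfK ?gt_eqF //.
  by rewrite mulrA -expr2 sg2 mul1r.
have oY0 : oY g sg ep 0 = Y0.
  rewrite /oY /oG mulr0 g0 !mxE /= invrK divfK ?gt_eqF //.
  by rewrite mulrA -expr2 ep2 mul1r.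
have Y00 : be X0 < oY g sg ep 0 by rewrite oY0 /Y0 ltrDl.
have [q [qs q2 lim]] := built_orbit_converges sg2 ep2 P2n X01 bar orb oX0 Y00.
have tau2 : (sg * ep) ^+ 2 = 1 by rewrite exprMn sg2 ep2 mulr1.
apply; exists g, q; split => //.
  by split => //; apply: (orbit_limit_equilibrium tau2 orb lim).
apply/tends_cvg.
move/eqP: tau2; rewrite sqrf_eq1 => /orP[] /eqP e; rewrite e in lim; [by left | by right].
Qed.
End FromBarrier.

(** * The characterization *)

Section Leading.
Variable R : realType.

Lemma flip_neq0 (sg : R) P : sg ^+ 2 = 1 -> P != 0 -> flip sg P != 0.
Proof.
move=> sg2; apply: contraNneq => z; apply/eqP/polyP => i; rewrite coef0.
have sn : sg != 0 by rewrite -sqrf_eq0 sg2 oner_eq0.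
have := congr1 (fun p : {poly R} => p`_i) z; rewrite coef_flip coef0 => /eqP.
by rewrite mulf_eq0 expf_eq0 (negPf sn) andbF /= => /eqP.
Qed.

Lemma qs_neq0 n (p : {poly R}) : (size p <= n.+1)%N -> p != 0 -> qs n p != 0.
Proof.
move=> sp p0; have [S kn [lead _]] := lead_data sp.
apply/eqP => z; have := lead p0; rewrite -(qs_at0 (size p).-1 p).
move: z; rewrite (qs_shift S kn) => z.
have -> : qs (size p).-1 p = 0.
  by apply: (@sXn_inj R (2 * (n - (size p).-1))); rewrite z mulr0.
by rewrite ser0 eqxx.
Qed.

(** For be = |K| the residual is a polynomial in x of degree n with positive leading
    coefficient. *)
Lemma const_barrier n (P0 P1 P2 : {poly R}) (sg K : R) :
  (size P0 <= n.+1)%N -> (size P1 <= n.+1)%N -> (size P2 <= n.+1)%N -> K != 0 ->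
  0 < sg ^+ n.+1 * (P0`_n + P1`_n * K + P2`_n * K ^+ 2) ->
  exists ep : R, ep ^+ 2 = 1 /\ barrier (flip sg P0) (ep *: flip sg P1) (flip sg P2).
Proof.
move=> s0 s1 s2 K0 pos.
pose q := flip sg P0 + K *: flip sg P1 + K ^+ 2 *: flip sg P2.
have [||X0 hq] := @poly_pos_infty R n q.
- have sf (P : {poly R}) c : (size P <= n.+1)%N -> (size (c *: flip sg P)%R <= n.+1)%N.
    by move=> sP; rewrite (leq_trans (size_scale_leq _ _)) // (leq_trans (size_flip _ _)).
  rewrite (leq_trans (size_polyD _ _)) // geq_max sf // andbT.
  by rewrite (leq_trans (size_polyD _ _)) // geq_max sf // andbT (leq_trans (size_flip _ _)).
- rewrite !coefD !coefZ !coef_flip.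
  by apply: lt_le_trans pos _; rewrite le_eqVlt; apply/orP; left; apply/eqP; ring.
exists (Num.sg K); split; first exact: sgsq.
exists (fun=> `|K|), (fun=> 0), X0 => x Xx; split; first by rewrite normr_gt0.
  exact: dC.
move: (hq x Xx); rewrite /q !(hornerD, hornerZ) mulr0 subr0 real_normK ?num_real //.
have -> : Num.sg K * (flip sg P1).[x] * `|K| = K * (flip sg P1).[x].
  by rewrite mulrAC -numEsg.
by rewrite [(flip sg P2).[x] * _]mulrC.
Qed.

Lemma quad_le0 (a b c : R) : a ^+ 2 + b ^+ 2 + c ^+ 2 <> 0 ->
  (forall K, K != 0 -> a + b * K + c * K ^+ 2 <= 0) ->
  [/\ c = 0, b = 0 & a < 0] \/ (c < 0 /\ b ^+ 2 - 4 * a * c <= 0).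
Proof.
move=> nz le.
have cle : c <= 0.
  rewrite leNgt; apply/negP => c0.
  pose K := 1 + `|a| / c; have ac : 0 <= `|a| / c by rewrite divr_ge0 // ltW.
  have K1 : 1 <= K by rewrite /K; lra.
  have Kn : K != 0 by rewrite gt_eqF //; lra.
  have := le K Kn; have := le (- K); rewrite oppr_eq0 Kn sqrrN => /(_ isT).
  have cK : c * K = c + `|a| by rewrite /K mulrDr mulr1 [_ * (_ / _)]mulrC divfK // gt_eqF.
  have : c * K <= c * K ^+ 2 by rewrite ler_pM2l // expr2 ler_peMl //; lra.
  have := ler_norm (- a); rewrite normrN cK; lra.
have [c0|cn] := eqVneq c 0.
  have [b0|bn] := eqVneq b 0.
    left; split => //; have := le 1 (oner_neq0 _); rewrite c0 b0 !mul0r !addr0 => a0.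
    rewrite lt_neqAle a0 andbT; apply/eqP => z; apply: nz.
    by rewrite z b0 c0 expr0n /= !addr0.
  exfalso; have an : 0 < `|a| + 1 by rewrite ltr_wpDl.
  have Kn : (`|a| + 1) / b != 0 by rewrite mulf_neq0 ?invr_eq0 // gt_eqF.
  have := le _ Kn.
  rewrite c0 mul0r addr0 mulrC divfK //; have := ler_norm (- a); rewrite normrN; lra.
have clt : c < 0 by rewrite lt_neqAle cn.
right; split => //.
have [b0|bn] := eqVneq b 0.
  rewrite b0 expr0n /= sub0r oppr_le0 -mulrA mulr_ge0 // mulr_le0 //.
  rewrite leNgt; apply/negP => a0.
  have d0 : 0 < a / (- 2 * c) by rewrite divr_gt0 //; lra.
  have := le (Num.sqrt (a / (- 2 * c))); rewrite sqrtr_eq0 -ltNge d0 => /(_ isT).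
  rewrite sqr_sqrtr ?(ltW d0) // b0 mul0r addr0.
  have -> : c * (a / (- 2 * c)) = - (a / 2) by field.
  lra.
have c2 : 2 * c != 0 by rewrite mulf_neq0 // pnatr_eq0.
have Kn : - b / (2 * c) != 0 by rewrite mulf_neq0 ?oppr_eq0 ?invr_eq0.
have := le _ Kn.
have -> : a + b * (- b / (2 * c)) + c * (- b / (2 * c)) ^+ 2 = (b ^+ 2 - 4 * a * c) / (- 4 * c) by field.
by rewrite ler_pdivrMr ?mul0r //; lra.
Qed.
End Leading.

Theorem theorem2p1 (R : realType) (n : nat) (P0 P1 P2 : {poly R})
  (sP0 : (size P0 <= n.+1)%N) (sP1 : (size P1 <= n.+1)%N)
  (sP2 : (size P2 <= n.+1)%N)
  (hn : P0`_n ^+ 2 + P1`_n ^+ 2 + P2`_n ^+ 2 <> 0)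
  (hP0 : P0 <> 0) (hP2 : P2 <> 0) :
  monodromic_at_infinity (cherkas P0 P1 P2) <->
  odd n /\
  ( [/\ P2`_n = 0, P1`_n = 0, P0`_n < 0 &
        ~ exists (neg : bool) (f : fps R),
            [/\ f 0%N = 0, (exists k : nat, f k <> 0) &
                formal_invariant_curve (X0 n P0 P1 P2) neg f]]
  \/ (P2`_n < 0 /\ P1`_n ^+ 2 - 4 * P0`_n * P2`_n < 0)
  \/ [/\ P2`_n < 0, P1`_n ^+ 2 - 4 * P0`_n * P2`_n = 0 &
        ~ exists (neg : bool) (f : fps R),
            f 0%N = 0 /\ formal_invariant_curve (Y0 n P0 P1 P2) neg f] ).
Proof.
have P0n : P0 != 0 by apply/eqP.
have P2n : P2 != 0 by apply/eqP.
have sf sg (P : {poly R}) : (size P <= n.+1)%N -> (size (flip sg P) <= n.+1)%N.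
  by move=> sP; rewrite (leq_trans (size_flip _ _)).
split=> [mono|[nodd cases]].
- have nobar sg ep : sg ^+ 2 = 1 -> ep ^+ 2 = 1 ->
      ~ barrier (flip sg P0) (ep *: flip sg P1) (flip sg P2).
    by move=> sg2 ep2 /(barrier_nonmonodromic sg2 ep2 P2n).
  have noK sg K : sg ^+ 2 = 1 -> K != 0 ->
      sg ^+ n.+1 * (P0`_n + P1`_n * K + P2`_n * K ^+ 2) <= 0.
    move=> sg2 K0; rewrite leNgt; apply/negP => /(const_barrier sP0 sP1 sP2 K0)[ep [ep2]].
    exact: nobar.
  have nodd : odd n.
    apply: contraT => even.
    have qz K : K != 0 -> P0`_n + P1`_n * K + P2`_n * K ^+ 2 = 0.
      move=> K0; set q := _ + _ + _; apply/eqP; rewrite eq_le.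
      have e1 : (1 : R) ^+ 2 = 1 by rewrite expr1n.
      have e2 : (-1 : R) ^+ 2 = 1 by rewrite sqrrN expr1n.
      have := noK 1 K e1 K0; have := noK (-1) K e2 K0.
      by rewrite -/q -signr_odd /= even expr1n expr1 mulN1r mul1r oppr_le0 => -> ->.
    case: hn; have := qz 1 (oner_neq0 _); have := qz (-1); have := qz 2.
    rewrite oppr_eq0 oner_eq0 pnatr_eq0 => /(_ isT) h2 /(_ isT) h1 h0.
    have c0 : P2`_n = 0 by lra.
    have b0 : P1`_n = 0 by lra.
    have a0 : P0`_n = 0 by lra.
    by rewrite a0 b0 c0 expr0n /= !addr0.
  split => //.
  have sgn (neg : bool) : ((-1) ^+ neg : R) ^+ 2 = 1 by rewrite sqrr_sign.
  have [K K0|[c0 b0 a0]|[c0 disc]] := quad_le0 hn.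
  + by have := noK 1 K (expr1n _ _) K0; rewrite expr1n mul1r.
  + left; split => //; move=> [neg [f [f0 [k fk] /(formal_X0 neg nodd) eq]]].
    have [||ep [ep2 bar]] := formal_barrier (sf _ _ sP0) (sf _ _ sP1) (sf _ _ sP2) _ _ eq.
    * exact: oner_neq0.
    * by apply/eqP => z; apply: fk; rewrite z; exact: ser0.
    exact: (nobar _ _ (sgn neg) ep2 bar).
  + right; move: disc; rewrite le_eqVlt => /orP[/eqP disc|disc]; last by left.
    right; split => //; move=> [neg [f [f0 /(formal_Y0 neg nodd) eq]]].
    have [||ep [ep2 bar]] := formal_barrier (sf _ _ sP0) (sf _ _ sP1) (sf _ _ sP2) _ _ eq.
    * apply/eqP => z; move: eq; rewrite z /orbit_form => /eqP.
      rewrite expr1n !mulr1 mulr0 mul0r !mul1r expr0n /= !mulr0 !addr0 add0r.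
      by rewrite (negPf (qs_neq0 (sf _ _ sP0) (flip_neq0 (sgn neg) P0n))).
    * exact: oner_neq0.
    exact: (nobar _ _ (sgn neg) ep2 bar).
apply: contrapT => /(nonmonodromic_end_sol P0n)[sg [ep [sg2 ep2 sol]]].
have sgn1 : sg ^+ n.+1 = 1.
  have -> : n.+1 = (2 * n.+1./2)%N by rewrite mul2n -[LHS]odd_double_half /= nodd.
  by rewrite exprM sg2 expr1n.
have [neg sgE] : exists neg : bool, sg = (-1) ^+ neg.
  move/eqP: sg2; rewrite sqrf_eq1 => /orP[] /eqP ->; first by exists false.
  by exists true; rewrite expr1.
have n0 : (0 < n)%N by case: (n) nodd.
have cf P : (flip sg P)`_n = P`_n by rewrite coef_flip sgn1 mul1r.
have S1 : (size (ep *: flip sg P1)%R <= n.+1)%N.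
  by rewrite (leq_trans (size_scale_leq _ _)) // sf.
have ce : (ep *: flip sg P1)`_n = ep * P1`_n by rewrite coefZ cf.
have ee : sC ep * sC ep = 1 by rewrite -sCM -expr2 ep2 sC1.
have en : ep != 0 by rewrite -sqrf_eq0 ep2 oner_eq0.
case: cases => [[c0 b0 a0 nof]|[[c0 disc]|[c0 disc nof]]].
- have [||||f [f0 [k fk] ef]] := end_sol_formal_unbounded n0 (sf _ _ sP0) S1 (sf _ _ sP2) _ _ _ _ sol.
  + by rewrite cf.
  + by rewrite ce b0 mulr0.
  + by rewrite cf.
  + exact: flip_neq0.
  apply: nof; exists neg, (sC ep * f); split.
  + by rewrite coef_sCM f0 mulr0.
  + by exists k; rewrite coef_sCM => /eqP; rewrite mulf_eq0 (negPf en) /= => /eqP.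
  apply/(formal_X0 neg nodd); rewrite -sgE.
  rewrite (@orbit_form_sign R n ep _ _ _ _ _ ep2) mulr1 in ef.
  by rewrite -ee orbit_formZ ef mulr0.
- apply: (no_end_sol_of_neg_disc (sf _ _ sP0) S1 (sf _ _ sP2) _ _ _ sol).
  + by rewrite mul2n addnn.
  + by rewrite cf.
  + by rewrite mul2n addnn eqxx ce !cf exprMn ep2 mul1r -subr_lt0.
have [|||f [f0 ef]] := end_sol_formal_bounded n0 (sf _ _ sP0) S1 (sf _ _ sP2) _ _ _ sol.
- by rewrite cf.
- by rewrite ce !cf exprMn ep2 mul1r; apply/eqP; rewrite -subr_eq0 disc.
- exact: flip_neq0.
apply: nof; exists neg, (sC ep * f - sC (- P1`_n / (2 * P2`_n))); split.
  rewrite serB coef_sCM sCE /= f0 ce cf.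
  transitivity ((ep ^+ 2 - 1) * (- P1`_n / (2 * P2`_n))); last by rewrite ep2 subrr mul0r.
  by ring.
apply/(formal_Y0 neg nodd); rewrite -sgE.
rewrite subrK; by rewrite (@orbit_form_sign R n ep _ _ _ _ _ ep2) in ef.
Qed.
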